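(* Let $Q\subset\mathbb{H}^3$ be an all-right hyperbolic polyhedron, with a vertex at $\infty$, and with all vertices ideal. Let $G$ be the group of reflections in $Q$ (generated by the reflections of $\mathbb{H}^3$ in the faces of $Q$). Then $G$ contains a subgroup of index $4$ which admits a DF domain.
   Context: $\mathbb{H}^3$ is upper half-space $\mathbb{C}\times(0,\infty)$ with hyperbolic distance $d$; orientation-preserving isometries are identified with $\mathrm{PSL}_2(\mathbb{C})$. A Kleinian group is a discrete subgroup of $\mathrm{PSL}_2(\mathbb{C})$. Polyhedra are convex, finite-sided and of finite volume; ''all-right'' means that every dihedral angle is $\pi/2$. A fundamental domain for a Kleinian group $\Gamma$ is a closed convex polyhedron whose $\Gamma$-translates cover $\mathbb{H}^3$ and whose interior is disjoint from its translates by nontrivial elements of $\Gamma$. The Dirichlet domain of $\Gamma$ centered at $w_0\in\mathbb{H}^3$ is $\{x\in\mathbb{H}^3: d(x,w_0)\le d(x,\alpha(w_0))\ \forall\,1\ne\alpha\in\Gamma\}$. Ford domain: suppose the stabilizer $\Gamma_\infty<\Gamma$ of $\infty$ contains a copy of $\mathbb{Z}^2$. For $\gamma=\pm\begin{pmatrix}a&b\\c&d\end{pmatrix}\in\Gamma\setminus\Gamma_\infty$, the isometric sphere $S_\gamma$ is the hemisphere in $\mathbb{H}^3$ with center $-d/c\in\mathbb{C}$ and radius $1/|c|$. A Ford domain is the intersection of the set of points lying on or outside all isometric spheres $S_\gamma$, $\gamma\in\Gamma\setminus\Gamma_\infty$, with a fundamental domain for the action of $\Gamma_\infty$ that is the vertical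 chimney above a fundamental polygon for $\Gamma_\infty$ acting on $\mathbb{C}$. A DF domain for a Kleinian group $\Gamma$ is a fundamental domain for $\Gamma$ which is both a Ford domain and a Dirichlet domain for some center in $\mathbb{H}^3$. (Thus a subgroup admitting a DF domain is in particular a Kleinian group, consisting of orientation-preserving isometries.) *)

(* Defs.v *)
From HB Require Import structures.
From mathcomp Require Import all_boot all_order all_algebra.
From mathcomp Require Import complex.
From mathcomp Require Import all_classical all_reals all_analysis.

Set Implicit Arguments.
Unset Strict Implicit.
Unset Printing Implicit Defensive.

Import Order.TTheory GRing.Theory Num.Theory.
Import numFieldNormedType.Exports.

Local Open Scope classical_set_scope.
Local Open Scope ring_scope.

(** * Hyperbolic 3-space: the upper half-space C x (0, +oo) *)

Notation normc := (@ComplexField.Normc.normc _).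
Notation cRe := (@complex.Re _).
Notation cIm := (@complex.Im _).

Record h3 (R : realType) := H3 {
  zc : R[i];
  ht : R;
  ht_gt0 : 0 < ht }.

Definition arcosh {R : realType} (u : R) : R := ln (u + Num.sqrt (u ^+ 2 - 1)).

Definition hdist {R : realType} (x y : h3 R) : R :=
  arcosh (1 + (normc (zc x - zc y) ^+ 2 + (ht x - ht y) ^+ 2)
              / (2 * ht x * ht y)).

Definition hinterior {R : realType} (X : set (h3 R)) : set (h3 R) :=
  [set x | exists2 e : R, 0 < e & forall y, hdist x y < e -> X y].

(* The volume form is dx dy dt / t^3. *)
Definition hvolume {R : realType} (X : set (h3 R)) : \bar R :=
  (\int[(lebesgue_measure \x lebesgue_measure) \x lebesgue_measure]_(p in
      [set (cRe (zc x), cIm (zc x), ht x) | x in X])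
    ((p.2 ^+ 3)^-1)%:E)%E.

(** * Half-spaces, their bounding planes, and reflections *)

(* [Vertical n c] is { Re (conj n * z) <= c }; [Inside p r] and [Outside p r]
   are bounded by the hemisphere with center p in C and radius r. *)
Inductive halfspace (R : realType) :=
| Vertical (n : R[i]) (c : R) of n != 0
| Inside (p : R[i]) (r : R) of 0 < r
| Outside (p : R[i]) (r : R) of 0 < r.

Definition cdot {R : realType} (n z : R[i]) : R := cRe (conjc n * z).

(* Squared Euclidean distance from x to the point p of C. *)
Definition sqdist {R : realType} (p : R[i]) (x : h3 R) : R :=
  normc (zc x - p) ^+ 2 + ht x ^+ 2.

Lemma sqdist_gt0 (R : realType) (p : R[i]) (x : h3 R) : 0 < sqdist p x.
Proof. by rewrite ltr_wpDl ?sqr_ge0 // exprn_gt0 // ht_gt0. Qed.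

Definition hs_set {R : realType} (h : halfspace R) : set (h3 R) :=
  match h with
  | Vertical n c _ => [set x | cdot n (zc x) <= c]
  | Inside p r _ => [set x | sqdist p x <= r ^+ 2]
  | Outside p r _ => [set x | r ^+ 2 <= sqdist p x]
  end.

Definition hs_plane {R : realType} (h : halfspace R) : set (h3 R) :=
  match h with
  | Vertical n c _ => [set x | cdot n (zc x) = c]
  | Inside p r _ | Outside p r _ => [set x | sqdist p x = r ^+ 2]
  end.

(* Euclidean reflection in a vertical plane. *)
Definition vrefl {R : realType} (n : R[i]) (c : R) (x : h3 R) : h3 R :=
  H3 (zc x - (2 * (cdot n (zc x) - c) / normc n ^+ 2)%:C%C * n) (ht_gt0 x).

Lemma inversion_gt0 (R : realType) (p : R[i]) (r : R) (x : h3 R) :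
  0 < r -> 0 < r ^+ 2 / sqdist p x * ht x.
Proof.
by move=> r0; rewrite mulr_gt0 ?ht_gt0 // divr_gt0 ?exprn_gt0 ?sqdist_gt0.
Qed.

Definition inversion {R : realType} (p : R[i]) (r : R) (r0 : 0 < r) (x : h3 R) :
    h3 R :=
  H3 (p + (r ^+ 2 / sqdist p x)%:C%C * (zc x - p)) (inversion_gt0 p x r0).

Definition reflection {R : realType} (h : halfspace R) : h3 R -> h3 R :=
  match h with
  | Vertical n c _ => vrefl n c
  | Inside p r r0 | Outside p r r0 => inversion p r0
  end.

(** * Polyhedra *)

Definition polyhedron {R : realType} (Q : set (h3 R)) : Prop :=
  [/\ exists (m : nat) (h : 'I_m -> halfspace R),
        Q = [set x | forall i, hs_set (h i) x],
      hinterior Q !=set0 &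
      (hvolume Q < +oo)%E].

(* [h] is the half-space containing [Q] on a 2-dimensional face of [Q]. *)
Definition face {R : realType} (Q : set (h3 R)) (h : halfspace R) : Prop :=
  Q `<=` hs_set h /\
  exists x, [/\ Q x, hs_plane h x &
    exists2 e : R, 0 < e & forall y, hs_plane h y -> hdist x y < e -> Q y].

(* Two distinct faces meeting along an edge, i.e. in more than one point. *)
Definition adjacent {R : realType} (Q : set (h3 R)) (h k : halfspace R) : Prop :=
  [/\ face Q h, face Q k, hs_plane h <> hs_plane k &
    exists x y, x <> y /\ [set x; y] `<=` Q `&` hs_plane h `&` hs_plane k].

(* A Euclidean normal vector to the bounding plane at x, pointing out of the
   half-space. *)
Definition outward {R : realType} (h : halfspace R) (x : h3 R) : R[i] * R :=
  match h with
  | Vertical n _ _ => (n, 0)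
  | Inside p _ _ => (zc x - p, ht x)
  | Outside p _ _ => (p - zc x, - ht x)
  end.

Definition dot3 {R : realType} (u v : R[i] * R) : R :=
  cdot u.1 v.1 + u.2 * v.2.

(* The upper half-space model is conformal, so angles are Euclidean; the
   dihedral angle is the supplement of the angle between outward normals. *)
Definition dihedral_angle {R : realType} (h k : halfspace R) (x : h3 R) : R :=
  let u := outward h x in let v := outward k x in
  pi - acos (dot3 u v / (Num.sqrt (dot3 u u) * Num.sqrt (dot3 v v))).

Definition all_right {R : realType} (Q : set (h3 R)) : Prop :=
  forall h k x, adjacent Q h k -> Q x -> hs_plane h x -> hs_plane k x ->
    dihedral_angle h k x = pi / 2.

(* The vertices of [Q] in hyperbolic space are its 0-dimensional faces. *)
Definition finite_vertex {R : realType} (Q : set (h3 R)) (x : h3 R) : Prop :=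
  Q x /\
  \bigcap_(h in [set h | face Q h /\ hs_plane h x]) hs_plane h = [set x].

Definition all_vertices_ideal {R : realType} (Q : set (h3 R)) : Prop :=
  forall x, ~ finite_vertex Q x.

(* The ideal vertices of a polyhedron of finite volume are the points of its
   closure at infinity. *)
Definition ideal_vertex_at_infinity {R : realType} (Q : set (h3 R)) : Prop :=
  forall M : R, exists2 x, Q x & M < sqdist 0 x.

(** * Groups of transformations of hyperbolic space *)

Definition is_group {R : realType} (G : set (h3 R -> h3 R)) : Prop :=
  [/\ G id,
      forall f g, G f -> G g -> G (f \o g) &
      forall f, G f -> exists g, [/\ G g, f \o g = id & g \o f = id]].

Definition reflection_group {R : realType} (Q : set (h3 R)) :
    set (h3 R -> h3 R) :=
  smallest (@is_group R) [set reflection h | h in face Q].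

Definition left_cosets {R : realType} (G H : set (h3 R -> h3 R)) :
    set (set (h3 R -> h3 R)) :=
  [set [set g \o f | f in H] | g in G].

Definition subgroup_of_index {R : realType} (n : nat)
    (H G : set (h3 R -> h3 R)) : Prop :=
  [/\ is_group H, H `<=` G & (left_cosets G H #= `I_n)%card].

Record sl2 (R : realType) := SL2 {
  sl2_mx :> 'M[R[i]]_2;
  det_sl2 : \det sl2_mx = 1 }.

Definition ma {R : realType} (M : sl2 R) : R[i] := sl2_mx M 0 0.
Definition mb {R : realType} (M : sl2 R) : R[i] := sl2_mx M 0 1.
Definition mc {R : realType} (M : sl2 R) : R[i] := sl2_mx M 1 0.
Definition md {R : realType} (M : sl2 R) : R[i] := sl2_mx M 1 1.

Definition act_den {R : realType} (M : sl2 R) (x : h3 R) : R :=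
  normc (mc M * zc x + md M) ^+ 2 + normc (mc M) ^+ 2 * ht x ^+ 2.

Lemma act_den_gt0 (R : realType) (M : sl2 R) (x : h3 R) : 0 < act_den M x.
Proof.
have p1 : 0 <= normc (mc M * zc x + md M) ^+ 2 by exact: sqr_ge0.
have p2 : 0 <= normc (mc M) ^+ 2 * ht x ^+ 2 by rewrite mulr_ge0 // sqr_ge0.
rewrite /act_den lt0r (addr_ge0 p1 p2) andbT paddr_eq0 //.
apply/negP => /andP[].
rewrite expf_eq0 /= => /eqP/ComplexField.Normc.eq0_normc e1.
rewrite mulf_eq0 => /orP[|]; rewrite expf_eq0 /= => /eqP; last first.
  by apply/eqP; rewrite gt_eqF // ht_gt0.
move=> /ComplexField.Normc.eq0_normc c0.
move: e1; rewrite c0 mul0r add0r => d0.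
have := det_sl2 M; rewrite (expand_det_row _ 1) !big_ord_recl big_ord0.
have -> : sl2_mx M 1 0 = 0 by exact: c0.
have -> : sl2_mx M 1 (lift ord0 ord0) = 0.
  by rewrite -[RHS]d0 /md; congr (sl2_mx M _ _); apply: val_inj.
by rewrite !mul0r !addr0 => /esym/eqP; rewrite oner_eq0.
Qed.

Lemma act_ht_gt0 (R : realType) (M : sl2 R) (x : h3 R) : 0 < ht x / act_den M x.
Proof. by rewrite divr_gt0 ?ht_gt0 ?act_den_gt0. Qed.

(* Poincare extension of z |-> (a z + b) / (c z + d); two matrices have the same
   action iff they agree in PSL_2(C). *)
Definition act {R : realType} (M : sl2 R) (x : h3 R) : h3 R :=
  H3 (((ma M * zc x + mb M) * conjc (mc M * zc x + md M)
       + ma M * conjc (mc M) * (ht x ^+ 2)%:C%C) / (act_den M x)%:C%C)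
     (act_ht_gt0 M x).

(* A subgroup of PSL_2(C), i.e. of the group of all transformations [act M],
   that is discrete: its identity element is isolated. *)
Definition kleinian {R : realType} (Gamma : set (h3 R -> h3 R)) : Prop :=
  [/\ is_group Gamma,
      Gamma `<=` range (@act R) &
      exists2 e : R, 0 < e &
        forall M : sl2 R, Gamma (act M) ->
          (forall i j, normc (sl2_mx M i j - (1%:M : 'M[R[i]]_2) i j) < e) ->
          act M = id].

(** * Fundamental domains, Dirichlet domains and Ford domains *)

Definition fundamental_domain {R : realType} (Gamma : set (h3 R -> h3 R))
    (P : set (h3 R)) : Prop :=
  [/\ polyhedron P,
      forall x, exists2 g, Gamma g & (g @` P) x &
      forall g, Gamma g -> g <> id ->
        hinterior P `&` g @` hinterior P = set0].

Definition dirichlet_set {R : realType} (Gamma : set (h3 R -> h3 R))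
    (w0 : h3 R) : set (h3 R) :=
  [set x | forall g, Gamma g -> g <> id -> hdist x w0 <= hdist x (g w0)].

(* [Gamma] has the transformation of M as an element fixing infinity. *)
Definition in_stab_infinity {R : realType} (Gamma : set (h3 R -> h3 R))
    (M : sl2 R) : Prop := Gamma (act M) /\ mc M = 0.

Definition stab_infinity {R : realType} (Gamma : set (h3 R -> h3 R)) :
    set (h3 R -> h3 R) := @act R @` in_stab_infinity Gamma.

Definition contains_Z2 {R : realType} (G : set (h3 R -> h3 R)) : Prop :=
  exists phi : int * int -> (h3 R -> h3 R),
    [/\ forall u, G (phi u),
        forall u v, phi (u + v) = phi u \o phi v &
        injective phi].

(* The action on C of a matrix fixing infinity. *)
Definition act_plane {R : realType} (M : sl2 R) (z : R[i]) : R[i] :=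
  (ma M * z + mb M) / md M.

Definition cinterior {R : realType} (D : set R[i]) : set R[i] :=
  [set z | exists2 e : R, 0 < e & forall w, normc (w - z) < e -> D w].

Definition polygon {R : realType} (D : set R[i]) : Prop :=
  [/\ exists (m : nat) (n : 'I_m -> R[i]) (c : 'I_m -> R),
        (forall i, n i != 0) /\ D = [set z | forall i, cdot (n i) z <= c i],
      exists B : R, forall z, D z -> normc z <= B &
      cinterior D !=set0].

Definition fundamental_polygon {R : realType} (Gamma : set (h3 R -> h3 R))
    (D : set R[i]) : Prop :=
  [/\ polygon D,
      forall z, exists2 M, in_stab_infinity Gamma M & (act_plane M @` D) z &
      forall M, in_stab_infinity Gamma M -> act M <> id ->
        cinterior D `&` act_plane M @` cinterior D = set0].

Definition chimney {R : realType} (D : set R[i]) : set (h3 R) :=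
  [set x | D (zc x)].

(* The points lying on or outside all isometric spheres. *)
Definition outside_isometric_spheres {R : realType}
    (Gamma : set (h3 R -> h3 R)) : set (h3 R) :=
  [set x | forall M : sl2 R, Gamma (act M) -> mc M != 0 ->
     (normc (mc M))^-1 ^+ 2 <= sqdist (- md M / mc M) x].

Definition is_Ford_domain {R : realType} (Gamma : set (h3 R -> h3 R))
    (P : set (h3 R)) : Prop :=
  contains_Z2 (stab_infinity Gamma) /\
  exists2 D, fundamental_polygon Gamma D &
    P = outside_isometric_spheres Gamma `&` chimney D.

Definition is_Dirichlet_domain {R : realType} (Gamma : set (h3 R -> h3 R))
    (P : set (h3 R)) : Prop :=
  exists w0, P = dirichlet_set Gamma w0.

Definition is_DF_domain {R : realType} (Gamma : set (h3 R -> h3 R))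
    (P : set (h3 R)) : Prop :=
  [/\ fundamental_domain Gamma P, is_Ford_domain Gamma P &
      is_Dirichlet_domain Gamma P].

Definition admits_DF_domain {R : realType} (Gamma : set (h3 R -> h3 R)) : Prop :=
  kleinian Gamma /\ exists P, is_DF_domain Gamma P.

(* Main.v *)
(** At infinity a right-angled ideal polyhedron of finite volume is a Euclidean
    rectangle times a half-line, and two of its faces are coplanar, perpendicular
    or disjoint, so by Tits' argument the images of Q under G tile hyperbolic
    space. Count modulo 2 the reflections in the pair of parallel sides b, b' of
    the rectangle, and the reflections in all other faces: this maps G onto
    (Z/2)^2, and the kernel Gamma has index 4. The union P of the four copies of Q
    around a corner of the rectangle, cut out by the faces of these copies other
    than the two sides through the corner, is a fundamental domain for Gamma.
    If w lies high enough above the corner, reflecting in a remaining face of a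
    copy, or in its images by the two sides, moves w away, and the element of
    Gamma which does it is determined by the face up to the two sides, which fix
    w: hence P is the Dirichlet domain centred at w. As a point lies outside all
    isometric spheres iff no element of Gamma raises it, and reflections in
    hemispherical faces lower the points of Q, P is also a Ford domain, with
    chimney over the rectangle of four copies. *)

Require Import Defs.
From HB Require Import structures.
From mathcomp Require Import all_boot all_order all_algebra.
From mathcomp Require Import complex measurable_realfun ring lra.
From mathcomp Require Import all_classical all_reals all_analysis.

Set Implicit Arguments.
Unset Strict Implicit.
Unset Printing Implicit Defensive.

Import Order.TTheory GRing.Theory Num.Theory.
Import numFieldNormedType.Exports.

Local Open Scope classical_set_scope.
Local Open Scope ring_scope.

(** * The Lorentz model *)

Section Lorentz.
Variable R : realType.
Implicit Types (x y z : h3 R) (n p : R[i]) (h k : halfspace R).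

(** The right angles are given only along edges, while the planes of two faces might cross away from
    Q; that such planes are still perpendicular is the main geometric obstacle. The foot of the
    perpendicular from a point of Q to a face plane is again in Q, so the point of Q nearest to a
    common point of the two planes lies on both, and the absence of finite vertices turns that
    contact into an edge. Metric arguments take place in the Lorentz model: a point is a vector of
    square -1, a half-space is a unit normal, a reflection is linear. The hyperbolic cosine of the
    distance is then bilinear, and polynomial inequalities suffice. Elements of G are bare functions
    without a presentation, so parities are attached to words; only Tits' argument, which carries
    them along, shows that they depend on the element alone. They are chosen so that the total
    parity decides orientation, which puts Gamma into PSL_2(C), and so that the two commuting
    reflections through a corner of the rectangle generate representatives of the four cosets. *)

Lemma normc_sqr n : normc n ^+ 2 = cRe n ^+ 2 + cIm n ^+ 2.
Proof.
by case: n => a b /=; rewrite sqr_sqrtr // addr_ge0 // sqr_ge0.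
Qed.

Lemma normc_ge0 n : 0 <= normc n.
Proof. by case: n => a b /=; exact: sqrtr_ge0. Qed.

Lemma normc_gt0 n : n != 0 -> 0 < normc n.
Proof.
move=> n0; rewrite lt0r normc_ge0 andbT; apply: contra n0 => /eqP.
by move/ComplexField.Normc.eq0_normc => ->.
Qed.

Lemma cdotE n p : cdot n p = cRe n * cRe p + cIm n * cIm p.
Proof. by case: n p => a b [c d]; rewrite /cdot /=; ring. Qed.

Lemma complex_eq n p : cRe n = cRe p -> cIm n = cIm p -> n = p.
Proof. by case: n p => a b [c d] /= -> ->. Qed.

Lemma h3_eq x y : zc x = zc y -> ht x = ht y -> x = y.
Proof.
case: x y => zx tx px [zy ty py] /= -> e; move: px py; rewrite e => px py.
by rewrite (bool_irrelevance px py).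
Qed.

Record vec := Vec { cA : R; cB : R; cC : R; cD : R }.

(* The quadratic form is the negative of the determinant of the Hermitian matrix
   [[A, B + iC], [B - iC, D]]. *)
Definition bil (u v : vec) : R :=
  cB u * cB v + cC u * cC v - (cA u * cD v + cD u * cA v) / 2.

Definition comb (a : R) (u : vec) (b : R) (v : vec) : vec :=
  Vec (a * cA u + b * cA v) (a * cB u + b * cB v)
      (a * cC u + b * cC v) (a * cD u + b * cD v).

Lemma vec_eq u v : cA u = cA v -> cB u = cB v -> cC u = cC v -> cD u = cD v ->
  u = v.
Proof. by case: u v => ? ? ? ? [? ? ? ?] /= -> -> -> ->. Qed.

Lemma bilC u v : bil u v = bil v u.
Proof. by rewrite /bil; ring. Qed.

Lemma bil_combl a u b v w : bil (comb a u b v) w = a * bil u w + b * bil v w.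
Proof. by rewrite /bil /comb /=; field. Qed.

Lemma bil_combr a u b v w : bil w (comb a u b v) = a * bil w u + b * bil w v.
Proof. by rewrite bilC bil_combl !(bilC w). Qed.

(** The Hermitian matrix with rows (|z|^2 + t^2, z) and (conj z, 1), divided by t; its determinant
    is 1. *)
Definition pt x : vec :=
  Vec ((cRe (zc x) ^+ 2 + cIm (zc x) ^+ 2 + ht x ^+ 2) / ht x)
      (cRe (zc x) / ht x) (cIm (zc x) / ht x) (ht x)^-1.

Lemma ht_neq0 x : ht x != 0.
Proof. by rewrite gt_eqF // ht_gt0. Qed.
Lemma ht_ge0 x : 0 <= ht x.
Proof. by rewrite ltW // ht_gt0. Qed.
Hint Resolve ht_neq0 ht_ge0 : core.
Hint Extern 0 (is_true (0 < ht _)) => exact: ht_gt0 : core.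

Lemma pt_inj : injective pt.
Proof.
move=> x y [_ eB eC /invr_inj eD]; apply: h3_eq => //; apply: complex_eq.
  by move: eB; rewrite eD => /mulIf; apply; rewrite invr_neq0.
by move: eC; rewrite eD => /mulIf; apply; rewrite invr_neq0.
Qed.

Lemma bil_pt x : bil (pt x) (pt x) = -1.
Proof. by rewrite /bil /pt /=; field. Qed.

(** The hyperbolic cosine of the distance. Radii of balls are replaced throughout by bounds [d > 1]
    on [chd]. *)
Definition chd x y : R := - bil (pt x) (pt y).

Lemma chdC x y : chd x y = chd y x. Proof. by rewrite /chd bilC. Qed.

Lemma chdxx x : chd x x = 1. Proof. by rewrite /chd bil_pt opprK. Qed.

Lemma chdE x y : chd x y =
  1 + (normc (zc x - zc y) ^+ 2 + (ht x - ht y) ^+ 2) / (2 * ht x * ht y).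
Proof.
rewrite normc_sqr /chd /bil /pt; case: x y => [[a b] s s0] [[c d] t t0] /=.
by field; rewrite !gt_eqF.
Qed.

Lemma chd_ge1 x y : 1 <= chd x y.
Proof.
by rewrite chdE lerDl divr_ge0 ?addr_ge0 ?sqr_ge0 // !mulr_ge0.
Qed.

Lemma chd_eq1 x y : chd x y = 1 -> x = y.
Proof.
rewrite chdE -[RHS]addr0 => /addrI/eqP; rewrite mulf_eq0 invr_eq0.
rewrite !mulf_eq0 !(negbTE (ht_neq0 _)) !orbF pnatr_eq0 orbF.
rewrite paddr_eq0 ?sqr_ge0 // !sqrf_eq0 => /andP[/eqP e1 /eqP e2].
apply: h3_eq; apply/eqP; rewrite -subr_eq0 ?e2 //.
by rewrite (ComplexField.Normc.eq0_normc e1).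
Qed.

Lemma hdistE x y : hdist x y = arcosh (chd x y).
Proof. by rewrite chdE. Qed.

Lemma arcosh_le (u v : R) : 1 <= u -> 1 <= v -> (arcosh u <= arcosh v) = (u <= v).
Proof.
move=> u1 v1; have f (w : R) : 1 <= w -> 0 < w + Num.sqrt (w ^+ 2 - 1).
  by move=> w1; rewrite ltr_pwDl ?sqrtr_ge0 //; lra.
have m (a b : R) : 1 <= a -> a < b -> a + Num.sqrt (a ^+ 2 - 1) < b + Num.sqrt (b ^+ 2 - 1).
  by move=> a1 ab; rewrite ltr_leD // ler_wsqrtr //; nra.
rewrite /arcosh ler_ln ?posrE ?f //.
case: (leP u v) => [|/(m _ _ v1) H]; last by apply: negbTE; rewrite -ltNge.
by rewrite [u <= v]le_eqVlt => /predU1P[->|/(m _ _ u1)/ltW ->]; rewrite ?lexx.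
Qed.

Lemma hdist_le x y z w : (hdist x y <= hdist z w) = (chd x y <= chd z w).
Proof. by rewrite !hdistE arcosh_le ?chd_ge1. Qed.

Lemma arcosh_gt0 (d : R) : 1 < d -> 0 < arcosh d.
Proof.
move=> d1; rewrite /arcosh ln_gt0 // ltr_wpDr ?sqrtr_ge0 //.
Qed.

Lemma hdist_lt_arcosh (d : R) x y : 1 <= d -> (hdist x y < arcosh d) = (chd x y < d).
Proof. by move=> d1; rewrite hdistE !ltNge arcosh_le ?chd_ge1. Qed.

Lemma hdist_near (e : R) : 0 < e ->
  exists2 d : R, 1 < d & forall x y, chd x y < d -> hdist x y < e.
Proof.
move=> e0; have E1 : 1 < expR e by rewrite -expR0 ltr_expR.
have E0 : 0 < expR e by rewrite expR_gt0.
set E := expR e in E1 E0.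
(* The bound is cosh e. *)
have d1 : 1 < (E + E^-1) / 2.
  rewrite -subr_gt0.
  have -> : (E + E^-1) / 2 - 1 = (E - 1) ^+ 2 / (2 * E).
    by field; rewrite gt_eqF.
  by rewrite divr_gt0 ?exprn_gt0 ?subr_gt0 ?mulr_gt0.
exists ((E + E^-1) / 2) => // x y; rewrite -hdist_lt_arcosh ?ltW //.
suff -> : arcosh ((E + E^-1) / 2) = e by [].
rewrite /arcosh.
have -> : ((E + E^-1) / 2) ^+ 2 - 1 = ((E - E^-1) / 2) ^+ 2.
  by field; rewrite gt_eqF.
rewrite sqrtr_sqr ger0_norm.
  have -> : (E + E^-1) / 2 + (E - E^-1) / 2 = E by field; rewrite gt_eqF.
  by rewrite /E expRK.
rewrite divr_ge0 // subr_ge0 (le_trans _ (ltW E1)) // invf_le1 // ltW //.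
Qed.

Lemma hinteriorP (X : set (h3 R)) x :
  hinterior X x <-> exists2 d : R, 1 < d & forall y, chd x y < d -> X y.
Proof.
split=> [[e e0 H]|[d d1 H]].
  by have [d d1 Hd] := hdist_near e0; exists d => // y /Hd/H.
by exists (arcosh d) => [|y]; rewrite ?arcosh_gt0 // hdist_lt_arcosh ?ltW // => /H.
Qed.

(** The usual way to produce points (on segments, feet of perpendiculars, intersections of planes):
    write down a vector, check that its square is negative, and rescale. *)
Lemma timelike_pt (u : vec) : bil u u < 0 ->
  exists z (l : R), [/\ l != 0, u = comb l (pt z) 0 (pt z) & l ^+ 2 = - bil u u].
Proof.
move=> u0.
have D0 : cD u != 0.
  apply/eqP => D0; move: u0; rewrite /bil D0; case: u D0 => A B C D /= _; nra.
set s := Num.sqrt (- bil u u).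
have s0 : 0 < s by rewrite sqrtr_gt0 oppr_gt0.
have s2 : s ^+ 2 = - bil u u by rewrite sqr_sqrtr // oppr_ge0 ltW.
have t0 : 0 < s / `|cD u| by rewrite divr_gt0 ?normr_gt0.
exists (H3 (cB u / cD u +i* (cC u / cD u))%C t0), (Num.sg (cD u) * s).
have D1 : Num.sg (cD u) * `|cD u| = cD u by rewrite -numEsg.
have sg2 : Num.sg (cD u) * Num.sg (cD u) = 1 by rewrite -expr2 sqr_sg D0.
have nD0 : `|cD u| != 0 by rewrite normr_eq0.
have nD2 : `|cD u| ^+ 2 = cD u ^+ 2 by rewrite real_normK ?num_real.
have sn0 : s != 0 by rewrite gt_eqF.
split; first by rewrite mulf_neq0 ?sgr_eq0.
  have E1 : Num.sg (cD u) * s * (s / `|cD u|)^-1 = cD u by rewrite -[RHS]D1; field; apply/andP.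
  have E2 a : Num.sg (cD u) * s * (a / (s / `|cD u|)) = a * cD u.
    by rewrite -[in RHS]E1; ring.
  apply: vec_eq; rewrite /= mul0r addr0 ?E2 ?E1 //; try by field.
  by rewrite [(s / _) ^+ 2]expr_div_n nD2 s2 /bil; field.
by rewrite exprMn sqr_sg D0 mul1r s2.
Qed.

(** Pairing negatively with one point selects the right sheet of the hyperboloid, because [chd x z]
    is positive. *)
Lemma timelike_future (u : vec) x : bil u u < 0 -> bil (pt x) u < 0 ->
  exists z (l : R), [/\ 0 < l, u = comb l (pt z) 0 (pt z) & l ^+ 2 = - bil u u].
Proof.
move=> u0 xu; have [z [l [l0 e l2]]] := timelike_pt u0; exists z, l; split => //.
move: xu; rewrite {1}e bil_combr mul0r addr0; have := chd_ge1 x z.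
rewrite /chd; nra.
Qed.

Lemma bil_comb1 (l : R) u w : bil (comb l u 0 u) w = l * bil u w.
Proof. by rewrite bil_combl mul0r addr0. Qed.

Lemma bil_comb1r (l : R) u w : bil w (comb l u 0 u) = l * bil w u.
Proof. by rewrite bilC bil_comb1 bilC. Qed.

(** Rescaled nonnegative combinations of the ends are the points of the geodesic segment; along them
    [side] is linear up to the factor [l > 0]. *)
Lemma segment_pt (a b : R) x y : 0 <= a -> 0 <= b -> 0 < a + b ->
  exists z (l : R), 0 < l /\ comb a (pt x) b (pt y) = comb l (pt z) 0 (pt z).
Proof.
move=> a0 b0 ab.
have xy := chd_ge1 x y; rewrite /chd in xy.
have [||z [l [l0 e _]]] := @timelike_future (comb a (pt x) b (pt y)) x.
- rewrite bil_combl !bil_combr !bil_pt [bil (pt y) (pt x)]bilC.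
  have := mulr_ge0 a0 b0; have := exprn_gt0 2 ab; nra.
- rewrite bil_combr bil_pt; nra.
by exists z, l.
Qed.

(** The closed light cone has two halves, each pairing with all points with one sign. In coordinates
    [q] completes the square, so for [D != 0] the sign is that of -D; for [D = 0] only [A]
    survives. *)
Lemma causal_sign u x : bil u u <= 0 -> bil (pt x) u <= 0 ->
  (forall y, bil (pt y) u <= 0) /\ (bil (pt x) u = 0 -> u = Vec 0 0 0 0).
Proof.
move=> u0.
have key y : ht y * bil (pt y) u = - (cD u * (cRe (zc y) ^+ 2 + cIm (zc y) ^+ 2 + ht y ^+ 2) + cA u) / 2
    + cRe (zc y) * cB u + cIm (zc y) * cC u.
  by rewrite /bil /pt /=; field.
case: u u0 key => A B C D; rewrite /bil /= => u0 key.
have sgn (y : h3 R) s : (ht y * s <= 0) = (s <= 0) by rewrite pmulr_rle0.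
have q y (c : R) : (cRe (zc y) * D - B) ^+ 2 + (cIm (zc y) * D - C) ^+ 2 + ht y ^+ 2 * D ^+ 2 =
   D * (D * (cRe (zc y) ^+ 2 + cIm (zc y) ^+ 2 + ht y ^+ 2) + A - 2 * (cRe (zc y) * B + cIm (zc y) * C)) + (B ^+ 2 + C ^+ 2 - A * D) by ring.
have p0 y : 0 < ht y ^+ 2 by rewrite exprn_gt0.
have [D0|D0|D0] := ltgtP D 0.
- rewrite -(sgn x) key => H; exfalso.
  have := q x 0; have := p0 x; have : 0 < D ^+ 2 by nra.
  have := sqr_ge0 (cRe (zc x) * D - B); have := sqr_ge0 (cIm (zc x) * D - C); nra.
- have neg y : cB (pt y) * B + cC (pt y) * C - (cA (pt y) * D + cD (pt y) * A) / 2 < 0.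
    rewrite -(pmulr_rlt0 _ (ht_gt0 y)) key; have := q y 0; have := p0 y; have : 0 < D ^+ 2 by nra.
    have := sqr_ge0 (cRe (zc y) * D - B); have := sqr_ge0 (cIm (zc y) * D - C); nra.
  move=> _; split=> [y|e]; first exact: ltW (neg y).
  by have := neg x; rewrite e ltxx.
- have [B0 C0] : B = 0 /\ C = 0.
    by rewrite D0 in u0; split; apply/eqP; rewrite -sqrf_eq0 eq_le sqr_ge0 andbT; nra.
  move=> H; split=> [y|e].
    have A0 : 0 <= A.
      by move/(mulr_ge0_le0 (ht_ge0 x)): H; rewrite key B0 C0 D0; lra.
    rewrite -(pmulr_rle0 _ (ht_gt0 y)) key B0 C0 D0; lra.
  by have := key x; rewrite e B0 C0 D0 mulr0 => E; congr Vec; lra.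
Qed.

(** The outward unit normal in Lorentz space. Positively proportional [Vertical] data give the same
    vector, so coincidence of half-spaces is expressed by equality of [enorm]. *)
Definition enorm h : vec :=
  match h with
  | Vertical n c _ => Vec (2 * c / normc n) (cRe n / normc n) (cIm n / normc n) 0
  | Inside p r _ => Vec (- ((normc p ^+ 2 - r ^+ 2) / r)) (- (cRe p / r)) (- (cIm p / r)) (- r^-1)
  | Outside p r _ => Vec ((normc p ^+ 2 - r ^+ 2) / r) (cRe p / r) (cIm p / r) r^-1
  end.

(** The hyperbolic sine of the signed distance to the plane, negative inside the half-space. *)
Definition side h x : R := bil (pt x) (enorm h).

Lemma bil_enorm h : bil (enorm h) (enorm h) = 1.
Proof.
rewrite /bil; case: h => [n c n0|p r r0|p r r0] /=.
- have := normc_gt0 n0; have := normc_sqr n; set m := normc n => m2 m0.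
  rewrite mulr0 mul0r addr0 mul0r subr0 !mulf_div -!expr2 -mulrDl -m2 divff //.
  by rewrite sqrf_eq0 gt_eqF.
- by rewrite normc_sqr; field; rewrite gt_eqF.
- by rewrite normc_sqr; field; rewrite gt_eqF.
Qed.

Lemma side_vertical n c (n0 : n != 0) x :
  side (Vertical c n0) x = (cdot n (zc x) - c) / (normc n * ht x).
Proof.
rewrite /side /bil cdotE /=; have := normc_gt0 n0; set m := normc n => m0.
by field; rewrite ht_neq0 gt_eqF.
Qed.

Lemma side_outside p r (r0 : 0 < r) x :
  side (Outside p r0) x = (r ^+ 2 - sqdist p x) / (2 * r * ht x).
Proof.
rewrite /side /bil /sqdist /= !normc_sqr; case: x => [[a b] t t0]; case: p => c d /=.
by field; rewrite !gt_eqF.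
Qed.

Lemma side_inside p r (r0 : 0 < r) x :
  side (Inside p r0) x = (sqdist p x - r ^+ 2) / (2 * r * ht x).
Proof.
rewrite /side /bil /sqdist /= !normc_sqr; case: x => [[a b] t t0]; case: p => c d /=.
by field; rewrite !gt_eqF.
Qed.

Lemma hs_setE h x : hs_set h x <-> side h x <= 0.
Proof.
case: h => [n c n0|p r r0|p r r0] /=.
- by rewrite side_vertical pmulr_lle0 ?subr_le0 // invr_gt0 mulr_gt0 // normc_gt0.
- by rewrite side_inside pmulr_lle0 ?subr_le0 // invr_gt0 !mulr_gt0.
- by rewrite side_outside pmulr_lle0 ?subr_le0 // invr_gt0 !mulr_gt0.
Qed.

Lemma hs_planeE h x : hs_plane h x <-> side h x = 0.
Proof.
have E (a b d : R) : 0 < d -> (a = b) <-> ((a - b) / d = 0).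
  move=> d0; split=> [->|/eqP]; first by rewrite subrr mul0r.
  by rewrite mulf_eq0 invr_eq0 (gt_eqF d0) orbF subr_eq0 => /eqP.
case: h => [n c n0|p r r0|p r r0] /=.
- by rewrite side_vertical; apply: E; rewrite mulr_gt0 // normc_gt0.
- by rewrite side_inside; apply: E; rewrite !mulr_gt0.
- rewrite side_outside; have D0 : 0 < 2 * r * ht x by rewrite !mulr_gt0.
  by rewrite -(E _ _ _ D0); split=> /esym.
Qed.

(** Euclidean reflections and inversions alike become the linear reflection in the unit normal. *)
Lemma pt_reflection h x : pt (reflection h x) = comb 1 (pt x) (- 2 * side h x) (enorm h).
Proof.
case: h => [n c n0|p r r0|p r r0].
- rewrite side_vertical /reflection; have := normc_gt0 n0; have := normc_sqr n.
  rewrite /pt /vrefl /= cdotE; case: n n0 => a b n0; case: x => [[u v] t t0].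
  set m := normc _ => /= m2 m0.
  have mn0 : m != 0 by rewrite gt_eqF.
  have tn0 : t != 0 by rewrite gt_eqF.
  have m4 : a ^+ 2 = m ^+ 2 - b ^+ 2 by rewrite m2; ring.
  apply: vec_eq => /=; last by field; apply/andP.
  + field : m4; by apply/andP.
  + by field; apply/andP.
  + by field; apply/andP.
- rewrite side_inside /reflection /pt /inversion /=.
  have := sqdist_gt0 p x; have : sqdist p x = normc (zc x - p) ^+ 2 + ht x ^+ 2 by [].
  rewrite !normc_sqr; set S := sqdist p x; case: x @S => [[u v] t t0] S.
  case: p @S => c d S /= S2 S0.
  have Sn0 : S != 0 by rewrite gt_eqF.
  have tn0 : t != 0 by rewrite gt_eqF.
  have rn0 : r != 0 by rewrite gt_eqF.
  have S3 : t ^+ 2 = S - (u - c) ^+ 2 - (v - d) ^+ 2 by rewrite S2; ring.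
  apply: vec_eq => /=; rewrite ?S3; field : S3; by rewrite ?Sn0 ?tn0 ?rn0.
- rewrite side_outside /reflection /pt /inversion /=.
  have := sqdist_gt0 p x; have : sqdist p x = normc (zc x - p) ^+ 2 + ht x ^+ 2 by [].
  rewrite !normc_sqr; set S := sqdist p x; case: x @S => [[u v] t t0] S.
  case: p @S => c d S /= S2 S0.
  have Sn0 : S != 0 by rewrite gt_eqF.
  have tn0 : t != 0 by rewrite gt_eqF.
  have rn0 : r != 0 by rewrite gt_eqF.
  have S3 : t ^+ 2 = S - (u - c) ^+ 2 - (v - d) ^+ 2 by rewrite S2; ring.
  apply: vec_eq => /=; rewrite ?S3; field : S3; by rewrite ?Sn0 ?tn0 ?rn0.
Qed.

Lemma side_seg h (a b l : R) x y z :
  comb a (pt x) b (pt y) = comb l (pt z) 0 (pt z) ->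
  l * side h z = a * side h x + b * side h y.
Proof. by move=> e; rewrite /side -bil_combl e bil_comb1. Qed.

Lemma side_reflection h k x :
  side k (reflection h x) = side k x - 2 * side h x * bil (enorm h) (enorm k).
Proof. by rewrite /side pt_reflection bil_combl mul1r -/(side h x); ring. Qed.

Lemma side_reflection_self h x : side h (reflection h x) = - side h x.
Proof. by rewrite side_reflection bil_enorm; ring. Qed.

(** The source of the distance comparisons: reflecting [y] takes it away from [x] exactly when both
    lie strictly on the same side. *)
Lemma chd_reflection_r h x y :
  chd x (reflection h y) = chd x y + 2 * side h x * side h y.
Proof. by rewrite /chd pt_reflection bil_combr /side; ring. Qed.

Lemma reflectionK h : involutive (reflection h).
Proof.
move=> x; apply: pt_inj; rewrite !pt_reflection side_reflection_self.
by apply: vec_eq => /=; ring.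
Qed.

Lemma chd_reflection h x y : chd (reflection h x) (reflection h y) = chd x y.
Proof.
rewrite chd_reflection_r side_reflection_self chdC chd_reflection_r chdC; ring.
Qed.

Lemma reflection_comm h k : bil (enorm h) (enorm k) = 0 ->
  reflection h \o reflection k = reflection k \o reflection h.
Proof.
move=> e; apply/funext => x; apply: pt_inj => /=.
rewrite !pt_reflection !side_reflection (bilC (enorm k)) e.
by apply: vec_eq => /=; ring.
Qed.

Lemma reflection_eq h k : enorm h = enorm k -> reflection h = reflection k.
Proof.
by move=> e; apply/funext => x; apply: pt_inj; rewrite !pt_reflection /side e.
Qed.

(* [m] is the orthogonal projection of [x] to the plane of [h]. *)
Lemma foot_exists h x : exists m (l : R), [/\ 0 < l,
  comb 1 (pt x) 1 (pt (reflection h x)) = comb l (pt m) 0 (pt m) &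
  l ^+ 2 = 4 * (1 + side h x ^+ 2)].
Proof.
set u := comb _ _ _ _.
have uE : bil u u = - (4 * (1 + side h x ^+ 2)).
  rewrite /u pt_reflection !(bil_combl, bil_combr) !bil_pt bil_enorm.
  by rewrite (bilC (enorm h)) -/(side h x); ring.
have u0 : bil u u < 0 by rewrite uE oppr_lt0; have := sqr_ge0 (side h x); nra.
have [|m [l [l0 e l2]]] := @timelike_future u x u0.
  rewrite /u pt_reflection !bil_combr bil_pt -/(side h x).
  by have := sqr_ge0 (side h x); nra.
by exists m, l; split => //; rewrite l2 uE opprK.
Qed.

Lemma foot_side h x m l : 0 < l ->
  comb 1 (pt x) 1 (pt (reflection h x)) = comb l (pt m) 0 (pt m) -> side h m = 0.
Proof.
move=> l0 /(side_seg h) e; apply/eqP; rewrite -(mulrI_eq0 _ (mulfI (lt0r_neq0 l0))) e.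
by rewrite side_reflection_self; apply/eqP; ring.
Qed.

(** A point across the plane is at least as far as the plane. If y' is the mirror image of [y] and
    [m] the foot, then [chd x y] + [chd x] y' = [l * chd x m >= l], and y' is no farther from [x]
    than [y]. *)
Lemma chd_cross h x y : side h x * side h y <= 0 ->
  1 + side h y ^+ 2 <= chd x y ^+ 2.
Proof.
move=> hxy; have [m [l [l0 e l2]]] := foot_exists h y.
have e1 := congr1 (fun u => - bil (pt x) u) e.
rewrite bil_combr bil_comb1r !mul1r opprD -mulrN -/(chd x m) in e1.
move: e1; rewrite -/(chd x y) -/(chd x (reflection h y)) chd_reflection_r => e1.
have m1 := chd_ge1 x m; have y1 := chd_ge1 x y.
have l2y : l <= 2 * chd x y by nra.
have : l ^+ 2 <= (2 * chd x y) ^+ 2 by rewrite ler_sqr ?nnegrE; lra.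
by rewrite l2; nra.
Qed.

Lemma hs_nbhd h x : side h x != 0 ->
  exists2 d : R, 1 < d & forall y, chd x y < d -> 0 < side h x * side h y.
Proof.
move=> hx; have s2 : 0 < side h x ^+ 2 by rewrite exprn_even_gt0.
(* The hyperbolic cosine of the distance from [x] to the plane. *)
exists (Num.sqrt (1 + side h x ^+ 2)).
  by rewrite -[ltLHS]sqrtr1 ltr_sqrt; lra.
move=> y xy; rewrite ltNge mulrC; apply/negP => /chd_cross; apply/negP; rewrite -ltNge.
have s0 : 0 <= 1 + side h x ^+ 2 by lra.
rewrite -[ltRHS]sqr_sqrtr // ltr_sqr ?nnegrE ?sqrtr_ge0 // chdC //.
by have := chd_ge1 x y; lra.
Qed.

Lemma plane_near (s : bool) h x (d : R) : 1 < d -> side h x = 0 ->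
  exists y, chd x y < d /\ 0 < (-1) ^+ s * side h y.
Proof.
move=> d1 hx; have di : 0 < d^-1 < 1 by rewrite invr_gt0 invf_lt1; lra.
(* The point is [x] pushed by [e] along the normal and divided by [l], with l^2 = 1 - e^2 = 2b - b^2
   > b^2; hence [chd x y] = 1/l < d. *)
set b := d^-1 in di; set e : R := 1 - b.
have e0 : 0 < e < 1 by rewrite /e; lra.
set u := comb 1 (pt x) ((-1) ^+ s * e) (enorm h).
have sg : ((-1) ^+ s) ^+ 2 = 1 :> R by rewrite sqrr_sign.
set g : R := (-1) ^+ s in u sg *.
have xe : bil (pt x) (enorm h) = 0 by [].
have uE : bil u u = - (1 - e ^+ 2).
  rewrite /u !(bil_combl, bil_combr) bil_pt bil_enorm (bilC (enorm h)) xe.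
  transitivity (- 1 + g ^+ 2 * e ^+ 2); first by ring.
  by rewrite sg; ring.
have [||y [l [l0 ue l2]]] := @timelike_future u x.
- by rewrite uE; nra.
- by rewrite /u bil_combr bil_pt xe; lra.
exists y.
have hy : l * side h y = g * e.
  by rewrite /side -bil_comb1 -ue /u bil_combl bil_enorm xe; ring.
have xy : l * chd x y = 1.
  by rewrite /chd mulrN -bil_comb1r -ue /u bil_combr bil_pt xe; ring.
split; last first.
  by rewrite -(pmulr_rgt0 _ l0) mulrCA hy mulrA -expr2 sg mul1r; lra.
have lb : b < l.
  rewrite -ltr_sqr ?nnegrE; [rewrite l2 uE /e; nra|lra|lra].
rewrite -(ltr_pM2l l0) xy.
have -> : 1 = b * d by rewrite mulVf //; lra.
by rewrite ltr_pM2r //; lra.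
Qed.

(** This is cosh 2r = 2 (cosh r)^2 - 1. With [m] the midpoint, x + z = l m where l^2 = 2 + 2
    [chd x z], and pairing with [y] gives l <= [chd y x] + [chd y z]. *)
Lemma chd_triangle (d : R) x y z : chd y x < d -> chd y z < d -> chd x z < 2 * d ^+ 2 - 1.
Proof.
move=> yx yz; have [m [l [l0 e]]] := @segment_pt 1 1 x z ler01 ler01 (addr_gt0 ltr01 ltr01).
have e1 := congr1 (fun u => - bil (pt y) u) e.
rewrite bil_combr bil_comb1r !mul1r opprD -mulrN -/(chd y m) in e1.
have e2 := congr1 (fun u => - bil u u) e.
rewrite !(bil_combl, bil_combr) !bil_pt (bilC (pt z)) in e2.
move: e1 e2; rewrite -/(chd y x) -/(chd y z).
have -> : bil (pt x) (pt z) = - chd x z by rewrite opprK.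
have := chd_ge1 y x; have := chd_ge1 y m; have := chd_ge1 y z => *.
have l2 : l < 2 * d by nra.
by have : l ^+ 2 < (2 * d) ^+ 2 by [rewrite ltr_sqr ?nnegrE; lra]; nra.
Qed.

End Lorentz.
Hint Resolve ht_neq0 ht_ge0 : core.
Hint Extern 0 (is_true (0 < ht _)) => exact: ht_gt0 : core.

(** * Nearest points of polyhedra *)

Section Nearest.
Variable R : realType.
Implicit Types (x y z p : h3 R).

(** The logarithm of the height makes the coordinates range over all of R^3, where compact boxes are
    at hand. *)
Let of_coord (q : R * R * R) : h3 R := H3 (q.1.1 +i* q.1.2)%C (expR_gt0 q.2).

Let of_coordK x : of_coord (cRe (zc x), cIm (zc x), ln (ht x)) = x.
Proof. by apply: h3_eq => /=; [case: (zc x)|rewrite lnK ?posrE]. Qed.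

Let chd_of_coord p q : chd p (of_coord q) =
  ((cRe (zc p) - q.1.1) ^+ 2 + (cIm (zc p) - q.1.2) ^+ 2 + ht p ^+ 2)
    * (expR (- q.2) / (2 * ht p)) + expR q.2 / (2 * ht p).
Proof.
rewrite chdE normc_sqr /= expRN; case: p => [[a b] t t0]; case: q => [[u v] s] /=.
by field; rewrite !gt_eqF // expR_gt0.
Qed.

Let chd_continuous p : continuous (fun q => chd p (of_coord q)).
Proof.
move=> q; rewrite /continuous_at chd_of_coord.
under eq_fun do rewrite chd_of_coord.
have c1 : (fun q : R * R * R => q.1.1) @ q --> q.1.1.
  by apply: (@cvg_comp _ _ _ fst fst); [exact: cvg_fst|exact: cvg_fst].
have c2 : (fun q : R * R * R => q.1.2) @ q --> q.1.2.
  by apply: (@cvg_comp _ _ _ fst snd); [exact: cvg_fst|exact: cvg_snd].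
have c3 : (fun q : R * R * R => q.2) @ q --> q.2 by exact: cvg_snd.
have e (f : R * R * R -> R) : f @ q --> f q -> (fun q => expR (f q)) @ q --> expR (f q).
  by move=> fq; apply: (@cvg_comp _ _ _ f expR _ (nbhs (f q))) => //; exact: continuous_expR.
apply: cvgD; last by apply: cvgM; [exact: (e (fun q => q.2))|exact: cvg_cst].
apply: cvgM; last first.
  by apply: cvgM; [apply: (e (fun q => - q.2)); exact: cvgN|exact: cvg_cst].
apply: cvgD; last exact: cvg_cst.
by apply: cvgD; rewrite expr2; under eq_fun do rewrite expr2;
  apply: cvgM; apply: cvgB => //; exact: cvg_cst.
Qed.

Let chd_bounds p x (M : R) : chd p x <= M ->
  [/\ `|cRe (zc x) - cRe (zc p)| <= 2 * M * ht p,
      `|cIm (zc x) - cIm (zc p)| <= 2 * M * ht p &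
      ht p / (2 * M) <= ht x <= 2 * M * ht p].
Proof.
move=> xM; have x1 := chd_ge1 p x.
have e : chd p x * (2 * ht p * ht x) =
  (cRe (zc x) - cRe (zc p)) ^+ 2 + (cIm (zc x) - cIm (zc p)) ^+ 2 + ht x ^+ 2 + ht p ^+ 2.
  rewrite chdE normc_sqr; case: x {xM x1} => [[a b] t t0]; case: p => [[u v] s s0] /=.
  by field; rewrite !gt_eqF.
have [p0 x0] := (ht_gt0 p, ht_gt0 x).
have px := mulr_gt0 p0 x0.
have le : (cRe (zc x) - cRe (zc p)) ^+ 2 + (cIm (zc x) - cIm (zc p)) ^+ 2 + ht x ^+ 2 + ht p ^+ 2
   <= 2 * M * (ht p * ht x) by rewrite -e; nra.
have [s1 s2] := (sqr_ge0 (cRe (zc x) - cRe (zc p)), sqr_ge0 (cIm (zc x) - cIm (zc p))).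
have up : ht x <= 2 * M * ht p by nra.
have sq (u : R) : u ^+ 2 <= 2 * M * (ht p * ht x) -> `|u| <= 2 * M * ht p.
  move=> h; rewrite -ler_sqr ?nnegrE ?real_normK ?num_real //; last by nra.
  by apply: (le_trans h); nra.
split; [apply: sq; nra|apply: sq; nra|].
by rewrite up andbT ler_pdivrMr; nra.
Qed.

(** Only points as near to [p] as [s0] matter, and these lie in a compact box of logarithmic
    coordinates. *)
Lemma nearest_point (S : set (h3 R)) p : S !=set0 ->
  (forall y, ~ S y -> exists2 d : R, 1 < d & forall x, chd y x < d -> ~ S x) ->
  exists2 x, S x & forall y, S y -> chd p x <= chd p y.
Proof.
move=> [s0 Ss0] clS; set M := chd p s0.
have M1 : 1 <= M := chd_ge1 p s0.
set a := 2 * M * ht p.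
pose K := ([set` `[cRe (zc p) - a, cRe (zc p) + a]] `*`
           [set` `[cIm (zc p) - a, cIm (zc p) + a]]) `*`
           [set` `[ln (ht p / (2 * M)), ln a]] : set (R * R * R).
have Kc : compact K by do 2?apply: compact_setX; exact: segment_compact.
pose S' := of_coord @^-1` S.
have S'cl : closed S'.
  rewrite -[S']setCK; apply: open_closedC; rewrite openE => q /= nS.
  have [d d1 Hd] := clS _ nS.
  have : \forall q' \near q, chd (of_coord q) (of_coord q') < d.
    have := chd_continuous (p := of_coord q) (x := q); rewrite /continuous_at chdxx.
    by move/cvgr_lt; apply.
  by apply: filterS => q' /Hd.
have inK x : chd p x <= M -> K (cRe (zc x), cIm (zc x), ln (ht x)).
  move=> /chd_bounds[]; rewrite -/a !ler_norml => /andP[e1 e2] /andP[e3 e4] /andP[e5 e6].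
  have px : 0 < ht p / (2 * M) by rewrite divr_gt0 // mulr_gt0 //; lra.
  have ax : 0 < a by exact: lt_le_trans e6.
  by rewrite /K /=; split; [split|]; rewrite /= in_itv /= ?ler_ln ?posrE ?e5 ?e6 //; lra.
have A0 : (K `&` S') (cRe (zc s0), cIm (zc s0), ln (ht s0)).
  by split; [exact: inK|rewrite /S' /= of_coordK].
have [|||c /set_mem[Kcc Sc] cmin] :=
  @compact_EVT_min _ R (fun q => chd p (of_coord q)) (K `&` S').
- by exists (cRe (zc s0), cIm (zc s0), ln (ht s0)).
- apply: (subclosed_compact _ Kc); last by move=> ? [].
  by apply: closedI => //; exact: compact_closed.
- by apply: continuous_subspaceT; exact: chd_continuous.
exists (of_coord c) => // y Sy.
have [yM|My] := leP (chd p y) M.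
  have := cmin (cRe (zc y), cIm (zc y), ln (ht y)); rewrite of_coordK; apply.
  by apply: mem_set; split; [exact: inK|rewrite /S' /= of_coordK].
apply: le_trans (ltW My); have := cmin _ (mem_set A0); by rewrite of_coordK.
Qed.

End Nearest.

(** * Presentation of a polyhedron by its faces *)

Section Faces.
Variable R : realType.
Implicit Types (x y z p : h3 R) (h k : halfspace R).

Lemma finite_lower_bound (I : finType) (f : I -> R) (b : R) :
  (forall i, b < f i) -> exists2 d, b < d & forall i, d <= f i.
Proof.
(* [b + 1] is the value for an empty index type. *)
move=> bf; exists (\big[Num.min/b + 1]_i f i).
  by apply: lt_bigmin => [|i _]; [lra|exact: bf].
by move=> i; exact: bigmin_le.
Qed.

Lemma faceP (Q : set (h3 R)) h : face Q h <->
  (forall x, Q x -> side h x <= 0) /\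
  exists x, [/\ Q x, side h x = 0 &
    exists2 d : R, 1 < d & forall y, side h y = 0 -> chd x y < d -> Q y].
Proof.
split=> -[Qh [x [Qx hx He]]]; split.
- by move=> y /Qh /hs_setE.
- exists x; split=> //; first exact/hs_planeE.
  case: He => e e0 He; have [d d1 Hd] := hdist_near e0.
  by exists d => // y /hs_planeE hy /Hd; exact: He.
- by move=> y /Qh /hs_setE.
- exists x; split=> //; first exact/hs_planeE.
  case: He => d d1 Hd; exists (arcosh d); first exact: arcosh_gt0.
  by move=> y /hs_planeE hy; rewrite hdist_lt_arcosh ?ltW //; exact: Hd.
Qed.

(** A presentation with the least number of half-spaces consists of faces: some [y] violates the
    i-th half-space alone, and the segment from the interior point [o] to [y] crosses the i-th plane
    strictly inside all the others. *)
Lemma polyhedron_faces (Q : set (h3 R)) : polyhedron Q ->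
  exists (m : nat) (h : 'I_m -> halfspace R) (o : h3 R),
    [/\ forall x, Q x <-> forall i, side (h i) x <= 0,
        forall i, face Q (h i) & forall i, side (h i) o < 0].
Proof.
move=> [ex [ o /hinteriorP[d d1 Hd]] _].
pose P m := `[< exists h : 'I_m -> halfspace R, forall x, Q x <-> forall i, side (h i) x <= 0 >].
have exP : exists m, P m.
  have [m [h Qh]] := ex; exists m; apply/asboolP; exists h => x.
  by rewrite Qh; split=> /= H i; apply/hs_setE; exact: H.
case: (ex_minnP exP) => m /asboolP[h Qh] mmin.
have ho i : side (h i) o < 0.
  have Qo : Q o by apply: Hd; rewrite chdxx.
  rewrite lt_neqAle (proj1 (Qh o) Qo i) andbT; apply/eqP => e.
  have [y [oy]] := plane_near false d1 e.
  by rewrite expr0 mul1r ltNge; have /Qh-> := Hd _ oy.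
exists m, h, o; split=> // i; apply/faceP; split; first by move=> x /Qh.
case: m i h Qh mmin ho => [[]//|m] i h Qh mmin ho.
have [y hy] : exists y, (forall j, j != i -> side (h j) y <= 0) /\ 0 < side (h i) y.
  apply: contrapT => H; suff /mmin : P m by rewrite ltnn.
  apply/asboolP; exists (fun j => h (lift i j)) => x; split=> [/Qh|] Hx; first by [].
  apply/Qh; have Hx' j : j != i -> side (h j) x <= 0.
    by rewrite eq_sym => /unlift_some[j' -> _].
  move=> j; have [->|/Hx'//] := eqVneq j i; rewrite leNgt; apply/negP => hx.
  by apply: H; exists x.
case: hy => hy hiy; set s := - side (h i) o / side (h i) y.
have s0 : 0 < s by rewrite divr_gt0 // oppr_gt0.
have [|||x [l [l0 e]]] := @segment_pt _ 1 s o y; [by []|by lra|by lra|].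
have hx j : l * side (h j) x = side (h j) o + s * side (h j) y.
  by rewrite (side_seg (h j) e) mul1r.
have hx0 : side (h i) x = 0.
  apply/eqP; rewrite -(mulrI_eq0 _ (mulfI (lt0r_neq0 l0))) hx /s divfK ?lt0r_neq0 //.
  by rewrite subrr.
have hxj j : j != i -> side (h j) x < 0.
  move=> ji; rewrite -(pmulr_rlt0 _ l0) hx; have := ho j; have := hy j ji; nra.
have Qx : Q x.
  by apply/Qh => j; have [->|/hxj/ltW//] := eqVneq j i; rewrite hx0.
exists x; split=> //.
have /choice[f Hf] : forall j, exists d, 1 < d /\ (j != i -> forall z, chd x z < d -> side (h j) z <= 0).
  move=> j; have [_|ji] := eqVneq j i; first by exists 2; split=> //; lra.
  have [d' d'1 Hd'] := hs_nbhd (ltr0_neq0 (hxj j ji)).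
  exists d'; split=> // _ z /Hd'; rewrite nmulr_rgt0 ?hxj //; exact: ltW.
have [d' d'1 Hd'] := finite_lower_bound (fun j => (Hf j).1).
exists d' => // z hz xz; apply/Qh => j; have [->|ji] := eqVneq j i; first by rewrite hz.
by apply: (Hf j).2 => //; exact: lt_le_trans (Hd' j).
Qed.

End Faces.

(** * Right-angled ideal polyhedra *)

Section RightAngles.
Variable R : realType.
Implicit Types (x y z p : h3 R) (h k : halfspace R).

Let weight h : R :=
  match h with Vertical n _ _ => normc n | Inside _ r _ | Outside _ r _ => r end.

Let weight_gt0 h : 0 < weight h.
Proof. by case: h => //= n c; exact: normc_gt0. Qed.

(** Conformality of the model: at a common point the Euclidean normals have lengths [weight], and
    their angle is that of the Lorentz normals. *)
Let dot3_outward h k x : hs_plane h x -> hs_plane k x ->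
  dot3 (outward h x) (outward k x) = weight h * weight k * bil (enorm h) (enorm k).
Proof.
have N0 (a b : R) : (a +i* b)%C != 0 -> Num.sqrt (a ^+ 2 + b ^+ 2) != 0.
  by move=> /normc_gt0/lt0r_neq0.
have S (a b : R) : Num.sqrt (a ^+ 2 + b ^+ 2) ^+ 2 = a ^+ 2 + b ^+ 2.
  by rewrite sqr_sqrtr // addr_ge0 ?sqr_ge0.
rewrite /dot3 /bil; case: x => [[u v] t t0].
case: h => [[a b] c n0|[a b] r r0|[a b] r r0];
  case: k => [[a' b'] c' n0'|[a' b'] r' r0'|[a' b'] r' r0'];
  rewrite /hs_plane /= /sqdist ?cdotE ?normc_sqr /= => e1 e2;
  rewrite -?e1 -?e2 ?S; field; do ?[apply/andP; split]; first [by apply: N0 | by rewrite gt_eqF].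
Qed.

Let cauchy_schwarz (u v : R[i] * R) : dot3 u v ^+ 2 <= dot3 u u * dot3 v v.
Proof.
case: u v => [[a b] c] [[d e] f]; rewrite /dot3 !cdotE /= -subr_ge0.
rewrite (_ : _ - _ = (a * e - b * d) ^+ 2 + (a * f - c * d) ^+ 2 + (b * f - c * e) ^+ 2).
  by rewrite !addr_ge0 ?sqr_ge0.
by ring.
Qed.

Let dihedral_orth h k x : hs_plane h x -> hs_plane k x ->
  dihedral_angle h k x = pi / 2 -> bil (enorm h) (enorm k) = 0.
Proof.
move=> hx kx; rewrite /dihedral_angle; set u := outward h x; set v := outward k x.
set w := _ / _ => e.
have {e} e : acos w = pi / 2 by move: e; lra.
have CS := cauchy_schwarz u v.
have nn (t : R[i] * R) : 0 <= dot3 t t.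
  by case: t => [[a b] c]; rewrite /dot3 cdotE /= !addr_ge0 // -expr2 sqr_ge0.
have [s0|s0] := eqVneq (Num.sqrt (dot3 u u) * Num.sqrt (dot3 v v)) 0.
  have : dot3 u v ^+ 2 = 0.
    apply/eqP; rewrite eq_le sqr_ge0 andbT (le_trans CS) //.
    by rewrite -(sqr_sqrtr (nn u)) -(sqr_sqrtr (nn v)) -exprMn s0 expr0n.
  move/eqP; rewrite sqrf_eq0 => /eqP; rewrite dot3_outward // => /eqP.
  by rewrite mulf_eq0 gt_eqF ?mulr_gt0 //= => /eqP.
have w1 : w \in `[-1, 1].
  rewrite in_itv /= -ler_norml -(ler_sqr) ?nnegrE // expr1n real_normK ?num_real //.
  rewrite /w expr_div_n ler_pdivrMr ?mul1r; last by rewrite exprn_even_gt0.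
  by rewrite exprMn !sqr_sqrtr.
have : w = 0 by rewrite -(acosK w1) e cos_pihalf.
move/eqP; rewrite /w mulf_eq0 invr_eq0 (negbTE s0) orbF => /eqP.
rewrite dot3_outward // => /eqP.
by rewrite mulf_eq0 gt_eqF ?mulr_gt0 //= => /eqP.
Qed.

Variables (Q : set (h3 R)) (m : nat) (h : 'I_m -> halfspace R) (o : h3 R).
Hypothesis QE : forall x, Q x <-> forall i, side (h i) x <= 0.
Hypothesis hface : forall i, face Q (h i).
Hypothesis ho : forall i, side (h i) o < 0.
Hypothesis Qright : all_right Q.
Hypothesis Qideal : all_vertices_ideal Q.

(* Since no vertex is finite, some other point lies on all the face planes through
   [x]; near [x], the geodesic towards it stays in [Q]. *)
Lemma meeting_faces_adjacent f g x : face Q f -> face Q g ->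
  hs_plane f <> hs_plane g -> Q x -> side f x = 0 -> side g x = 0 -> Defs.adjacent Q f g.
Proof.
move=> Ff Fg fg Qx fx gx; split=> //.
have [y [yx Hy]] : exists y, y <> x /\ forall k, face Q k -> side k x = 0 -> side k y = 0.
  apply: contrapT => H; apply: (Qideal (x := x)); split=> //.
  apply/seteqP; split=> [y Hy|_ -> k [_ //]]; apply: contrapT => yx; apply: H.
  exists y; split=> // k Fk kx; apply/hs_planeE; apply: (Hy k).
  by split=> //; apply/hs_planeE.
(* A bound on the step towards [y] that keeps every inactive inequality; active planes contain [y],
   so their value 1 is arbitrary. *)
pose t i := if side (h i) x == 0 then 1 else - side (h i) x / (`|side (h i) y| + 1).
have t0 i : 0 < t i.
  rewrite /t; case: eqP => // /eqP hx; rewrite divr_gt0 ?oppr_gt0 ?ltr_wpDl //.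
  by rewrite lt_neqAle hx; exact: (QE x).1.
have [d d0 Hd] := finite_lower_bound t0.
have [|||z [l [l0 e]]] := @segment_pt _ 1 d x y; [by []|by lra|by lra|].
have hz k : l * side k z = side k x + d * side k y by rewrite (side_seg k e) mul1r.
have kz0 k : side k x = 0 -> side k y = 0 -> side k z = 0.
  by move=> e1 e2; apply/eqP; rewrite -(mulrI_eq0 _ (mulfI (lt0r_neq0 l0))) hz e1 e2 mulr0 addr0.
have Qz : Q z.
  apply/QE => i; have := Hd i; rewrite /t; case: eqP => [hx _|hx].
    by rewrite kz0 //; exact: Hy.
  rewrite ler_pdivlMr ?ltr_wpDl // => le_d; rewrite -(pmulr_rle0 _ l0) hz.
  by have := ler_norm (side (h i) y); nra.
exists x, z; split; last first.
  move=> w [->|->]; split; try split=> //; apply/hs_planeE => //; apply: kz0 => //; exact: Hy.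
(* If [z] were [x], pairing the relation with [x] and with [y] would give d (c^2 - 1) = 0 for c =
   [chd x y], hence [y = x]. *)
move=> xz; rewrite -xz in e.
have e1 := congr1 (fun u => - bil (pt x) u) e.
have e2 := congr1 (fun u => - bil (pt y) u) e.
move: e1 e2; rewrite !bil_combr !mul0r !addr0 !bil_pt (bilC (pt y)) !opprD -!mulrN opprK -/(chd x y) => e1 e2.
apply: yx; apply/esym/chd_eq1; have := chd_ge1 x y.
have l1 : l = 1 + d * chd x y by lra.
rewrite l1 in e2 => c1; have : d * (chd x y + 1) * (chd x y - 1) = 0 by lra.
move/eqP; rewrite -mulrA mulf_eq0 (gt_eqF d0) mulf_eq0 gt_eqF ?subr_eq0 //=; last by lra.
by move/eqP.
Qed.

Lemma meeting_faces_orth f g x : face Q f -> face Q g ->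
  hs_plane f <> hs_plane g -> Q x -> side f x = 0 -> side g x = 0 ->
  bil (enorm f) (enorm g) = 0.
Proof.
move=> Ff Fg fg Qx fx gx; have adj := meeting_faces_adjacent Ff Fg fg Qx fx gx.
by apply: (@dihedral_orth _ _ x); [exact/hs_planeE|exact/hs_planeE|];
  apply: Qright => //; exact/hs_planeE.
Qed.

(* The segment from a point of the face to [z] can only leave [Q] through a face
   perpendicular to [f], but [z] is on the same side of that face as [x]. *)
Lemma foot_in_polyhedron f x z l : face Q f -> Q x -> 0 < l ->
  comb 1 (pt x) 1 (pt (reflection f x)) = comb l (pt z) 0 (pt z) -> Q z.
Proof.
move=> Ff Qx l0 e; apply/QE => i0; rewrite leNgt; apply/negP => hi0.
have fz : side f z = 0 := foot_side l0 e.
have [_ [y [Qy fy _]]] := (faceP Q f).1 Ff.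
(* The parameter at which the segment from [y] to [z] crosses the i-th plane; its minimum over the
   violated faces is the exit from [Q]. *)
pose s i := - side (h i) y / side (h i) z.
case: (@arg_minP _ _ _ i0 (fun i => 0 < side (h i) z) s hi0) => i hi smin.
have si0 : 0 <= s i by rewrite divr_ge0 ?(ltW hi) // oppr_ge0; exact: (QE y).1 Qy i.
have [|||w [l' [l'0 e']]] := @segment_pt _ 1 (s i) y z; [by []|by []|by lra|].
have hw k : l' * side k w = side k y + s i * side k z by rewrite (side_seg k e') mul1r.
have w0 k : side k y + s i * side k z = 0 -> side k w = 0.
  by move=> E; apply/eqP; rewrite -(mulrI_eq0 _ (mulfI (lt0r_neq0 l'0))) hw E.
have Qw : Q w.
  apply/QE => j; rewrite -(pmulr_rle0 _ l'0) hw.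
  have hjy : side (h j) y <= 0 by exact: (QE y).1.
  have [hj|hj] := ltP 0 (side (h j) z); last by nra.
  by have := smin j hj; rewrite [in X in _ <= X]/s ler_pdivlMr //; lra.
have orth : bil (enorm f) (enorm (h i)) = 0.
  apply: (@meeting_faces_orth _ _ w) => //.
  - move=> E; have : hs_plane (h i) z by rewrite -E; apply/hs_planeE.
    by move/hs_planeE => E'; rewrite E' ltxx in hi.
  - by apply: w0; rewrite fy fz mulr0 addr0.
  - by apply: w0; rewrite /s divfK ?lt0r_neq0 // subrr.
have := side_seg (h i) e; rewrite side_reflection orth !mul1r mulr0 subr0.
by have := (QE x).1 Qx i; nra.
Qed.

(** The Gram entry [c] decides. If c <= -1, the sum of the normals is causal and the exteriors are
    disjoint. If c >= 1, each normal minus c times the other is causal, which forces equality. If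
    |c| < 1 the planes cross, and [c = 0] is to be shown. *)
Lemma face_trichotomy f g : face Q f -> face Q g ->
  [\/ enorm f = enorm g, bil (enorm f) (enorm g) = 0 |
      forall y, side f y + side g y <= 0].
Proof.
move=> Ff Fg; set c := bil _ _.
have [Qf [x [Qx fx _]]] := (faceP Q f).1 Ff.
have [Qg [x' [Qx' gx' _]]] := (faceP Q g).1 Fg.
have [c1|c1] := leP c (-1).
  constructor 3; set u := comb 1 (enorm f) 1 (enorm g).
  have su y : bil (pt y) u = side f y + side g y by rewrite bil_combr !mul1r.
  have [|| H _] := @causal_sign _ u x.
  - by rewrite /u !(bil_combl, bil_combr) !bil_enorm (bilC (enorm g)) -/c; lra.
  - by rewrite su fx add0r; exact: Qg.
  by move=> y; rewrite -su.
have [c2|c2] := leP 1 c.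
  constructor 1; set u := comb 1 (enorm g) (- c) (enorm f).
  set u' := comb 1 (enorm f) (- c) (enorm g).
  have su y : bil (pt y) u = side g y - c * side f y by rewrite bil_combr mul1r mulNr.
  have su' y : bil (pt y) u' = side f y - c * side g y by rewrite bil_combr mul1r mulNr.
  have qu : bil u u <= 0.
    by rewrite /u !(bil_combl, bil_combr) !bil_enorm (bilC (enorm g)) -/c; nra.
  have qu' : bil u' u' <= 0.
    by rewrite /u' !(bil_combl, bil_combr) !bil_enorm (bilC (enorm g)) -/c; nra.
  have [|H H0] := causal_sign (x := x) qu; first by rewrite su fx mulr0 subr0; exact: Qg.
  have [|H' _] := causal_sign (x := x') qu'; first by rewrite su' gx' mulr0 subr0; exact: Qf.
  have gx : side g x = 0.
    by have := H' x; rewrite su' fx; have := Qg _ Qx; nra.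
  have {}H0 : u = Vec 0 0 0 0 by apply: H0; rewrite su fx gx mulr0 subr0.
  have uc : bil u (enorm g) = 0 by rewrite H0 /bil /=; ring.
  have c3 : c = 1.
    move: uc; rewrite /u bil_combl bil_enorm -/c; nra.
  case: H0; rewrite c3 => e1 e2 e3 e4; apply: vec_eq; lra.
constructor 2.
(* The planes intersect: the point of [Q] closest to a common point [p] equals both
   its feet, hence lies on both planes. *)
have c10 : 0 < 1 - c ^+ 2 by nra.
have planes : hs_plane f <> hs_plane g.
  move=> E; have gx : side g x = 0 by apply/hs_planeE; rewrite -E; exact/hs_planeE.
  (* [x] is pushed within the plane of [f] along the part of the normal of [g] orthogonal to that of
     [f]; the factor 1/2 keeps the vector timelike, and the result leaves the plane of [g]. *)
  pose e : R := 1 / 2; pose u := comb 1 (pt x) e (comb 1 (enorm g) (- c) (enorm f)).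
  have xf : bil (pt x) (enorm f) = 0 by [].
  have xg : bil (pt x) (enorm g) = 0 by [].
  have [|y [l [l0 ue _]]] := @timelike_pt _ u.
    rewrite /u !(bil_combl, bil_combr) !bil_enorm !bil_pt !(bilC _ (pt x)) xf xg.
    by rewrite (bilC (enorm g)) -/c /e; nra.
  have fy : side f y = 0.
    apply/eqP; rewrite -(mulrI_eq0 _ (mulfI l0)) /side -bil_comb1 -ue /u.
    by rewrite !bil_combl xf bil_enorm (bilC (enorm g)) -/c; apply/eqP; ring.
  have : side g y = 0 by apply/hs_planeE; rewrite -E; exact/hs_planeE.
  move/eqP; rewrite -(mulrI_eq0 _ (mulfI l0)) /side -bil_comb1 -ue /u.
  by rewrite !bil_combl xg bil_enorm -/c /e => /eqP; nra.
have [p [fp gp]] : exists p, side f p = 0 /\ side g p = 0.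
  pose a := side f x; pose b := side g x.
  (* The projection of [x] orthogonal to both normals, multiplied by 1 - c^2 to clear
     denominators. *)
  pose u := comb (1 - c ^+ 2) (pt x) 1 (comb (c * b - a) (enorm f) (c * a - b) (enorm g)).
  have uf : bil u (enorm f) = 0.
    by rewrite /u !bil_combl !bil_enorm (bilC (enorm g)) -/c -/(side f x) -/a; ring.
  have ug : bil u (enorm g) = 0.
    by rewrite /u !bil_combl !bil_enorm -/c -/(side g x) -/b; ring.
  have [|p [l [l0 ue _]]] := @timelike_pt _ u.
    rewrite {2}/u !bil_combr uf ug {1}/u !bil_combl !bil_pt !(bilC _ (pt x)) -/(side f x) -/(side g x).
    rewrite -/a -/b /a fx; nra.
  by exists p; split; apply/eqP; rewrite -(mulrI_eq0 _ (mulfI l0)) /side -bil_comb1 -ue ?uf ?ug.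
have [||z Qz zmin] := @nearest_point _ Q p.
- by exists x.
- move=> y nQy; have [i hi] : exists i, 0 < side (h i) y.
    apply: contrapT => H; apply: nQy; apply/QE => i; rewrite leNgt; apply/negP => hi.
    by apply: H; exists i.
  have [d d1 Hd] := hs_nbhd (lt0r_neq0 hi).
  by exists d => // w /Hd; rewrite pmulr_rgt0 // => hw /QE/(_ i); rewrite leNgt hw.
have onplane k : face Q k -> side k p = 0 -> side k z = 0.
  move=> Fk kp; have [w [l [l0 e l2]]] := foot_exists k z.
  have Qw := foot_in_polyhedron Fk Qz l0 e.
  have := congr1 (fun u => - bil (pt p) u) e.
  rewrite bil_combr bil_comb1r !mul1r opprD -mulrN -/(chd p w) -/(chd p z) -/(chd p (reflection k z)).
  rewrite chd_reflection_r kp mulr0 mul0r addr0 => E.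
  have le := zmin _ Qw; have w1 := chd_ge1 p w.
  have l4 : l <= 2 by nra.
  by apply/eqP; rewrite -sqrf_eq0 eq_le sqr_ge0 andbT; nra.
by apply: (@meeting_faces_orth _ _ z) => //; exact: onplane.
Qed.

End RightAngles.

(** * The tiling by the images of a right-angled polyhedron *)

Section Coxeter.
Variable R : realType.
Implicit Types (x y z p : h3 R) (f g : halfspace R) (w : h3 R -> h3 R).
Variables (Q : set (h3 R)) (m : nat) (h : 'I_m -> halfspace R) (o : h3 R).
Hypothesis QE : forall x, Q x <-> forall i, side (h i) x <= 0.
Hypothesis hface : forall i, face Q (h i).
Hypothesis ho : forall i, side (h i) o < 0.
Hypothesis tri : forall f g, face Q f -> face Q g ->
  [\/ enorm f = enorm g, bil (enorm f) (enorm g) = 0 |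
      forall y, side f y + side g y <= 0].
Variable phi : halfspace R -> bool.
Hypothesis phi_plane : forall f g, enorm f = enorm g -> phi f = phi g.

(* The booleans are the parities of the numbers of letters with [phi] false and true. *)
Inductive word : nat -> (h3 R -> h3 R) -> bool -> bool -> Prop :=
| word0 : word 0 id false false
| wordS n f w a b : face Q f -> word n w a b ->
    word n.+1 (reflection f \o w) (a (+) ~~ phi f) (b (+) phi f).

(** Minimal among words with the same element and the same parities, since the element is not yet
    known to determine the parities. *)
Definition reduced n w a b :=
  word n w a b /\ forall k, (k < n)%N -> ~ word k w a b.

Let reflectionKo f w : reflection f \o (reflection f \o w) = w.
Proof. by apply/funext => x /=; rewrite reflectionK. Qed.

Let face_le f x : face Q f -> Q x -> side f x <= 0.
Proof. by move=> /faceP[H _] /H. Qed.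

Lemma reduced_exists n w a b : word n w a b -> exists k, reduced k w a b.
Proof.
move=> W; have ex : exists n, `[< word n w a b >] by exists n; apply/asboolP.
case: (ex_minnP ex) => k /asboolP Wk kmin; exists k; split=> // j jk Wj.
by have := kmin j (asboolT Wj); rewrite leqNgt jk.
Qed.

Lemma reducedS n w a b : reduced n.+1 w a b ->
  exists f w' a' b', [/\ face Q f, reduced n w' a' b', w = reflection f \o w',
    a = a' (+) ~~ phi f & b = b' (+) phi f].
Proof.
move=> [W rW]; inversion W as [|n' f w' a' b' Ff W' e1 e2 e3 e4]; subst.
exists f, w', a', b'; split=> //; split=> // k kn Wk.
by apply: (rW k.+1) => //; exact: wordS.
Qed.

(* Tits' argument; for right-angled groups no induction over the dihedral subgroups
   is needed. *)
Lemma reduced_sides n w a b f : reduced n w a b -> face Q f ->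
  (forall x, Q x -> side f (w x) <= 0) \/
  (forall x, Q x -> 0 <= side f (w x)) /\
  exists2 k, (k < n)%N & word k (reflection f \o w) (a (+) ~~ phi f) (b (+) phi f).
Proof.
elim: n w a b f => [|n IH] w a b f.
  move=> [W _] Ff; left => x Qx; inversion W; subst; exact: face_le.
move=> rw Ff; have [t [w' [a' [b' [Ft rw' ew ea eb]]]]] := reducedS rw.
have noback k : (k < n)%N -> ~ word k (reflection t \o w') (a' (+) ~~ phi t) (b' (+) phi t).
  by move=> kn W; case: rw => _ /(_ k (leqW kn)); rewrite ew ea eb.
have back : forall x, Q x -> 0 <= side t (w x).
  move=> x Qx; have [H|[_ [k kn /noback]]//] := IH _ _ _ t rw' Ft.
  by rewrite ew /= side_reflection_self oppr_ge0 H.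
(* Equal planes: the letter cancels. Perpendicular planes: [f] commutes past [t]. Disjoint
   exteriors: the tile lies beyond [t], hence not beyond [f]. *)
have [e|e|e] := tri Ft Ff.
- right; split=> [x Qx|]; first by rewrite /side -e; exact: back.
  exists n => //; rewrite -(reflection_eq e) -(phi_plane e) ew ea eb.
  by rewrite reflectionKo -!addbA !addbb !addbF; case: rw'.
- have [H|[H [k kn W]]] := IH _ _ _ f rw' Ff.
    by left=> x Qx; rewrite ew /= side_reflection e mulr0 subr0 H.
  right; split=> [x Qx|]; first by rewrite ew /= side_reflection e mulr0 subr0 H.
  exists k.+1 => //; rewrite ew compA -(reflection_comm e) -compA ea eb.
  by rewrite addbAC (addbAC b'); exact: wordS.
- by left=> x Qx; have := e (w x); have := back _ Qx; lra.
Qed.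

Lemma word_cat n n' w w' a b a' b' : word n w a b -> word n' w' a' b' ->
  word (n + n') (w \o w') (a (+) a') (b (+) b').
Proof.
move=> W W'; elim: W => [|k f v c d Ff W IH]; first by rewrite !addFb.
by rewrite addSn addbAC (addbAC d) -compA; exact: wordS.
Qed.

Lemma word1 f : face Q f -> word 1 (reflection f) (~~ phi f) (phi f).
Proof.
move=> Ff; have := wordS Ff word0; rewrite !addFb.
by rewrite (_ : reflection f \o id = reflection f).
Qed.

Lemma word_inv n w a b : word n w a b ->
  exists w', [/\ word n w' a b, w \o w' = id & w' \o w = id].
Proof.
elim=> [|k f v c d Ff W [v' [W' e1 e2]]]; first by exists id; split=> //; exact: word0.
exists (v' \o reflection f); split.
- by rewrite -addn1; exact: word_cat (word1 Ff).
- apply/funext => x /=; have := congr1 (fun u => u (reflection f x)) e1.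
  by rewrite /= => ->; rewrite reflectionK.
- apply/funext => x /=; have := congr1 (fun u => u x) e2.
  by rewrite /= => E; rewrite reflectionK.
Qed.

Lemma word_chd n w a b x y : word n w a b -> chd (w x) (w y) = chd x y.
Proof. by elim=> //= k f v c d _ _ IH; rewrite chd_reflection. Qed.

Lemma interior_ball x : (forall i, side (h i) x < 0) ->
  exists2 d : R, 1 < d & forall y, chd x y < d -> Q y.
Proof.
move=> xh; have /choice[g Hg] : forall i, exists d, 1 < d /\ forall z, chd x z < d -> side (h i) z <= 0.
  move=> i; have [d d1 Hd] := hs_nbhd (ltr0_neq0 (xh i)).
  by exists d; split=> // z /Hd; rewrite nmulr_rgt0 //; exact: ltW.
have [d d1 Hd] := finite_lower_bound (fun j => (Hg j).1).
by exists d => // y xy; apply/QE => j; apply: (Hg j).2; exact: lt_le_trans (Hd j).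
Qed.

(** If a reduced word for [w] began with [t], the rest [w'] would map [Q] to the inner side of [t],
    while [w x] in [Q] puts [w' x] on the plane; but a neighbourhood of [w' x] lies in the image of
    [Q]. *)
Lemma word_tile n w a b x : word n w a b -> (forall i, side (h i) x < 0) -> Q (w x) ->
  [/\ w = id, a = false & b = false].
Proof.
move=> /reduced_exists[k rw] xh Qwx.
case: k rw => [[W _]|k rw]; first by inversion W.
exfalso; have [t [w' [a' [b' [Ft rw' ew ea eb]]]]] := reducedS rw.
have [H|[_ [j jk]]] := reduced_sides rw' Ft; last first.
  by rewrite -ew -ea -eb; case: rw => _ /(_ j (leqW jk)).
have [d d1 Hd] := interior_ball xh.
have Qx : Q x by apply: Hd; rewrite chdxx.
have tx : side t (w' x) = 0.
  apply/eqP; rewrite eq_le H //=; have := face_le Ft Qwx.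
  by rewrite ew /= side_reflection_self oppr_le0.
have [y [xy]] := plane_near false d1 tx; rewrite expr0 mul1r ltNge.
have [v [_ e _]] := word_inv rw'.1.
have ey : w' (v y) = y by have := congr1 (fun u => u y) e.
move/negP; apply; rewrite -ey; apply/H/Hd.
by rewrite -(word_chd x (v y) rw'.1) ey.
Qed.

(** Two words for one element combine to a word for the identity, which fixes the interior point [o]
    and so has even parities. *)
Lemma word_parity n n' w a b a' b' : word n w a b -> word n' w a' b' ->
  a = a' /\ b = b'.
Proof.
move=> W W'; have [v [V _ e]] := word_inv W.
have := word_cat V W'; rewrite e => U.
have Qo : Q (id o) by have [d d1] := interior_ball ho; apply; rewrite chdxx.
have [_] := word_tile U ho Qo.
by case: a {W V U}; case: a' {W'}; case: b; case: b'.
Qed.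

(** Each letter of a reduced word reflects a point on the inner side of its face. It is applied to
    minus the distance from a point of [Q] for the Dirichlet domain, and to the height for the
    isometric spheres. *)
Lemma word_fold (F : h3 R -> R) n w a b x :
  (forall f y, face Q f -> side f y <= 0 -> F (reflection f y) <= F y) ->
  word n w a b -> Q x -> F (w x) <= F x.
Proof.
move=> HF /reduced_exists[{}n rw] Qx.
elim: n w a b rw => [|n IH] w a b rw; first by case: rw => W _; inversion W.
have [t [w' [a' [b' [Ft rw' ew ea eb]]]]] := reducedS rw.
have [H|[_ [j jk]]] := reduced_sides rw' Ft; last first.
  by rewrite -ew -ea -eb; case: rw => _ /(_ j (leqW jk)).
by rewrite ew /=; apply: le_trans (IH _ _ _ rw'); apply: HF => //; exact: H.
Qed.

(** Take the orbit point of [o] nearest to [x] and move it back to [o]: if the image of [x] violated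
    a face, the reflection of [o] in it would be nearer. *)
Lemma word_cover x : exists n w a b, word n w a b /\ Q (w x).
Proof.
pose S := [set w o | w in [set w | exists n a b, word n w a b]].
have [d d1 Hd] := interior_ball ho.
have sep y z : S y -> S z -> chd y z < d -> y = z.
  move=> [w [n [a [b W]]] <-] [w' [n' [a' [b' W']]] <-] yz.
  have [v [V e1 e2]] := word_inv W.
  have VW := word_cat V W'.
  have [|e _ _] := word_tile VW ho.
    apply: Hd; rewrite -(word_chd _ _ W).
    by have := congr1 (fun u => u (w' o)) e1 => /= ->.
  have := congr1 (fun u => w (u o)) e => /=.
  by have := congr1 (fun u => u (w' o)) e1 => /= -> ->.
(* Half the radius, by the doubling formula of [chd_triangle]. *)
pose d' := Num.sqrt ((1 + d) / 2).
have d'1 : 1 < d' by rewrite -[ltLHS]sqrtr1 ltr_sqrt; lra.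
have d'2 : 2 * d' ^+ 2 - 1 = d by rewrite sqr_sqrtr; lra.
have [||y [w [n [a [b W]]] wy] ymin] := @nearest_point _ S x.
- by exists o, id => //; exists 0, false, false; exact: word0.
- move=> y nSy.
  have [[z [Sz yz]]|none] := pselect (exists z, S z /\ chd y z < d'); last first.
    by exists d' => // z yz Sz; apply: none; exists z.
  (* Another orbit point this close to [y] would be within [d] of [z], hence equal to [z], which the
     second bound excludes. *)
  exists (Num.min d' (chd y z)).
    rewrite lt_min d'1 lt_neqAle chd_ge1 andbT eq_sym; apply/eqP => /chd_eq1 E.
    by apply: nSy; rewrite E.
  move=> u; rewrite lt_min => /andP[yu1 yu2] Su.
  have := sep z u Sz Su; rewrite -{1}d'2 => /(_ (chd_triangle yz yu1)) E.
  by move: yu2; rewrite E ltxx.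
have [v [V e1 e2]] := word_inv W.
have vy : v y = o by rewrite -wy; exact: (congr1 (fun u => u o) e2).
exists n, v, a, b; split=> //; apply/QE => i; rewrite leNgt; apply/negP => hi.
have Sz : S (w (reflection (h i) o)).
  exists (w \o reflection (h i)) => //.
  by exists (n + 1)%N, (a (+) ~~ phi (h i)), (b (+) phi (h i)); exact: word_cat (word1 _).
have := ymin _ Sz.
rewrite -(word_chd x y V) -(word_chd x (w (reflection (h i) o)) V) vy.
have -> : v (w (reflection (h i) o)) = reflection (h i) o by exact: (congr1 (fun u => u _) e2).
by rewrite chd_reflection_r; have := ho i; nra.
Qed.

Lemma reflection_groupP w : reflection_group Q w <-> exists n a b, word n w a b.
Proof.
split=> [H|[n [a [b]]]].
  apply: (H [set w | exists n a b, word n w a b]); split; first split.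
  - by exists 0, false, false; exact: word0.
  - move=> u v [n [a [b W]]] [n' [a' [b' W']]].
    by exists (n + n')%N, (a (+) a'), (b (+) b'); exact: word_cat.
  - move=> u [n [a [b W]]]; have [v [V e1 e2]] := word_inv W.
    by exists v; split=> //; exists n, a, b.
  - by move=> _ [f Ff <-]; exists 1%N, (~~ phi f), (phi f); exact: word1.
elim=> [|k f v c d Ff W IH] A [[A1 AM AV] AF]; first by [].
apply: (AM _ v); last exact: (IH A (conj (And3 A1 AM AV) AF)).
by apply: AF; exists f.
Qed.

End Coxeter.

(** * Reflections and Moebius transformations *)

Section Moebius.
Variable R : realType.
Local Notation C := R[i].
Implicit Types (x y : h3 R) (M N : sl2 R) (z : C).
Local Notation "z ^*" := (conjc z) : ring_scope.

Lemma normc_conj z : (normc z ^+ 2)%:C%C = z * z^*.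
Proof.
by rewrite normc_sqr; case: z => a b; apply: complex_eq => /=; ring.
Qed.

Lemma normcD z z' : normc (z + z') <= normc z + normc z'.
Proof.
case: z z' => a b [c d] /=.
have s0 (u v : R) : 0 <= u ^+ 2 + v ^+ 2 by rewrite addr_ge0 ?sqr_ge0.
have cs : a * c + b * d <= Num.sqrt (a ^+ 2 + b ^+ 2) * Num.sqrt (c ^+ 2 + d ^+ 2).
  rewrite -sqrtrM //; apply: le_trans (ler_norm _) _; rewrite -sqrtr_sqr ler_wsqrtr //.
  by have := sqr_ge0 (a * d - b * c); nra.
rewrite -ler_sqr ?nnegrE ?addr_ge0 ?sqrtr_ge0 // sqr_sqrtr // [in leRHS]sqrrD !sqr_sqrtr //.
by move: cs; set S := Num.sqrt _ * _; lra.
Qed.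

Lemma normcN z : normc (- z) = normc z.
Proof. by case: z => a b /=; rewrite !sqrrN. Qed.

Let lift1 : lift ord0 ord0 = 1 :> 'I_2. Proof. exact: val_inj. Qed.

Lemma det_mx2 (A : 'M[C]_2) : \det A = A 0 0 * A 1 1 - A 0 1 * A 1 0.
Proof.
rewrite (expand_det_row _ 0) !big_ord_recl big_ord0 addr0 /cofactor !det_mx11 !mxE.
rewrite !lift1 /= expr0 expr1 mul1r mulN1r mulrN.
by congr (_ * A _ _ - _ * A _ _); apply: val_inj.
Qed.

Lemma sl2_det M : ma M * md M - mb M * mc M = 1.
Proof. by rewrite -(det_sl2 M) det_mx2. Qed.

Definition mk_mx (a b c d : C) : 'M[C]_2 :=
  \matrix_(i, j) if i == 0 then (if j == 0 then a else b) else (if j == 0 then c else d).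

Lemma mk_mx_det a b c d : a * d - b * c = 1 -> \det (mk_mx a b c d) = 1.
Proof. by move=> e; rewrite det_mx2 !mxE. Qed.

Definition mk_sl2 a b c d (e : a * d - b * c = 1) : sl2 R := SL2 (mk_mx_det e).

Lemma mk_sl2E a b c d (e : a * d - b * c = 1) : let M := mk_sl2 e in
  [/\ ma M = a, mb M = b, mc M = c & md M = d].
Proof. by rewrite /ma /mb /mc /md /= !mxE. Qed.

Let conjD (u v : C) : (u + v)^* = u^* + v^*.
Proof. by case: u v => ? ? [? ?]; apply: complex_eq => /=; ring. Qed.

Let conjM (u v : C) : (u * v)^* = u^* * v^*.
Proof. by case: u v => ? ? [? ?]; apply: complex_eq => /=; ring. Qed.

Let conj_re (r : R) : (r%:C%C)^* = r%:C%C :> C.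
Proof. by apply: complex_eq => //=; ring. Qed.

Let conjK (u : C) : u^*^* = u.
Proof. by case: u => ? ?; apply: complex_eq => //=; ring. Qed.

Let conj1 : (1 : C)^* = 1.
Proof. by apply: complex_eq => //=; ring. Qed.

Let reD (r s : R) : (r + s)%:C%C = r%:C%C + s%:C%C :> C.
Proof. by apply: complex_eq => //=; ring. Qed.

Let reM (r s : R) : (r * s)%:C%C = r%:C%C * s%:C%C :> C.
Proof. by apply: complex_eq => //=; ring. Qed.

Let reI (r s : R) : r%:C%C = s%:C%C :> C -> r = s.
Proof. by case. Qed.

Let conjB (u v : C) : (u - v)^* = u^* - v^*.
Proof. by case: u v => ? ? [? ?]; apply: complex_eq => /=; ring. Qed.

Let reX (r : R) : (r ^+ 2)%:C%C = r%:C%C ^+ 2 :> C.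
Proof. by rewrite !expr2 reM. Qed.

Let reV (r : R) : (r^-1)%:C%C = (r%:C%C)^-1 :> C.
Proof. exact: (fmorphV (real_complex R)). Qed.

Let num M x : C := (ma M * zc x + mb M) * (mc M * zc x + md M)^* + ma M * (mc M)^* * (ht x ^+ 2)%:C%C.

Let denE M x : (act_den M x)%:C%C =
  (mc M * zc x + md M) * (mc M * zc x + md M)^* + mc M * (mc M)^* * (ht x ^+ 2)%:C%C.
Proof. by rewrite /act_den reD (reM (normc (mc M) ^+ 2)) !normc_conj. Qed.

Let den_neq0 M x : (act_den M x)%:C%C != 0 :> C.
Proof. by apply/eqP => -[] /eqP; rewrite gt_eqF // act_den_gt0. Qed.

(* Primed letters stand for complex conjugates. *)
Let moebius_identity (F : fieldType) (a b c' d' p q r s p' q' r' s' z z' T : F) :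
  (p * s - q * r) * (p' * s' - q' * r') = 1 ->
  let D := (r * z + s) * (r' * z' + s') + r * r' * T in
  let n := (p * z + q) * (r' * z' + s') + p * r' * T in
  let n' := (p' * z' + q') * (r * z + s) + p' * r * T in
  (a * n + b * D) * (c' * n' + d' * D) + a * c' * T =
  D * (((a * p + b * r) * z + (a * q + b * s)) * ((c' * p' + d' * r') * z' + (c' * q' + d' * s'))
       + (a * p + b * r) * (c' * p' + d' * r') * T).
Proof. by move=> e /=; rewrite -[X in X + _ = _]addr0 -[a * c' * T]mulr1 -e; ring. Qed.

Let sl2_det_conj M : (ma M * md M - mb M * mc M) * ((ma M)^* * (md M)^* - (mb M)^* * (mc M)^*) = 1.
Proof.
by rewrite sl2_det mul1r -!conjM -conjB sl2_det conj1.
Qed.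

Lemma act_mul M N : exists L, act M \o act N = act L.
Proof.
have e : (ma M * ma N + mb M * mc N) * (mc M * mb N + md M * md N) -
  (ma M * mb N + mb M * md N) * (mc M * ma N + md M * mc N) = 1.
  by rewrite -[RHS]mulr1 -{1}(sl2_det M) -(sl2_det N); ring.
exists (mk_sl2 e); apply/funext => x /=; have [ea eb ec ed] := mk_sl2E e.
set L := mk_sl2 e in ea eb ec ed *.
have D0 := den_neq0 N x; set D := (act_den N x)%:C%C in D0.
have zN : zc (act N x) = num N x / D by [].
have tN : (ht (act N x) ^+ 2)%:C%C = (ht x ^+ 2)%:C%C / D ^+ 2.
  by rewrite /= expr_div_n reM reV (reX (act_den N x)).
have numc : (num N x)^* = ((ma N)^* * (zc x)^* + (mb N)^*) * (mc N * zc x + md N)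
    + (ma N)^* * mc N * (ht x ^+ 2)%:C%C.
  rewrite /num conjD; congr (_ + _).
    by rewrite conjM conjK conjD conjM.
  by rewrite (conjM (ma N * _)) conjM conjK conj_re.
(* Taking (a, b) = (c, d) yields the denominator of the composite as well as its numerator. *)
have key (a b c d : C) : (a * zc (act N x) + b) * (c * zc (act N x) + d)^* + a * c^* * (ht (act N x) ^+ 2)%:C%C
  = (((a * ma N + b * mc N) * zc x + (a * mb N + b * md N)) *
     ((c * ma N + d * mc N) * zc x + (c * mb N + d * md N))^*
     + (a * ma N + b * mc N) * (c * ma N + d * mc N)^* * (ht x ^+ 2)%:C%C) / D.
  have Dc : (D^-1)^* = D^-1 by rewrite /D -reV conj_re.
  have E := moebius_identity a b c^* d^* (zc x) (zc x)^* (ht x ^+ 2)%:C%C (sl2_det_conj N).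
  rewrite /= -numc in E.
  have DE : (mc N * zc x + md N) * ((mc N)^* * (zc x)^* + (md N)^*)
      + mc N * (mc N)^* * (ht x ^+ 2)%:C%C = D by rewrite /D denE conjD conjM.
  have nE : (ma N * zc x + mb N) * ((mc N)^* * (zc x)^* + (md N)^*)
      + ma N * (mc N)^* * (ht x ^+ 2)%:C%C = num N x by rewrite /num conjD conjM.
  rewrite DE nE in E; rewrite zN tN.
  move: E; clear DE nE numc tN zN; move: (num N x) => n E.
  rewrite !(conjD, conjM) Dc.
  transitivity (((a * n + b * D) * (c^* * n^* + d^* * D)
    + a * c^* * (ht x ^+ 2)%:C%C) / D ^+ 2); first by field.
  by rewrite E; field.
have denL : (act_den M (act N x))%:C%C = (act_den L x)%:C%C / D.
  by rewrite denE key -ec -ed [in RHS]denE.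
apply: h3_eq => /=.
  rewrite -[LHS]/(num M (act N x) / (act_den M (act N x))%:C%C) /num key denL -ea -eb -ec -ed.
  by rewrite -[RHS]/(num L x / (act_den L x)%:C%C) /num; field; rewrite D0 den_neq0.
have {}denL : act_den M (act N x) = act_den L x / act_den N x.
  apply: reI; rewrite denL; apply: (mulIf D0); rewrite divfK // -reM divfK //.
  by rewrite gt_eqF // act_den_gt0.
rewrite denL; field; rewrite !gt_eqF //; exact: act_den_gt0.
Qed.

(** One orientation-reversing isometry to compare all reflections with: an even product of
    reflections is then some [act M]. *)
Definition mirror x : h3 R := H3 (zc x)^* (ht_gt0 x).

Lemma mirrorK : involutive mirror.
Proof. by move=> x; apply: h3_eq => //=; exact: conjK. Qed.

Lemma mirror_act M : exists L, mirror \o act M \o mirror = act L.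
Proof.
have e : (ma M)^* * (md M)^* - (mb M)^* * (mc M)^* = 1.
  by rewrite -!conjM -conjB sl2_det conj1.
exists (mk_sl2 e); apply/funext => x; have [ea eb ec ed] := mk_sl2E e.
set L := mk_sl2 e in ea eb ec ed *.
have D : act_den L x = act_den M (mirror x).
  by apply: reI; rewrite !denE /= ec ed !(conjD, conjM, conjK); ring.
apply: h3_eq => /=; last by rewrite D.
rewrite conjM -reV conj_re reV -D ea eb ec ed; congr (_ / _).
by rewrite !(conjD, conjM, conjK) conj_re.
Qed.

Lemma reflection_mirror (h : halfspace R) : exists M, reflection h = act M \o mirror.
Proof.
have inv (p : C) (r : R) (r0 : 0 < r) : exists M, inversion p r0 = act M \o mirror.
  have rn : r != 0 by rewrite gt_eqF.
  (* The matrix is i/r times the one with rows (p, r^2 - |p|^2) and (1, - conj p), which sends conj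
     z to p + r^2 / (conj z - conj p). *)
  have e : ((- cIm p / r) +i* (cRe p / r))%C * ((- cIm p / r) +i* (- cRe p / r))%C
      - (0 +i* ((r ^+ 2 - (cRe p ^+ 2 + cIm p ^+ 2)) / r))%C * (0 +i* r^-1)%C = 1 :> C.
    by apply: complex_eq => /=; field.
  exists (mk_sl2 e); apply/funext => x; have [ea eb ec ed] := mk_sl2E e.
  set L := mk_sl2 e in ea eb ec ed *.
  have D : act_den L (mirror x) = sqdist p x / r ^+ 2.
    rewrite /act_den ec ed /sqdist !normc_sqr /=; case: (p) (x) => a b [[u v] t t0] /=.
    by field.
  have s0 : sqdist p x != 0 by rewrite gt_eqF // sqdist_gt0.
  apply: h3_eq => /=; last by rewrite D; field; apply/andP.
  rewrite -reV D -/(num L (mirror x)) /num ea eb ec ed.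
  have : sqdist p x = normc (zc x - p) ^+ 2 + ht x ^+ 2 by [].
  rewrite normc_sqr; move: (sqdist p x) s0 => S s0.
  case: p x {e L ea eb ec ed D} => a b [[u v] t t0] /= SE.
  have t2 : t ^+ 2 = S - (u - a) ^+ 2 - (v - b) ^+ 2 by rewrite SE; ring.
  by apply: complex_eq => /=; rewrite ?t2; field; apply/andP.
case: h => [n c n0|p r r0|p r r0].
- have N0 := normc_gt0 n0; have N2 := normc_sqr n.
  set m := normc n in N0 N2.
  (* The matrix is i/m times the one with rows (n, -2c) and (0, - conj n), where m = |n|. *)
  have e : ((- cIm n / m) +i* (cRe n / m))%C * ((- cIm n / m) +i* (- cRe n / m))%C
      - (0 +i* (- 2 * c / m))%C * 0 = 1 :> C.
    rewrite mulr0 subr0; apply: complex_eq => /=; last by ring.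
    transitivity ((cRe n ^+ 2 + cIm n ^+ 2) / m ^+ 2); first by field; rewrite gt_eqF.
    by rewrite -N2 divff // sqrf_eq0 gt_eqF.
  exists (mk_sl2 e); apply/funext => x; have [ea eb ec ed] := mk_sl2E e.
  set L := mk_sl2 e in ea eb ec ed *.
  have D : act_den L (mirror x) = 1.
    rewrite /act_den ec ed mul0r add0r !normc_sqr /= expr0n /= addr0 mul0r addr0.
    transitivity ((cRe n ^+ 2 + cIm n ^+ 2) / m ^+ 2); first by field; rewrite gt_eqF.
    by rewrite -N2 divff // sqrf_eq0 gt_eqF.
  apply: h3_eq => /=; last by rewrite D divr1.
  rewrite D divr1 ea eb ec ed !mul0r add0r cdotE -/m.
  case: n n0 @m N0 N2 {e L ea eb ec ed D} => a b n0 m N0 N2.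
  case: x => [[u v] t t0] /=.
  have m0 : m != 0 by rewrite gt_eqF.
  have m2 : b ^+ 2 = m ^+ 2 - a ^+ 2 by rewrite N2 /=; ring.
  by apply: complex_eq => /=; field : m2.
- exact: inv.
- exact: inv.
Qed.

(** [act M] divides the height by [act_den M x], which is |c|^2 times the squared distance to the
    centre of the isometric sphere. *)
Lemma act_outside_isometric M x : mc M != 0 ->
  ((normc (mc M))^-1 ^+ 2 <= sqdist (- md M / mc M) x) = (ht (act M x) <= ht x).
Proof.
move=> c0; have nc := normc_gt0 c0; have D0 := act_den_gt0 M x.
have DE : act_den M x = normc (mc M) ^+ 2 * sqdist (- md M / mc M) x.
  rewrite /act_den /sqdist mulrDr; congr (_ + _).
  rewrite -exprMn -ComplexField.Normc.normcM; congr (normc _ ^+ 2); field.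
  exact: c0.
rewrite [in RHS]/= [in RHS]ler_pdivrMr ?act_den_gt0 // [in RHS]ler_pMr // DE exprVn.
by rewrite -(ler_pM2l (exprn_gt0 2 nc)) divff // gt_eqF // exprn_gt0.
Qed.

Lemma act_infinity M x : mc M = 0 ->
  [/\ zc (act M x) = act_plane M (zc x), ht (act M x) = ht x / normc (md M) ^+ 2 &
      0 < normc (md M)].
Proof.
move=> c0; have d0 : md M != 0.
  apply/eqP => d0; have := sl2_det M; rewrite c0 d0 !mulr0 subr0 => /eqP.
  by rewrite eq_sym oner_eq0.
have dc0 : (md M)^* != 0.
  by apply/eqP => e; move: d0; rewrite -[md M]conjK e; rewrite (_ : 0^* = 0) ?eqxx //;
    apply: complex_eq => //=; ring.
have D : act_den M x = normc (md M) ^+ 2.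
  by rewrite /act_den c0 mul0r add0r ComplexField.Normc.normc0 expr0n /= mul0r addr0.
split; last exact: normc_gt0.
- rewrite -[LHS]/(num M x / (act_den M x)%:C%C) D normc_conj /num c0 mul0r add0r.
  by rewrite (_ : 0^* = 0) ?mulr0 ?mul0r ?addr0 /act_plane; [field; apply/andP|apply: complex_eq => //=; ring].
- by rewrite /= D.
Qed.

Definition translation (u : C) x : h3 R := H3 (zc x + u) (ht_gt0 x).

Lemma translation_act (u : C) : exists M, [/\ act M = translation u, mc M = 0 &
  forall z, act_plane M z = z + u].
Proof.
have e : 1 * 1 - u * 0 = 1 :> C by ring.
exists (mk_sl2 e); have [ea eb ec ed] := mk_sl2E e.
have ap z : act_plane (mk_sl2 e) z = z + u.
  by rewrite /act_plane ea eb ed mul1r divr1.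
split=> //; apply/funext => x; have [e1 e2 _] := act_infinity x ec.
apply: h3_eq; rewrite ?e1 ?e2 ?ap // ed ComplexField.Normc.normc1 expr1n divr1 //.
Qed.

(* Conjugating [w] to the point of height 1 over 0, twice the hyperbolic cosine of
   the displacement becomes the sum of the squared moduli of the entries. *)
Let displacement M w : 2 * chd w (act M w) =
  normc (ma M - zc w * mc M) ^+ 2 +
  normc (ma M * zc w + mb M - zc w * (mc M * zc w + md M)) ^+ 2 / ht w ^+ 2 +
  normc (mc M) ^+ 2 * ht w ^+ 2 + normc (mc M * zc w + md M) ^+ 2.
Proof.
set u := _ - zc w * (_ + _); set v := ma M - _.
have D0 := act_den_gt0 M w; set D := act_den M w in D0.
have t0 : ht w != 0 by []. 
have key : normc (zc w * D%:C%C - num M w) ^+ 2 + ht w ^+ 2 =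
    D * (normc u ^+ 2 + normc v ^+ 2 * ht w ^+ 2).
  have reE (a b c e : R) : (a * (b + c * e))%:C%C = a%:C%C * (b%:C%C + c%:C%C * e%:C%C) :> C.
    by apply: complex_eq => /=; ring.
  apply: reI; rewrite reD reE !normc_conj.
  rewrite -[(ht w ^+ 2)%:C%C in LHS]mulr1 -[X in _ + _ * X = _](sl2_det_conj M).
  have nc : (num M w)^* = ((ma M)^* * (zc w)^* + (mb M)^*) * (mc M * zc w + md M)
    + (ma M)^* * mc M * (ht w ^+ 2)%:C%C.
    rewrite /num conjD; congr (_ + _); first by rewrite conjM conjK conjD conjM.
    by rewrite (conjM (ma M * _)) conjM conjK conj_re.
  rewrite (conjB (zc w * _)) (conjM (zc w)) conj_re nc /num denE /u /v.
  by rewrite !(conjB, conjD, conjM); ring.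
rewrite chdE -[ht (act M w)]/(ht w / D).
have -> : normc (zc w - zc (act M w)) ^+ 2 = normc (zc w * D%:C%C - num M w) ^+ 2 / D ^+ 2.
  have -> : zc w - zc (act M w) = (zc w * D%:C%C - num M w) / D%:C%C.
    rewrite -[zc (act M w)]/(num M w / D%:C%C); field.
    exact: den_neq0.
  rewrite ComplexField.Normc.normcM ComplexField.Normc.normcV exprMn exprVn.
  congr (_ / _); rewrite normc_sqr /= expr0n addr0 //.
have -> : normc (mc M * zc w + md M) ^+ 2 = D - normc (mc M) ^+ 2 * ht w ^+ 2.
  by rewrite /D /act_den; ring.
have -> : normc (zc w * D%:C%C - num M w) ^+ 2 =
    D * (normc u ^+ 2 + normc v ^+ 2 * ht w ^+ 2) - ht w ^+ 2 by rewrite -key; ring.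
by field; rewrite t0 gt_eqF.
Qed.

Lemma act_near_id w (d : R) : 1 < d -> exists2 e : R, 0 < e & forall M,
  (forall i j, normc (sl2_mx M i j - (1%:M : 'M[C]_2) i j) < e) -> chd w (act M w) < d.
Proof.
move=> d1; set Z := normc (zc w); have Z0 : 0 <= Z := normc_ge0 _.
have t0 := ht_gt0 w; set t := ht w in t0.
(* [K] dominates the factors 1 + Z, (1 + Z)^2 / t and t by which the entries of M - 1 enter the four
   terms of [displacement]. *)
pose K := 1 + Z + (1 + Z) ^+ 2 / t + t.
have K1 : 1 + Z <= K by rewrite /K -addrA lerDl addr_ge0 ?divr_ge0 ?sqr_ge0 // ltW.
have K2 : (1 + Z) ^+ 2 / t <= K by rewrite /K; lra.
have K3 : t <= K.
  have : 0 <= (1 + Z) ^+ 2 / t by rewrite divr_ge0 ?sqr_ge0 // ltW.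
  by rewrite /K; lra.
have K0 : 0 < K by lra.
(* With k = e K <= 1, twice [chd w (act M w)] is at most 2 (1 + k)^2 + 2 k^2 <= 2 + 8 k <= 1 + d < 2
   d. *)
pose e := Num.min 1 ((d - 1) / 8) / K.
have e0 : 0 < e by rewrite divr_gt0 // lt_min ltr01 divr_gt0 // subr_gt0.
have eK1 : e * K <= 1 by rewrite /e divfK ?gt_eqF // ge_min lexx.
have eK2 : e * K <= (d - 1) / 8 by rewrite /e divfK ?gt_eqF // ge_min lexx orbT.
exists e => // M H.
have Ha : normc (ma M - 1) < e by have := H 0 0; rewrite mxE.
have Hb : normc (mb M) < e by have := H 0 1; rewrite mxE /= subr0.
have Hc : normc (mc M) < e by have := H 1 0; rewrite mxE /= subr0.
have Hd : normc (md M - 1) < e by have := H 1 1; rewrite mxE.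
have nM u v : normc (u * v) = normc u * normc v := ComplexField.Normc.normcM u v.
have n1 : normc 1 = 1 :> R := ComplexField.Normc.normc1 R.
have b1 : normc (ma M - zc w * mc M) <= 1 + e * K.
  rewrite (_ : _ - _ = 1 + ((ma M - 1) + - (zc w * mc M))); last by ring.
  apply: le_trans (normcD _ _) _; rewrite n1 lerD2l; apply: le_trans (normcD _ _) _.
  by rewrite normcN nM -/Z; have := normc_ge0 (mc M); nra.
have b4 : normc (mc M * zc w + md M) <= 1 + e * K.
  rewrite (_ : _ + _ = 1 + ((md M - 1) + mc M * zc w)); last by ring.
  apply: le_trans (normcD _ _) _; rewrite n1 lerD2l; apply: le_trans (normcD _ _) _.
  by rewrite nM -/Z; have := normc_ge0 (mc M); nra.
have b3 : normc (mc M) * t <= e * K by have := normc_ge0 (mc M); nra.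
have b2 : normc (ma M * zc w + mb M - zc w * (mc M * zc w + md M)) / t <= e * K.
  rewrite (_ : _ - _ = (ma M - 1) * zc w + mb M + (- (mc M * zc w * zc w) + - ((md M - 1) * zc w))); last by ring.
  have : normc ((ma M - 1) * zc w + mb M + (- (mc M * zc w * zc w) + - ((md M - 1) * zc w))) <= e * (1 + Z) ^+ 2.
    apply: le_trans (normcD _ _) _.
    have := normcD ((ma M - 1) * zc w) (mb M).
    have := normcD (- (mc M * zc w * zc w)) (- ((md M - 1) * zc w)).
    rewrite !normcN !nM -/Z; have := mulr_ge0 Z0 Z0.
    have := normc_ge0 (mc M); have := normc_ge0 (ma M - 1); have := normc_ge0 (md M - 1).
    by nra.
  move=> h; rewrite ler_pdivrMr //; apply: le_trans h _.
  have : (1 + Z) ^+ 2 <= K * t by rewrite -ler_pdivrMr.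
  by nra.
have := displacement M w; rewrite -/t.
rewrite -expr_div_n -exprMn.
have sq (a b : R) : 0 <= a -> a <= b -> a ^+ 2 <= b ^+ 2 by move=> a0 ab; rewrite lerXn2r ?nnegrE //; lra.
have := sq _ _ (normc_ge0 _) b1; have := sq _ _ (normc_ge0 _) b4.
have := sq _ _ (mulr_ge0 (normc_ge0 _) (ltW t0)) b3.
have := sq _ _ (divr_ge0 (normc_ge0 _) (ltW t0)) b2.
by have := mulr_gt0 e0 K0; set k := e * K in eK1 eK2 *; nra.
Qed.

End Moebius.

(** * Invariance of the volume *)

Section Volume.
Variable R : realType.
Local Notation T1 := (measurableTypeR R).
Local Notation mu := (@lebesgue_measure R).

Definition preserves d (T : measurableType d) (m : set T -> \bar R) (f : T -> T) :=
  measurable_fun setT f /\ forall A, measurable A -> m (f @^-1` A) = m A.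

Lemma preserves_comp d (T : measurableType d) (m : set T -> \bar R) (f g : T -> T) :
  preserves m f -> preserves m g -> preserves m (f \o g).
Proof.
move=> [mf Hf] [mg Hg]; split; first exact: measurableT_comp.
move=> A mA; rewrite comp_preimage Hg ?Hf //.
by rewrite -[X in measurable X]setTI; exact: mf.
Qed.

Lemma preserves_integral d (T : measurableType d) (m : {measure set T -> \bar R})
    (f : T -> T) (D : set T) (g : T -> \bar R) :
  preserves m f -> measurable D -> measurable_fun D g -> (forall x, D x -> 0 <= g x)%E ->
  (\int[m]_(x in f @^-1` D) (g \o f) x = \int[m]_(x in D) g x)%E.
Proof.
move=> [mf Hf] mD mg g0; rewrite -(ge0_integral_pushforward mf) //.
  by apply: eq_measure_integral => A mA _; exact: Hf.
by move=> x /set_mem; exact: g0.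
Qed.

Lemma preserves_shift (c : R) : preserves mu (fun y : T1 => y + c).
Proof.
have mf : measurable_fun setT (fun y : T1 => (y + c : T1)) by exact: measurable_funD.
split=> // A mA.
pose f : {mfun T1 >-> T1} := HB.pack (fun y : T1 => (y + c : T1))
  (isMeasurableFun.Build _ _ _ _ _ mf).
rewrite -[LHS]/(pushforward mu f A); apply/esym/lebesgue_measure_unique => //.
move=> _ [[a b]] _ <-; rewrite /=.
have -> : pushforward mu f `]a, b]%classic = mu `]a - c, b - c]%classic.
  rewrite /pushforward; congr (mu _).
  by apply/seteqP; split=> y /=; rewrite !in_itv /= ltrBlDr lerBrDr.
rewrite !lebesgue_measure_itv /= !lte_fin ltrD2r.
by case: ifP => // _; rewrite -!EFinB; congr (_%:E); ring.
Qed.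

Lemma preserves_opp : preserves mu (fun y : T1 => - y).
Proof.
by split=> [|A mA]; [exact: measurable_funN|exact: lebesgue_measureN].
Qed.

Lemma product_measureC d1 d2 (X1 : measurableType d1) (X2 : measurableType d2)
    (m1 : {sigma_finite_measure set X1 -> \bar R})
    (m2 : {sigma_finite_measure set X2 -> \bar R}) A : measurable A ->
  (m1 \x m2)%E A = (m1 \x^ m2)%E A.
Proof.
by move=> mA; apply: product_measure_unique => // B C mB mC; rewrite /= product_measure2E.
Qed.

(** Cavalieri's principle: every section keeps its measure. *)
Lemma preserves_fiberr d1 d2 (X1 : measurableType d1) (X2 : measurableType d2)
    (m1 : {sigma_finite_measure set X1 -> \bar R})
    (m2 : {sigma_finite_measure set X2 -> \bar R}) (F : X1 -> X2 -> X2) :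
  measurable_fun setT (fun p : X1 * X2 => F p.1 p.2) ->
  (forall x, preserves m2 (F x)) ->
  preserves (m1 \x m2)%E (fun p => (p.1, F p.1 p.2)).
Proof.
move=> mF HF; split; first exact: measurable_fun_pair.
move=> A mA; apply: eq_integral => x _ /=; rewrite -[RHS](HF x).2.
  by congr (m2 _); apply/seteqP; split=> y /set_mem ?; apply/mem_set.
exact: measurable_xsection.
Qed.

Lemma preserves_fiberl d1 d2 (X1 : measurableType d1) (X2 : measurableType d2)
    (m1 : {sigma_finite_measure set X1 -> \bar R})
    (m2 : {sigma_finite_measure set X2 -> \bar R}) (F : X2 -> X1 -> X1) :
  measurable_fun setT (fun p : X1 * X2 => F p.2 p.1) ->
  (forall x, preserves m1 (F x)) ->
  preserves (m1 \x m2)%E (fun p => (F p.2 p.1, p.2)).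
Proof.
move=> mF HF; have mf := measurable_fun_pair mF (@measurable_snd _ _ X1 X2).
split=> // A mA; rewrite !product_measureC //; last first.
  by rewrite -[X in measurable X]setTI; exact: mf.
apply: eq_integral => y _ /=; rewrite -[RHS](HF y).2.
  by congr (m1 _); apply/seteqP; split=> x /set_mem ?; apply/mem_set.
exact: measurable_ysection.
Qed.

Lemma preserves_fst d1 d2 (X1 : measurableType d1) (X2 : measurableType d2)
    (m1 : {measure set X1 -> \bar R})
    (m2 : {sigma_finite_measure set X2 -> \bar R}) (g : X1 -> X1) :
  preserves m1 g -> preserves (m1 \x m2)%E (fun p => (g p.1, p.2)).
Proof.
move=> [mg Hg]; split.
  by apply: measurable_fun_pair; [apply: measurableT_comp|]; rewrite //; exact: measurable_snd.
move=> A mA; have mx := measurable_fun_xsection m2 mA.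
transitivity (\int[m1]_(x in g @^-1` setT) ((m2 \o xsection A) \o g) x)%E.
  rewrite preimage_setT; apply: eq_integral => x _ /=.
  by congr (m2 _); apply/seteqP; split=> y /set_mem ?; apply/mem_set.
exact: preserves_integral.
Qed.

Definition line_refl (a b c : R) (p : T1 * T1) : T1 * T1 :=
  let s := 2 * (a * p.1 + b * p.2 - c) / (a ^+ 2 + b ^+ 2) in
  (p.1 - s * a, p.2 - s * b).

(* A reflection is a product of shears and a skew flip. *)
Lemma preserves_line_refl (a b c : R) : a ^+ 2 + b ^+ 2 != 0 ->
  preserves (mu \x mu)%E (line_refl a b c).
Proof.
move=> N0.
have m1 : measurable_fun setT (fun p : T1 * T1 => (p.1 : T1)) by exact: measurable_fst.
have m2 : measurable_fun setT (fun p : T1 * T1 => (p.2 : T1)) by exact: measurable_snd.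
have [b0|b0] := eqVneq b 0.
  have := @preserves_fiberl _ _ T1 T1 mu mu (fun _ x => - x + 2 * c / a).
  have -> : (fun p : T1 * T1 => (- p.1 + 2 * c / a, p.2)) = line_refl a b c.
    have a0 : a != 0 by move: N0; rewrite b0 expr0n addr0 sqrf_eq0.
    by apply/funext => p; rewrite /line_refl b0; congr pair; field.
  apply; first by apply: measurable_funD => //; exact: measurable_funN.
  by move=> _; exact: (preserves_comp (preserves_shift _) preserves_opp).
(* The shear [U (- (a / b))] sends the normal (a, b) to (0, b); conjugated by it, the reflection
   moves only the second coordinate, by a flip and a shift on each fibre. *)
pose U (k : R) (p : T1 * T1) : T1 * T1 := (p.1 + k * p.2, p.2).
have pU k : preserves (mu \x mu)%E (U k).
  apply: (@preserves_fiberl _ _ T1 T1 mu mu (fun y x => x + k * y)).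
    by apply: measurable_funD => //; exact: measurable_funM.
  by move=> y; exact: preserves_shift.
pose q := - (2 * a * b) / (a ^+ 2 + b ^+ 2).
pose e := 2 * c * b / (a ^+ 2 + b ^+ 2).
pose V (p : T1 * T1) : T1 * T1 := (p.1, - p.2 + (q * p.1 + e)).
have pV : preserves (mu \x mu)%E V.
  apply: (@preserves_fiberr _ _ T1 T1 mu mu (fun x y => - y + (q * x + e))).
    apply: measurable_funD; first exact: measurable_funN.
    by apply: measurable_funD => //; exact: measurable_funM.
  by move=> x; exact: (preserves_comp (preserves_shift _) preserves_opp).
have -> : line_refl a b c = U (a / b) \o (V \o U (- (a / b))).
  apply/funext => p; rewrite /line_refl /U /V /q /e /=.
  by congr pair; field; apply/andP.
by exact: (preserves_comp (pU _) (preserves_comp pV (pU _))).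
Qed.

Definition coord (x : h3 R) : T1 * T1 * T1 := (cRe (zc x), cIm (zc x), ht x).

Let dens (p : T1 * T1 * T1) : \bar R := ((p.2 ^+ 3)^-1)%:E.

Lemma coord_eq x y : coord x = coord y -> x = y.
Proof. by case=> e1 e2 e3; apply: h3_eq => //; exact: complex_eq. Qed.

Lemma measurable_dens (D : set (T1 * T1 * T1)) : (forall p, D p -> 0 < p.2) ->
  measurable_fun D dens.
Proof.
move=> D0; apply/measurable_EFinP.
apply: (eq_measurable_fun (fun p : T1 * T1 * T1 => expR (- (3 * ln p.2)))).
  by move=> p /set_mem/D0 p0; rewrite expRN (expRM_natl 3) lnK.
apply: (@measurable_funTS _ _ _ _ _ (fun p : T1 * T1 * T1 => expR (- (3 * ln p.2)))).
apply: measurableT_comp; first exact: measurable_expR.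
apply: measurable_funN; apply: measurable_funM => //.
by apply: measurableT_comp; first exact: measurable_ln.
Qed.

Let hvolE (X : set (h3 R)) : hvolume X = (\int[mu \x mu \x mu]_(p in coord @` X) dens p)%E.
Proof. by []. Qed.

Let coord_gt0 (X : set (h3 R)) p : (coord @` X) p -> 0 < p.2.
Proof. by move=> [x _ <-]; exact: ht_gt0. Qed.

Let dens_ge0 (X : set (h3 R)) p : (coord @` X) p -> (0 <= dens p)%E.
Proof. by move=> /coord_gt0 p0; rewrite /dens lee_fin invr_ge0 exprn_ge0 // ltW. Qed.

(** A vertical reflection keeps the height, hence the density. This yields finite volume for the
    copies of [Q] around the corner. *)
Lemma hvolume_vrefl (X : set (h3 R)) (n : R[i]) (c : R) : n != 0 ->
  measurable (coord @` X) ->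
  measurable (coord @` [set x | X (Defs.vrefl n c x)]) /\
  hvolume [set x | X (Defs.vrefl n c x)] = hvolume X.
Proof.
move=> n0 mX.
have N0 : cRe n ^+ 2 + cIm n ^+ 2 != 0 by rewrite -normc_sqr sqrf_eq0 gt_eqF ?normc_gt0.
pose f (p : T1 * T1 * T1) : T1 * T1 * T1 := (line_refl (cRe n) (cIm n) c p.1, p.2).
have pf : preserves (mu \x mu \x mu)%E f.
  have pl := preserves_line_refl c N0.
  exact: preserves_fst pl.
have vf x : coord (Defs.vrefl n c x) = f (coord x).
  rewrite /coord /f /Defs.vrefl /line_refl cdotE normc_sqr /=.
  by case: n {n0 mX N0 f pf} => a b; case: x => [[u v] t t0] /=; congr (_, _, _); ring.
have vK x : Defs.vrefl n c (Defs.vrefl n c x) = x by exact: (reflectionK (Vertical c n0)).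
have E : coord @` [set x | X (Defs.vrefl n c x)] = f @^-1` (coord @` X).
  apply/seteqP; split=> [_ [x Xx <-]|p [x Xx fp]] /=; first by exists (Defs.vrefl n c x).
  have p0 : 0 < p.2 by have := congr1 snd fp => /= <-.
  have ep : p = coord (H3 (p.1.1 +i* p.1.2)%C p0) by case: p {fp} p0 => [[]].
  exists (Defs.vrefl n c x); first by rewrite /= vK.
  rewrite [RHS]ep; congr coord; rewrite -[RHS]vK; congr Defs.vrefl.
  by apply: coord_eq; rewrite vf -ep fp.
split; first by rewrite E -[X in measurable X]setTI; exact: pf.1.
rewrite !hvolE E.
have md : measurable_fun (coord @` X) dens.
  by apply: measurable_dens => p; exact: coord_gt0.
exact: (preserves_integral pf mX md (@dens_ge0 X)).
Qed.

Lemma hvolume_setU_lt (X Y : set (h3 R)) :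
  measurable (coord @` X) -> measurable (coord @` Y) ->
  (hvolume X < +oo -> hvolume Y < +oo -> hvolume (X `|` Y) < +oo)%E.
Proof.
move=> mX mY vX vY; set A := coord @` X in mX; set B := coord @` Y in mY.
have d0 p : (A `|` B) p -> (0 <= dens p)%E by move=> [] /dens_ge0.
have md : measurable_fun (A `|` B) dens.
  by apply: measurable_dens => p [] /coord_gt0.
rewrite hvolE image_setU -/A -/B -(@setDUK _ A (A `|` B)); last by move=> p; left.
have mD : measurable ((A `|` B) `\` A) by apply: measurableD => //; exact: measurableU.
have AB : A `|` (A `|` B) `\` A = A `|` B by rewrite setDUK // => p; left.
rewrite ge0_integral_setU //; first last.
- by apply/disj_setPS => p [Ap [_ /(_ Ap)]].
- by rewrite AB.
- by rewrite AB.
apply: lte_add_pinfty => //; apply: le_lt_trans vY.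
apply: ge0_subset_integral => //.
- by apply: measurable_dens => p; exact: coord_gt0.
- by move=> p; exact: dens_ge0.
- by move=> p [[]].
Qed.

Lemma hs_measurable (h : halfspace R) : measurable (coord @` hs_set h).
Proof.
have key (f : T1 * T1 * T1 -> R) : measurable_fun setT f ->
    (forall x, hs_set h x <-> f (coord x) <= 0) -> measurable (coord @` hs_set h).
  move=> mf hf; pose pos := (fun p : T1 * T1 * T1 => p.2 : T1) @^-1` `]0, +oo[%classic.
  have -> : coord @` hs_set h = f @^-1` `]-oo, 0]%classic `&` pos.
    apply/seteqP; split=> [_ [x /hf hx <-]|p []] /=.
      by rewrite /pos /= !in_itv /= andbT; split.
    rewrite /pos /= !in_itv /= andbT => fp p0.
    have ep : coord (H3 (p.1.1 +i* p.1.2)%C p0) = p by case: p {fp} p0 => [[]].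
    by exists (H3 (p.1.1 +i* p.1.2)%C p0) => //; apply/hf; rewrite ep.
  apply: measurableI; first by rewrite -[X in measurable X]setTI; exact: mf.
  by rewrite -[X in measurable X]setTI; apply: measurable_snd.
have m1 : measurable_fun setT (fun p : T1 * T1 * T1 => p.1.1 : R).
  by apply: (measurableT_comp (f := fst)); exact: measurable_fst.
have m2 : measurable_fun setT (fun p : T1 * T1 * T1 => p.1.2 : R).
  by apply: (measurableT_comp (f := snd)); [exact: measurable_snd|exact: measurable_fst].
have m3 : measurable_fun setT (fun p : T1 * T1 * T1 => p.2 : R) by exact: measurable_snd.
have msq p : measurable_fun setT (fun q : T1 * T1 * T1 =>
    (q.1.1 - cRe p) ^+ 2 + (q.1.2 - cIm p) ^+ 2 + q.2 ^+ 2 : R).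
  apply: measurable_funD; last exact: measurable_funX.
  by apply: measurable_funD; apply: measurable_funX; exact: measurable_funB.
have sqE p x : sqdist p x = (cRe (zc x) - cRe p) ^+ 2 + (cIm (zc x) - cIm p) ^+ 2 + ht x ^+ 2.
  by rewrite /sqdist normc_sqr; case: p x => [u v] [[a b] t t0].
case: h key => [n c n0|p r r0|p r r0] key.
- apply: (key (fun q => cRe n * q.1.1 + cIm n * q.1.2 - c)).
    by apply: measurable_funB => //; apply: measurable_funD; exact: measurable_funM.
  by move=> x; rewrite /= cdotE subr_le0.
- apply: (key (fun q => (q.1.1 - cRe p) ^+ 2 + (q.1.2 - cIm p) ^+ 2 + q.2 ^+ 2 - r ^+ 2)).
    exact: measurable_funB.
  by move=> x; rewrite /= sqE subr_le0.
- apply: (key (fun q => r ^+ 2 - ((q.1.1 - cRe p) ^+ 2 + (q.1.2 - cIm p) ^+ 2 + q.2 ^+ 2))).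
    exact: measurable_funB.
  by move=> x; rewrite /= sqE subr_le0.
Qed.

Lemma polyhedron_measurable m (h : 'I_m -> halfspace R) (Q : set (h3 R)) :
  (forall x, Q x <-> forall i, side (h i) x <= 0) -> measurable (coord @` Q).
Proof.
move=> QE.
have -> : coord @` Q = coord @` setT `&` \bigcap_(i in [set: 'I_m]) (coord @` hs_set (h i)).
  apply/seteqP; split=> [_ [x /QE Qx <-]|_ [[x _ <-]]].
    by split; [exists x|move=> i _; exists x => //; apply/hs_setE].
  move=> H; exists x => //; apply/QE => i.
  by have [y Hy /coord_eq <-] := H i I; apply/hs_setE.
apply: measurableI; last by apply: fin_bigcap_measurable => // i _; exact: hs_measurable.
pose pos := (fun p : T1 * T1 * T1 => p.2 : T1) @^-1` `]0, +oo[%classic.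
have -> : coord @` setT = pos.
  apply/seteqP; split=> [_ [x _ <-]|p]; rewrite /pos /= in_itv /= andbT // => p0.
  by exists (H3 (p.1.1 +i* p.1.2)%C p0) => //; case: p p0 => [[]].
by rewrite -[X in measurable X]setTI; apply: measurable_snd.
Qed.

(* Infinitely many disjoint boxes of the same hyperbolic volume. *)
Lemma hvolume_infinite (Q : set (h3 R)) (z u : R[i]) (e T : R) :
  measurable (coord @` Q) -> 0 < e -> 0 < T -> u != 0 ->
  (forall (k : R) x, 0 <= k -> T <= ht x ->
    `|cRe (zc x - z - k%:C%C * u)| <= e -> `|cIm (zc x - z - k%:C%C * u)| <= e -> Q x) ->
  ~ (hvolume Q < +oo)%E.
Proof.
move=> mQ e0 T0 u0 HQ.
pose M := Num.max `|cRe u| `|cIm u|.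
have M0 : 0 < M.
  rewrite /M lt_max !normr_gt0 -negb_and; apply: contra u0 => /andP[/eqP a /eqP b].
  by apply/eqP; exact: complex_eq.
(* In the coordinate where [u] is largest, consecutive centres are 3e apart, more than the width 2e
   of a box. *)
pose s := 3 * e / M; have s0 : 0 < s by rewrite divr_gt0 // mulr_gt0.
pose a k := cRe z + (k%:R * s) * cRe u; pose b k := cIm z + (k%:R * s) * cIm u.
pose B (k : nat) : set (T1 * T1 * T1) :=
  ([set` `[a k - e, a k + e]] `*` [set` `[b k - e, b k + e]]) `*` [set` `[T, 2 * T]].
have mB k : measurable (B k) by do 2?apply: measurableX; exact: measurable_itv.
have BQ k : B k `<=` coord @` Q.
  move=> p [[/= p1 p2] p3]; have p0 : 0 < p.2.
    by move: p3; rewrite /= in_itv /= => /andP[+ _]; exact: lt_le_trans.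
  exists (H3 (p.1.1 +i* p.1.2)%C p0); last by case: p {p1 p2 p3} p0 => [[]].
  apply: (HQ (k%:R * s)) => /=.
  - by rewrite mulr_ge0 // ltW.
  - by move: p3; rewrite /= in_itv /= => /andP[].
  - move: p1; rewrite in_itv /= /a ler_norml; case: (z) (u) => z1 z2 [u1 u2] /=; lra.
  - move: p2; rewrite in_itv /= /b ler_norml; case: (z) (u) => z1 z2 [u1 u2] /=; lra.
have dB : trivIset setT B.
  apply/trivIsetP => i j _ _; wlog ij : i j / (i < j)%N => [wl|_].
    by rewrite neq_ltn => /orP[] H; [|rewrite setIC]; apply: wl => //; rewrite ltn_eqF.
  rewrite -subset0 => p [[[/= p1 p2] _] [[/= q1 q2] _]].
  have ijR : 1 <= j%:R - i%:R :> R by rewrite -natrB ?(ltnW ij) // (ler_nat _ 1) subn_gt0.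
  move: p1 p2 q1 q2; rewrite !in_itv /= /a /b => /andP[? ?] /andP[? ?] /andP[? ?] /andP[? ?].
  have key (w v : R) : `|w| = M -> `|v| <= 2 * e -> v = (j%:R - i%:R) * s * w -> False.
    move=> wM ve vE; move: ve; rewrite vE 2!normrM wM (ger0_norm (ltW s0)) /s.
    rewrite ger0_norm; last lra.
    have -> : (j%:R - i%:R) * (3 * e / M) * M = (j%:R - i%:R) * (3 * e).
      by field; rewrite gt_eqF.
    by nra.
  have := erefl M; rewrite {1}/M maxEle; case: ifP => _ EM.
    apply: (key _ ((j%:R - i%:R) * s * cIm u) EM) => //; rewrite ler_norml; lra.
  apply: (key _ ((j%:R - i%:R) * s * cRe u) EM) => //; rewrite ler_norml; lra.
(* A lower bound of the density on each box, whose heights are at most 2T; [w] is the Euclidean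
   volume of a box. *)
pose c := ((2 * T) ^+ 3)^-1; have c0 : 0 < c by rewrite invr_gt0 exprn_gt0 // mulr_gt0.
pose w := 2 * e * (2 * e) * T; have w0 : 0 < w by rewrite /w !mulr_gt0.
have Bw k : (mu \x mu \x mu)%E (B k) = w%:E.
  have mI (x y : R) : measurable ([set` `[x, y]] : set T1) by exact: measurable_itv.
  have lI (x y : R) : x < y -> mu [set` `[x, y]] = (y - x)%:E.
    by move=> xy; rewrite lebesgue_measure_itv /= lte_fin xy -EFinB.
  rewrite product_measure1E; [|by apply: measurableX; exact: mI|exact: mI].
  pose J (c : R) : set T1 := [set` `[c - e, c + e]].
  rewrite [X in (X * _)%E](_ : _ = (mu (J (a k)) * mu (J (b k)))%E).
    have lJ c' : mu (J c') = (2 * e)%:E by rewrite /J lI; [congr (_%:E); ring|lra].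
    have lT : mu [set` `[T, 2 * T]] = T%:E by rewrite lI; [congr (_%:E); ring|lra].
    by rewrite !lJ [X in (_ * X)%E](_ : _ = T%:E) -?EFinM //; exact: lT.
  exact: product_measure1E.
have lb N : ((c * (N%:R * w))%:E <= hvolume Q)%E.
  pose E := \big[setU/set0]_(k < N) B k.
  have mE : measurable E by apply: bigsetU_measurable => k _.
  have EQ : E `<=` coord @` Q by rewrite /E -bigcup_mkord => p [k _]; exact: BQ.
  have Ed p : E p -> (c%:E <= dens p)%E.
    rewrite /E -bigcup_mkord => -[k _ [_]]; rewrite /= in_itv /= => /andP[p1 p2].
    have p0 : 0 < p.2 by exact: lt_le_trans p1.
    by rewrite lee_fin lef_pV2 ?posrE ?exprn_gt0 ?mulr_gt0 // lerXn2r ?nnegrE ?mulr_ge0 // ltW.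
  have md : measurable_fun (coord @` Q) dens by apply: measurable_dens => p; exact: coord_gt0.
  have muE : (mu \x mu \x mu)%E E = (N%:R * w)%:E.
    rewrite /E measure_bigsetU //= (eq_bigr (fun=> w%:E)) // sumEFin.
    by rewrite sumr_const card_ord mulr_natl.
  rewrite EFinM -muE -integral_cst //.
  apply: (@le_trans _ _ (\int[mu \x mu \x mu]_(p in E) dens p)%E).
    apply: ge0_le_integral => //.
    - by move=> p _; rewrite lee_fin ltW.
    - by apply: measurable_funS md.
  apply: ge0_subset_integral => //.
  by move=> p; exact: dens_ge0.
move=> fin; have := lb 0; rewrite mul0r mulr0 => v0.
have vf : hvolume Q \is a fin_num by rewrite ge0_fin_numE.
set v := fine (hvolume Q); have vE : hvolume Q = v%:E by rewrite fineK.
have cw : 0 < c * w by rewrite mulr_gt0.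
have [N HN] : exists N : nat, v < N%:R * (c * w).
  exists (Num.bound (v / (c * w))); rewrite -ltr_pdivrMr //.
  by apply: archi_boundP; rewrite divr_ge0 ?(ltW cw) // fine_ge0.
by have := lb N; rewrite vE lee_fin mulrCA leNgt HN.
Qed.

End Volume.

(** * The cross-section at infinity *)

Section Cusp.
Variable R : realType.
Implicit Types (x y : h3 R) (f g : halfspace R).
Variables (Q : set (h3 R)) (m : nat) (h : 'I_m -> halfspace R) (o : h3 R).
Hypothesis QE : forall x, Q x <-> forall i, side (h i) x <= 0.
Hypothesis hface : forall i, face Q (h i).
Hypothesis ho : forall i, side (h i) o < 0.
Hypothesis tri : forall f g, face Q f -> face Q g ->
  [\/ enorm f = enorm g, bil (enorm f) (enorm g) = 0 |
      forall y, side f y + side g y <= 0].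
Hypothesis Qinf : ideal_vertex_at_infinity Q.
Hypothesis Qvol : (hvolume Q < +oo)%E.

(** A hemisphere containing [Q] would bound [Q], since |x|^2 <= 2 |x - p|^2 + 2 |p|^2, against the
    vertex at infinity. *)
Lemma face_shape f : face Q f ->
  (exists n c (n0 : n != 0), f = Vertical c n0) \/
  (exists p r (r0 : 0 < r), f = Outside p r0).
Proof.
case: f => [n c n0|p r r0|p r r0] Ff; [by left; exists n, c, n0| |by right; exists p, r, r0].
exfalso; have [Qf _] := Ff.
have [x Qx] := Qinf (2 * r ^+ 2 + 2 * normc p ^+ 2); apply/negP; rewrite -leNgt.
have : sqdist p x <= r ^+ 2 by exact: Qf.
rewrite /sqdist !normc_sqr; case: x {Qx} => [[a b] t t0]; case: p {Ff Qf} => c d /=.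
have := sqr_ge0 (a - 2 * c); have := sqr_ge0 (b - 2 * d); have := sqr_ge0 t; nra.
Qed.

(** [cD] vanishes exactly for vertical half-spaces, where the expression is affine in the horizontal
    coordinates. *)
Lemma side_eq f x : side f x * ht x = cB (enorm f) * cRe (zc x) + cC (enorm f) * cIm (zc x)
  - cA (enorm f) / 2 - cD (enorm f) / 2 * (cRe (zc x) ^+ 2 + cIm (zc x) ^+ 2 + ht x ^+ 2).
Proof. by rewrite /side /bil /pt /=; field; rewrite ht_neq0. Qed.

Lemma side_le0 f x : (side f x <= 0) = (side f x * ht x <= 0).
Proof. by rewrite pmulr_lle0. Qed.

Lemma side_lt0 f x : (side f x < 0) = (side f x * ht x < 0).
Proof. by rewrite pmulr_llt0. Qed.

Lemma high_points : exists2 T : R, 0 < T &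
  forall k x, cD (enorm (h k)) != 0 -> T < ht x -> side (h k) x < 0.
Proof.
pose rad f : R := match f with Vertical _ _ _ => 1 | Inside _ r _ | Outside _ r _ => r end.
have rad0 f : 0 < rad f by case: f.
(* A lower bound [d] of the inverse radii makes 1/d an upper bound of the radii. *)
have [d d0 Hd] := @finite_lower_bound R 'I_m (fun k => (rad (h k))^-1) 0
  (fun k => eq_ind_r is_true (rad0 (h k)) (invr_gt0 (rad (h k)))).
exists d^-1; first by rewrite invr_gt0.
move=> k x; have := Hd k.
have [[n [c [n0 ->]]]|[p [r [r0 ->]]]] := face_shape (hface k); first by rewrite /= eqxx.
move=> /= dr _ Tx; rewrite side_outside.
have rx : r < ht x by apply: le_lt_trans Tx; rewrite -[r]invrK lef_pV2 ?posrE ?invr_gt0.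
rewrite pmulr_llt0; last by rewrite invr_gt0 !mulr_gt0.
by rewrite subr_lt0 /sqdist; have := sqr_ge0 (normc (zc x - p)); nra.
Qed.

(** If no vertical face stopped the direction [u], then [Q] would contain, above some height, a
    thickened ray along [u], of infinite volume. *)
Lemma vertical_direction (u : R[i]) : u != 0 ->
  exists k, cD (enorm (h k)) = 0 /\ 0 < cB (enorm (h k)) * cRe u + cC (enorm (h k)) * cIm u.
Proof.
move=> u0; apply: contrapT => none.
have [T T0 HT] := high_points.
(* Half the slack of [o] at each vertical face: the normal has coordinates at most 1 in modulus, so
   the two coordinates of the offset [v] cost at most [e] each. *)
pose s k := if cD (enorm (h k)) == 0 then - (side (h k) o * ht o) / 2 else 1.
have s0 k : 0 < s k.
  rewrite /s; case: eqP => // _; rewrite divr_gt0 // oppr_gt0 -side_lt0; exact: ho.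
have [e e0 He] := finite_lower_bound s0.
apply: (@hvolume_infinite R Q (zc o) u e (T + 1) (polyhedron_measurable QE) e0 _ u0) => //.
  by lra.
move=> k x k0 Tx; set v := _ - _ - _ => v1 v2; apply/QE => i.
have [D0|D0] := eqVneq (cD (enorm (h i))) 0; last by apply/ltW/HT => //; lra.
rewrite side_le0 side_eq D0 mul0r mul0r subr0.
have := ho i; rewrite side_lt0 side_eq D0 !mul0r subr0.
have := He i; rewrite /s D0 eqxx side_eq D0 !mul0r subr0.
have uk : cB (enorm (h i)) * cRe u + cC (enorm (h i)) * cIm u <= 0.
  by rewrite leNgt; apply/negP => H; apply: none; exists i.
have xE : zc x = zc o + k%:C%C * u + v by rewrite /v; ring.
have := bil_enorm (h i); rewrite /bil D0.
move: (cB _) (cC _) (cA _) uk => b c a uk nE le lt.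
have b1 : `|b| <= 1 by rewrite -ler_sqr ?nnegrE // real_normK ?num_real // expr1n; nra.
have c1 : `|c| <= 1 by rewrite -ler_sqr ?nnegrE // real_normK ?num_real // expr1n; nra.
have bv : b * cRe v <= e.
  by apply: le_trans (ler_norm _) _; rewrite normrM; have := normr_ge0 (cRe v); nra.
have cv : c * cIm v <= e.
  by apply: le_trans (ler_norm _) _; rewrite normrM; have := normr_ge0 (cIm v); nra.
have -> : cRe (zc x) = cRe (zc o) + k * cRe u + cRe v.
  by rewrite xE; case: (zc o) (u) (v) => ? ? [? ?] [? ?] /=; ring.
have -> : cIm (zc x) = cIm (zc o) + k * cIm u + cIm v.
  by rewrite xE; case: (zc o) (u) (v) => ? ? [? ?] [? ?] /=; ring.
nra.
Qed.

(** For disjoint exteriors the sum of the two affine functions is bounded above on the plane, so its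
    gradient vanishes. *)
Lemma vertical_trichotomy f g : face Q f -> face Q g ->
  cD (enorm f) = 0 -> cD (enorm g) = 0 ->
  [\/ enorm f = enorm g,
      cB (enorm f) * cB (enorm g) + cC (enorm f) * cC (enorm g) = 0 |
      cB (enorm g) = - cB (enorm f) /\ cC (enorm g) = - cC (enorm f)].
Proof.
move=> Ff Fg Df Dg; have [e|e|e] := tri Ff Fg; [by constructor 1| |].
  by constructor 2; move: e; rewrite /bil Df Dg mulr0 mul0r; lra.
constructor 3.
set b := cB (enorm f) + cB (enorm g); set c := cC (enorm f) + cC (enorm g).
set a := (cA (enorm f) + cA (enorm g)) / 2.
have lin (X Y : R) : b * X + c * Y <= a.
  have := e (H3 (X +i* Y)%C ltr01); set x := H3 _ _ => le.
  have := side_eq f x; have := side_eq g x; rewrite Df Dg /= /a /b /c; lra.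
suff : b = 0 /\ c = 0 by rewrite /b /c; lra.
suff z0 : b ^+ 2 + c ^+ 2 = 0.
  by move/eqP: z0; rewrite paddr_eq0 ?sqr_ge0 // !sqrf_eq0 => /andP[/eqP-> /eqP->].
apply/eqP; rewrite eq_le addr_ge0 ?sqr_ge0 // andbT leNgt; apply/negP => pos.
have := lin (b * ((a + 1) / (b ^+ 2 + c ^+ 2))) (c * ((a + 1) / (b ^+ 2 + c ^+ 2))).
rewrite (_ : _ + _ = a + 1); last by field; rewrite gt_eqF.
by lra.
Qed.

(** All vertical normals are equal, perpendicular or opposite to (B, C), and each of the four
    directions of this frame is stopped by some face. The entry [2 * a1] encodes the line B x + C y
    = a1. *)
Lemma rectangle : exists (i1 i2 i3 i4 : 'I_m) (B C a1 a2 b1 b2 : R),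
  [/\ B ^+ 2 + C ^+ 2 = 1,
      [/\ enorm (h i1) = Vec (2 * a1) B C 0, enorm (h i2) = Vec (2 * a2) (- B) (- C) 0,
          enorm (h i3) = Vec (2 * b1) (- C) B 0 & enorm (h i4) = Vec (2 * b2) C (- B) 0] &
      forall f, face Q f -> cD (enorm f) = 0 ->
        (enorm f = enorm (h i1) \/ enorm f = enorm (h i2)) \/
        (enorm f = enorm (h i3) \/ enorm f = enorm (h i4))].
Proof.
have [i1 [D1 _]] := vertical_direction (oner_neq0 _).
set B := cB (enorm (h i1)); set C := cC (enorm (h i1)).
have unit f : cD (enorm f) = 0 -> cB (enorm f) ^+ 2 + cC (enorm f) ^+ 2 = 1.
  by move=> D0; rewrite -(bil_enorm f) /bil D0; ring.
have BC : B ^+ 2 + C ^+ 2 = 1 by exact: unit.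
have BCn0 (s t : R) : s ^+ 2 + t ^+ 2 = 1 -> (s +i* t)%C != 0 :> R[i].
  by move=> e; apply/eqP => -[s0 t0]; move: e; rewrite s0 t0 expr0n addr0 => /eqP; rewrite eq_sym oner_eq0.
have [|i2 [D2]] := @vertical_direction (- B +i* - C)%C; first by apply: BCn0; rewrite !sqrrN.
rewrite /= => p2.
have [B2 C2] : cB (enorm (h i2)) = - B /\ cC (enorm (h i2)) = - C.
  have [e|e|//] := vertical_trichotomy (hface i1) (hface i2) D1 D2.
    by move: p2; rewrite -e -/B -/C; nra.
  by move: p2; rewrite -/B -/C in e; lra.
(* A nonzero component along (-C, B) excludes normals parallel to (B, C), so the normal is s (-C, B)
   with s^2 = 1. *)
have orth f : face Q f -> cD (enorm f) = 0 ->
    0 < (cB (enorm f) * - C + cC (enorm f) * B) ^+ 2 -> exists s : R,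
    [/\ s ^+ 2 = 1, cB (enorm f) = s * - C, cC (enorm f) = s * B &
        s = cB (enorm f) * - C + cC (enorm f) * B].
  move=> Ff Df p; have [e|e|[e1 e2]] := vertical_trichotomy (hface i1) Ff D1 Df.
  - by exfalso; move: p; rewrite -e -/B -/C (_ : _ + _ = 0) ?expr0n ?ltxx //; ring.
  - have u1 := unit _ Df; rewrite -/B -/C in e.
    move: (cB _) (cC _) u1 e p => b c u1 e p; exists (b * - C + c * B); split => //.
    + transitivity ((b ^+ 2 + c ^+ 2) * (B ^+ 2 + C ^+ 2) - (B * b + C * c) ^+ 2); first by ring.
      by rewrite u1 e BC; ring.
    + transitivity (b * (B ^+ 2 + C ^+ 2) - B * (B * b + C * c)); last by ring.
      by rewrite e BC; ring.
    + transitivity (c * (B ^+ 2 + C ^+ 2) - C * (B * b + C * c)); last by ring.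
      by rewrite e BC; ring.
  - by exfalso; move: p; rewrite e1 e2 -/B -/C (_ : _ + _ = 0) ?expr0n ?ltxx //; ring.
have [|i3 [D3]] := @vertical_direction (- C +i* B)%C; first by apply: BCn0; rewrite sqrrN addrC.
rewrite /= => p3.
have [|s3 [s3q B3 C3 s3E]] := orth _ (hface i3) D3; first by rewrite exprn_gt0.
have s31 : s3 = 1 by rewrite -s3E in p3; nra.
rewrite {}s31 !mul1r in B3 C3.
have [|i4 [D4]] := @vertical_direction (C +i* - B)%C; first by apply: BCn0; rewrite sqrrN addrC.
rewrite /= => p4.
have [|s4 [s4q B4 C4 s4E]] := orth _ (hface i4) D4.
  by rewrite -sqrrN exprn_gt0 //; lra.
have s41 : s4 = -1 by have : s4 < 0 by [lra]; nra.
rewrite {}s41 in B4 C4.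
exists i1, i2, i3, i4, B, C, (cA (enorm (h i1)) / 2), (cA (enorm (h i2)) / 2),
  (cA (enorm (h i3)) / 2), (cA (enorm (h i4)) / 2); split=> //.
  by split; apply: vec_eq => //=; try field; rewrite ?B4 ?C4; ring.
move=> f Ff Df.
have [e|e|[e1 e2]] := vertical_trichotomy (hface i1) Ff D1 Df; [by left; left| |].
  have u1 := unit _ Df.
  have [|s [sq Bs Cs _]] := orth _ Ff Df.
    rewrite (_ : (_ + _) ^+ 2 = (cB (enorm f) ^+ 2 + cC (enorm f) ^+ 2) * (B ^+ 2 + C ^+ 2)
      - (B * cB (enorm f) + C * cC (enorm f)) ^+ 2); last by ring.
    by rewrite u1 BC e expr0n /= subr0 mul1r ltr01.
  have [s1|s1] : s = 1 \/ s = -1.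
    by move/eqP: sq; rewrite sqrf_eq1 => /orP[] /eqP; [left|right].
  - right; left; have [->//|e'|[e1 e2]] := vertical_trichotomy (hface i3) Ff D3 Df; exfalso.
      by move: e'; rewrite B3 C3 Bs Cs s1; nra.
    by move: e1 e2; rewrite B3 C3 Bs Cs s1; nra.
  - right; right; have [->//|e'|[e1 e2]] := vertical_trichotomy (hface i4) Ff D4 Df; exfalso.
      by move: e'; rewrite B4 C4 Bs Cs s1; nra.
    by move: e1 e2; rewrite B4 C4 Bs Cs s1; nra.
left; right; have [->//|e'|[e3 e4]] := vertical_trichotomy (hface i2) Ff D2 Df; exfalso.
  by move: e'; rewrite B2 C2 e1 e2 -/B -/C; nra.
by move: e3 e4; rewrite B2 C2 e1 e2 -/B -/C; nra.
Qed.

End Cusp.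

(** * The subgroup and its domain *)

Section Kernel.
Variable R : realType.
Implicit Types (x y : h3 R) (f g : halfspace R) (w : h3 R -> h3 R).
Variables (Q : set (h3 R)) (m : nat) (h : 'I_m -> halfspace R) (o : h3 R).
Hypothesis QE : forall x, Q x <-> forall i, side (h i) x <= 0.
Hypothesis hface : forall i, face Q (h i).
Hypothesis ho : forall i, side (h i) o < 0.
Hypothesis tri : forall f g, face Q f -> face Q g ->
  [\/ enorm f = enorm g, bil (enorm f) (enorm g) = 0 |
      forall y, side f y + side g y <= 0].
Hypothesis Qvol : (hvolume Q < +oo)%E.
Hypothesis shape : forall f, face Q f ->
  (exists n c (n0 : n != 0), f = Vertical c n0) \/
  (exists p r (r0 : 0 < r), f = Outside p r0).
Variables (wa wa' wb wb' : 'I_m) (B C a1 a2 b1 b2 T : R).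
Hypothesis BC : B ^+ 2 + C ^+ 2 = 1.
Hypothesis ea : enorm (h wa) = Vec (2 * a1) B C 0.
Hypothesis ea' : enorm (h wa') = Vec (2 * a2) (- B) (- C) 0.
Hypothesis eb : enorm (h wb) = Vec (2 * b1) (- C) B 0.
Hypothesis eb' : enorm (h wb') = Vec (2 * b2) C (- B) 0.
Hypothesis vert : forall f, face Q f -> cD (enorm f) = 0 ->
  (enorm f = enorm (h wa) \/ enorm f = enorm (h wa')) \/
  (enorm f = enorm (h wb) \/ enorm f = enorm (h wb')).
Hypothesis T0 : 0 < T.
Hypothesis high : forall k x, cD (enorm (h k)) != 0 -> T < ht x -> side (h k) x < 0.

Let phi f := `[< enorm f = enorm (h wb) \/ enorm f = enorm (h wb') >].

Let phi_plane f g : enorm f = enorm g -> phi f = phi g.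
Proof. by rewrite /phi => ->. Qed.

Let W w a b := exists n, word Q phi n w a b.

Let Wid : W id false false.
Proof. by exists 0%N; exact: word0. Qed.

Let Wcomp w w' a b a' b' : W w a b -> W w' a' b' -> W (w \o w') (a (+) a') (b (+) b').
Proof. by move=> [n H] [n' H']; exists (n + n')%N; exact: word_cat. Qed.

Let Winv w a b : W w a b -> exists w', [/\ W w' a b, w \o w' = id & w' \o w = id].
Proof.
by move=> [n /word_inv[w' [H e1 e2]]]; exists w'; split=> //; exists n.
Qed.

Let W1 f : face Q f -> W (reflection f) (~~ phi f) (phi f).
Proof. by move=> Ff; exists 1%N; exact: word1. Qed.

Let Wchd w a b x y : W w a b -> chd (w x) (w y) = chd x y.
Proof. by move=> [n /word_chd]; apply. Qed.

Let Wparity w a b a' b' : W w a b -> W w a' b' -> a = a' /\ b = b'.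
Proof. by move=> [n H] [n' H']; exact: (word_parity QE ho tri phi_plane H H'). Qed.

Let Wtile w a b x : W w a b -> (forall i, side (h i) x < 0) -> Q (w x) ->
  [/\ w = id, a = false & b = false].
Proof. by move=> [n H]; exact: (word_tile QE tri phi_plane H). Qed.

Let Wfold (F : h3 R -> R) w a b x :
  (forall f y, face Q f -> side f y <= 0 -> F (reflection f y) <= F y) ->
  W w a b -> Q x -> F (w x) <= F x.
Proof. by move=> HF [n H]; exact: (word_fold tri phi_plane HF H). Qed.

Let Wcover x : exists w a b, W w a b /\ Q (w x).
Proof.
have [n [w [a [b [H Qx]]]]] := word_cover QE hface ho tri phi_plane x.
by exists w, a, b; split=> //; exists n.
Qed.

Definition kernel_group : set (h3 R -> h3 R) := [set w | W w false false].
Let G := kernel_group.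

Lemma kernel_is_group : is_group G.
Proof.
split; first exact: Wid.
- by move=> f g Wf Wg; have := Wcomp Wf Wg.
- by move=> f /Winv[g [Wg e1 e2]]; exists g.
Qed.

Let phi_a : phi (h wa) = false.
Proof.
apply/negbTE/negP => /asboolP[]; rewrite ea ?eb ?eb' => -[_ e1 e2];
  by move: BC; rewrite e1 e2; nra.
Qed.

Let phi_a' : phi (h wa') = false.
Proof.
apply/negbTE/negP => /asboolP[]; rewrite ea' ?eb ?eb' => -[_ e1 e2];
  by move: BC; have : C = B by [lra]; nra.
Qed.

Let phi_b : phi (h wb) = true. Proof. by apply/asboolP; left. Qed.
Let phi_b' : phi (h wb') = true. Proof. by apply/asboolP; right. Qed.

Let sa := reflection (h wa).
Let sb := reflection (h wb).

Let sab : sa \o sb = sb \o sa.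
Proof. by apply: reflection_comm; rewrite ea eb /bil /=; ring. Qed.

(** The group generated by the two commuting sides through the corner. The parities of [kk i j] are
    (i, j), so its elements represent the cosets and can correct the parities of any word. *)
Let kk (i j : bool) : h3 R -> h3 R := (if i then sa else id) \o (if j then sb else id).

Let Wkk i j : W (kk i j) i j.
Proof.
have Wa : W sa true false by have := W1 (hface wa); rewrite phi_a.
have Wb : W sb false true by have := W1 (hface wb); rewrite phi_b.
rewrite -[i in W _ i _]addbF -[j in W _ _ j]addFb.
by apply: Wcomp; [case: i|case: j].
Qed.

Let kk_add i j i' j' x : kk i j (kk i' j' x) = kk (i (+) i') (j (+) j') x.
Proof.
have ab y : sb (sa y) = sa (sb y) by have := congr1 (fun u => u y) sab.
have aa y : sa (sa y) = y by exact: reflectionK.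
have bb y : sb (sb y) = y by exact: reflectionK.
by case: i; case: j; case: i'; case: j'; rewrite /kk /= ?ab ?aa ?bb // ?aa ?bb.
Qed.

Let kkK i j x : kk i j (kk i j x) = x.
Proof. by rewrite kk_add !addbb. Qed.

Let coset a b : set (h3 R -> h3 R) := [set w | W w a b].

Lemma kernel_index : subgroup_of_index 4 G (reflection_group Q).
Proof.
have GW w : reflection_group Q w <-> exists a b, W w a b.
  rewrite (reflection_groupP Q phi w).
  by split=> [[n [a [b H]]]|[a [b [n H]]]]; [exists a, b, n|exists n, a, b].
split; [exact: kernel_is_group|by move=> w Ww; apply/GW; exists false, false|].
have cosE w a b : W w a b -> [set w \o f | f in G] = coset a b.
  move=> Ww; apply/seteqP; split=> [_ [f Wf <-]|v Wv].
    by have := Wcomp Ww Wf; rewrite !addbF.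
  have [w' [Ww' e1 e2]] := Winv Ww; exists (w' \o v).
    by have := Wcomp Ww' Wv; rewrite !addbb.
  by rewrite compA e1.
pose c (k : nat) := coset (odd k) (1 < k)%N.
have -> : left_cosets (reflection_group Q) G = c @` `I_4.
  apply/seteqP; split=> [_ [w /GW[a [b Ww]] <-]|_ [k _ <-]].
    rewrite (cosE _ _ _ Ww); exists (a + 2 * b)%N; first by case: a {Ww}; case: b.
    by rewrite /c; case: a {Ww}; case: b.
  exists (kk (odd k) (1 < k)%N); first by apply/GW; exists (odd k), (1 < k)%N; exact: Wkk.
  exact: (cosE _ _ _ (Wkk _ _)).
apply: inj_card_eq => k k' /set_mem k4 /set_mem k'4 e.
have : c k (kk (odd k) (1 < k)%N) by exact: Wkk.
rewrite e => /(Wparity (Wkk _ _)).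
by case: k k4 {e} => [|[|[|[|//]]]] _; case: k' k'4 => [|[|[|[|//]]]] _ //= [].
Qed.

(** [a (+) b] is the parity of the length, and each letter contributes one [mirror]. *)
Let Wact w a b : W w a b ->
  if a (+) b then exists M, w = act M \o @mirror R else exists M, w = act M.
Proof.
case=> n; elim=> [|{}n f {}w {}a {}b Ff _ IH].
  have [M [e _ _]] := translation_act (0 : R[i]); exists M; rewrite e.
  by apply/funext => x; apply: h3_eq => //=; rewrite addr0.
have -> : (a (+) ~~ phi f) (+) (b (+) phi f) = ~~ (a (+) b).
  by case: a {IH}; case: b; case: (phi f).
have [M ->] := reflection_mirror f.
case: (a (+) b) IH => -[N ->].
  have [L e] := mirror_act N; have [K eK] := act_mul M L.
  exists K; rewrite -eK -e; apply/funext => x /=; by [].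
have [L e] := mirror_act N; have [K eK] := act_mul M L.
exists K; rewrite -eK -e; apply/funext => x /=; by rewrite mirrorK.
Qed.

Let G_act w : G w -> exists M, w = act M.
Proof. exact: Wact. Qed.

(** A matrix close to the identity keeps [o] inside [Q], and only the identity does so. *)
Lemma kernel_kleinian : kleinian G.
Proof.
split; [exact: kernel_is_group|by move=> w /G_act[M ->]; exists M|].
have [d d1 Hd] := interior_ball QE ho.
have [e e0 He] := act_near_id o d1; exists e => // M GM /He/Hd QM.
by have [] := Wtile GM ho QM.
Qed.

(** * The union of the four copies as a fundamental domain *)

Definition domain : set (h3 R) := [set x | exists i j, Q (kk i j x)].
Let P := domain.

(* The walls [wa] and [wb], which are not faces of the union of the four copies
   of [Q] around their intersection. *)
Let inner k := enorm (h k) = enorm (h wa) \/ enorm (h k) = enorm (h wb).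

(** For perpendicular planes the side of [k] is unchanged; for disjoint exteriors the reflected
    point is beyond [s], hence not beyond [k]. *)
Let fold_refl s k x : face Q s -> enorm (h k) <> enorm s ->
  side s x <= 0 -> side (h k) x <= 0 -> side (h k) (reflection s x) <= 0.
Proof.
move=> Fs ne sx kx; have [e|e|e] := tri Fs (hface k); first by case: ne.
  by rewrite side_reflection e mulr0 subr0.
by have := e (reflection s x); rewrite side_reflection_self; lra.
Qed.

Let orth_ab : bil (enorm (h wa)) (enorm (h wb)) = 0.
Proof. by rewrite ea eb /bil /=; ring. Qed.

Let side_a_kk i j x : side (h wa) (kk i j x) = (-1) ^+ i * side (h wa) x.
Proof.
have e y : side (h wa) (sb y) = side (h wa) y.
  by rewrite side_reflection bilC orth_ab mulr0 subr0.
by case: i; case: j; rewrite /kk /= ?side_reflection_self ?e ?expr0 ?expr1 ?mul1r ?mulN1r.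
Qed.

Let side_b_kk i j x : side (h wb) (kk i j x) = (-1) ^+ j * side (h wb) x.
Proof.
have e y : side (h wb) (sa y) = side (h wb) y.
  by rewrite side_reflection orth_ab mulr0 subr0.
by case: i; case: j; rewrite /kk /= ?e ?side_reflection_self ?expr0 ?expr1 ?mul1r ?mulN1r.
Qed.

(** This gives convexity of the union. As [kk i j] is an involution, the inequalities are those of
    the outer faces of all four copies. *)
Lemma domainP x : P x <-> forall i j k, ~ inner k -> side (h k) (kk i j x) <= 0.
Proof.
split=> [[i0 [j0 Qy]] i j k nk|H].
  rewrite -(kkK i0 j0 x) kk_add; move: (kk i0 j0 x) (i (+) i0) (j (+) j0) Qy => y {}i {}j Qy.
  have [Sa Sb] : side (h wa) y <= 0 /\ side (h wb) y <= 0 by split; exact: (QE y).1.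
  have Sk : side (h k) y <= 0 by exact: (QE y).1.
  have ka : enorm (h k) <> enorm (h wa) by move=> e; apply: nk; left.
  have kb : enorm (h k) <> enorm (h wb) by move=> e; apply: nk; right.
  have Sbk : side (h k) (sb y) <= 0 by exact: fold_refl.
  have Sba : side (h wa) (sb y) <= 0 by have := side_a_kk false true y; rewrite /kk /= mul1r => ->.
  by case: i; case: j; rewrite /kk //=; exact: fold_refl.
(* These reflections bring [x] to the inner side of both walls [wa] and [wb]. *)
exists (0 < side (h wa) x), (0 < side (h wb) x); apply/QE => k.
have [[e|e]|nk] := pselect (inner k); last exact: H.
- rewrite /side e -/(side (h wa) _) side_a_kk.
  by case: (ltP 0 (side (h wa) x)) => s; rewrite ?expr1 ?expr0; lra.
- rewrite /side e -/(side (h wb) _) side_b_kk.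
  by case: (ltP 0 (side (h wb) x)) => s; rewrite ?expr1 ?expr0; lra.
Qed.

Lemma domain_cover x : exists2 w, G w & (w @` P) x.
Proof.
have [w [a [b [Ww Qx]]]] := Wcover x.
(* Composing with the [kk] of equal parities gives an element of the kernel. *)
have Wg := Wcomp (Wkk a b) Ww; rewrite !addbb in Wg.
have [g [Gg e1 e2]] := Winv Wg; exists g => //.
exists ((kk a b \o w) x); last by have := congr1 (fun u => u x) e2.
by exists a, b; rewrite /= kkK.
Qed.

Let segment_near y z (d : R) : 1 < d -> exists (v : h3 R) (s l : R),
  [/\ 0 < s, 0 < l, comb 1 (pt y) s (pt z) = comb l (pt v) 0 (pt v) & chd y v < d].
Proof.
move=> d1; set c := chd y z; have c1 : 1 <= c := chd_ge1 y z.
(* For the resulting point, ([chd y v])^2 <= 1 + s^2 (c^2 - 1) <= 1 + s c^2 <= d < d^2. *)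
pose s := Num.min 1 ((d - 1) / c ^+ 2).
have c2 : 0 < c ^+ 2 by rewrite exprn_gt0 //; lra.
have s0 : 0 < s by rewrite lt_min ltr01 divr_gt0 // subr_gt0.
have s1 : s <= 1 by rewrite ge_min lexx.
have s2 : s * c ^+ 2 <= d - 1 by rewrite -ler_pdivlMr // ge_min lexx orbT.
have [|||v [l [l0 e]]] := @segment_pt _ 1 s y z; [by []|by lra|by lra|].
exists v, s, l; split=> //.
have e1 := congr1 (fun u => - bil (pt y) u) e.
rewrite bil_combr bil_comb1r bil_pt mul1r opprD opprK -!mulrN -/(chd y v) -/(chd y z) -/c in e1.
have e2 := congr1 (fun u => - bil u u) e.
rewrite bil_comb1 bil_comb1r !(bil_combl, bil_combr) !bil_pt (bilC (pt z)) in e2.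
have zc : bil (pt y) (pt z) = - c by rewrite opprK.
rewrite zc in e2; set q := chd y v in e1 *.
have q1 : 1 <= q := chd_ge1 y v.
have l1 : 1 <= l ^+ 2 by nra.
have lq : (l * q) ^+ 2 = l ^+ 2 + s ^+ 2 * (c ^+ 2 - 1).
  by rewrite -e1; move: e2; lra.
have q2 : q ^+ 2 <= 1 + s ^+ 2 * (c ^+ 2 - 1).
  have : 0 <= s ^+ 2 * (c ^+ 2 - 1) by rewrite mulr_ge0 ?sqr_ge0 // subr_ge0; nra.
  by move: lq; rewrite exprMn; nra.
have s3 : s ^+ 2 * (c ^+ 2 - 1) <= s * c ^+ 2 by nra.
rewrite ltNge; apply/negP => dq; have : d ^+ 2 <= q ^+ 2 by nra.
by nra.
Qed.

(** A common point may lie on the boundary of its tile. It is moved slightly towards [o], into the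
    interior of the tile; then [word_tile] applies, and the parities identify the two copies of
    [Q]. *)
Lemma domain_disjoint w : G w -> w <> id ->
  hinterior P `&` w @` hinterior P = set0.
Proof.
move: w => g Gg g1; rewrite -subset0 => y [/hinteriorP[d d1 Hd] [y' /hinteriorP[d' d'1 Hd'] gy]].
apply: g1.
have [i [j Qy]] : P y by apply: Hd; rewrite chdxx.
have [v [s [l [s0 l0 e vd]]]] := segment_near (kk i j y) o d'1.
have vin k : side (h k) v < 0.
  rewrite -(pmulr_rlt0 _ l0) (side_seg _ e) mul1r.
  by have := (QE _).1 Qy k; have := ho k; nra.
have [g' [Gg' e1 e2]] := Winv Gg.
have [i' [j' Qv]] : P (g' (kk i j v)).
  apply: Hd'; have <- : g' y = y' by rewrite -gy; exact: (congr1 (fun u => u y') e2).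
  by rewrite (Wchd _ _ Gg') -(Wchd _ _ (Wkk i j)) kkK.
have Ww := Wcomp (Wkk i' j') (Wcomp Gg' (Wkk i j)).
have [w1 ei ej] := Wtile Ww vin Qv.
have [ii jj] : i' = i /\ j' = j by move: ei ej; rewrite !addFb; case: (i') (i) (j') (j) => [] [] [] [].
have g'1 : g' = id.
  apply/funext => x; have := congr1 (fun u => kk i j (u (kk i j x))) w1.
  by rewrite ii jj /= !kkK.
by rewrite -e1 g'1.
Qed.

(** Coordinates along the sides of the rectangle, which is -a2 <= xi <= a1, -b2 <= eta <= b1, with
    the chosen corner at (a1, b1). *)
Let xi (z : R[i]) := B * cRe z + C * cIm z.
Let eta (z : R[i]) := - C * cRe z + B * cIm z.

Let side_wa x : side (h wa) x * ht x = xi (zc x) - a1.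
Proof. by rewrite side_eq ea /xi /=; field. Qed.
Let side_wa' x : side (h wa') x * ht x = - xi (zc x) - a2.
Proof. by rewrite side_eq ea' /xi /=; field. Qed.
Let side_wb x : side (h wb) x * ht x = eta (zc x) - b1.
Proof. by rewrite side_eq eb /eta /=; field. Qed.
Let side_wb' x : side (h wb') x * ht x = - eta (zc x) - b2.
Proof. by rewrite side_eq eb' /eta /=; field. Qed.

Let vertical_reflection k x : cD (enorm (h k)) = 0 ->
  [/\ ht (reflection (h k) x) = ht x,
      cRe (zc (reflection (h k) x)) = cRe (zc x) - 2 * (side (h k) x * ht x) * cB (enorm (h k)) &
      cIm (zc (reflection (h k) x)) = cIm (zc x) - 2 * (side (h k) x * ht x) * cC (enorm (h k))].
Proof.
move=> D0; set y := reflection (h k) x; set s := side (h k) x.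
have E : pt y = comb 1 (pt x) (- 2 * s) (enorm (h k)) by exact: pt_reflection.
have hy : ht y = ht x.
  by have := congr1 (fun u => cD u) E; rewrite /= D0 mulr0 addr0 mul1r => /invr_inj.
have eB := congr1 (fun u => cB u) E; have eC := congr1 (fun u => cC u) E.
move: eB eC; rewrite /= hy mul1r => eB eC; split=> //.
- rewrite -[LHS](divfK (ht_neq0 x)) eB; field; exact: ht_neq0.
- rewrite -[LHS](divfK (ht_neq0 x)) eC; field; exact: ht_neq0.
Qed.

Let kk_coord i j x : [/\ ht (kk i j x) = ht x,
  xi (zc (kk i j x)) = (if i then 2 * a1 - xi (zc x) else xi (zc x)) &
  eta (zc (kk i j x)) = (if j then 2 * b1 - eta (zc x) else eta (zc x))].
Proof.
have ca y : [/\ ht (sa y) = ht y, xi (zc (sa y)) = 2 * a1 - xi (zc y) & eta (zc (sa y)) = eta (zc y)].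
  have [|e1 e2 e3] := @vertical_reflection wa y; first by rewrite ea.
  rewrite side_wa ea /= in e2 e3; split=> //.
    rewrite {1}/xi e2 e3.
    transitivity (xi (zc y) - 2 * (xi (zc y) - a1) * (B ^+ 2 + C ^+ 2)); first by rewrite /xi; ring.
    by rewrite BC; ring.
  by rewrite /eta e2 e3; ring.
have cb y : [/\ ht (sb y) = ht y, xi (zc (sb y)) = xi (zc y) & eta (zc (sb y)) = 2 * b1 - eta (zc y)].
  have [|e1 e2 e3] := @vertical_reflection wb y; first by rewrite eb.
  rewrite side_wb eb /= in e2 e3; split=> //; first by rewrite /xi e2 e3; ring.
  rewrite {1}/eta e2 e3.
  transitivity (eta (zc y) - 2 * (eta (zc y) - b1) * (B ^+ 2 + C ^+ 2)); first by rewrite /eta; ring.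
  by rewrite BC; ring.
by case: i; case: j; rewrite /kk /=; have [? ? ?] := ca x; have [? ? ?] := cb x;
  have [? ? ?] := ca (sb x); split; congruence.
Qed.

Let xi_eta_inj z z' : xi z = xi z' -> eta z = eta z' -> z = z'.
Proof.
have Re' u : cRe u = B * xi u - C * eta u.
  by rewrite -[LHS]mul1r -BC /xi /eta; ring.
have Im' u : cIm u = C * xi u + B * eta u.
  by rewrite -[LHS]mul1r -BC /xi /eta; ring.
by move=> e1 e2; apply: complex_eq; rewrite ?Re' ?Im' e1 e2.
Qed.

Let widths : - a2 < a1 /\ - b2 < b1.
Proof.
have := ho wa; have := ho wa'; have := ho wb; have := ho wb'.
rewrite !side_lt0 side_wa side_wa' side_wb side_wb'; lra.
Qed.

Let not_inner_vertical k : ~ inner k -> cD (enorm (h k)) = 0 ->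
  enorm (h k) = enorm (h wa') \/ enorm (h k) = enorm (h wb').
Proof.
move=> nk D0; have [[e|e]|[e|e]] := vert (hface k) D0; [|by left| |by right].
  by case: nk; left.
by case: nk; right.
Qed.

Let a'_not_inner : ~ inner wa'.
Proof.
move=> [e|e]; first by move: e; rewrite ea ea' => -[_ e1 e2]; move: BC; nra.
by have := phi_plane e; rewrite phi_b phi_a'.
Qed.

Let b'_not_inner : ~ inner wb'.
Proof.
move=> [e|e]; first by have := phi_plane e; rewrite phi_b' phi_a.
by move: e; rewrite eb eb' => -[_ e1 e2]; move: BC; nra.
Qed.

Let wall_vrefl k : cD (enorm (h k)) = 0 ->
  exists n c, n != 0 /\ reflection (h k) = Defs.vrefl n c.
Proof.
have [[n [c [n0 ->]]] _|[p [r [r0 ->]]]] := shape (hface k); first by exists n, c.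
by move=> /= /eqP; rewrite invr_eq0 gt_eqF.
Qed.

(** Needed because a polyhedron is presented by data of type [halfspace], also for the outer faces
    of the reflected copies. *)
Let halfspace_vrefl n c f : n != 0 ->
  exists g, forall x, hs_set g x <-> hs_set f (Defs.vrefl n c x).
Proof.
move=> n0; have N0 := normc_gt0 n0; have N2 := normc_sqr n.
have Nn : cRe n ^+ 2 + cIm n ^+ 2 != 0 by rewrite -N2 sqrf_eq0 gt_eqF.
pose v (p : R[i]) := p - (2 * (cdot n p - c) / normc n ^+ 2)%:C%C * n.
have vE (p : R[i]) x : sqdist p (Defs.vrefl n c x) = sqdist (v p) x.
  rewrite /sqdist /v !normc_sqr /= !cdotE N2; move: (n) Nn (p) (x) => [n1 n2] /= Nn [p1 p2] [[x1 x2] t t0] /=.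
  by field.
case: f => [n' c' n'0|p r r0|p r r0].
- pose u := n' - (2 * cdot n n' / normc n ^+ 2)%:C%C * n.
  have u0 : u != 0.
    apply/eqP => u0; have : normc u ^+ 2 = normc n' ^+ 2.
      rewrite /u !normc_sqr !cdotE; move: (n) Nn (n') => [n1 n2] /= Nn [p1 p2] /=; by field.
    rewrite u0 ComplexField.Normc.normc0 expr0n /= => /eqP; rewrite eq_sym sqrf_eq0.
    by rewrite gt_eqF // normc_gt0.
  exists (Vertical (c' - 2 * cdot n n' * c / normc n ^+ 2) u0) => x.
  rewrite /= -![_ <= c']subr_ge0 -[cdot u _ <= _]subr_ge0.
  set l := _ - cdot u _; set r := c' - _; suff -> : l = r by [].
  rewrite /l /r /u !cdotE N2; move: (n) Nn (n') (x) => [n1 n2] /= Nn [p1 p2] [[x1 x2] t t0] /=.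
  by field.
- by exists (Inside (v p) r0) => x; rewrite /= vE.
- by exists (Outside (v p) r0) => x; rewrite /= vE.
Qed.

Lemma domain_polyhedron : polyhedron P.
Proof.
have [|na [ca [na0 sE]]] := @wall_vrefl wa; first by rewrite ea.
have [|nb [cb [nb0 sbE]]] := @wall_vrefl wb; first by rewrite eb.
split.
(* Inner walls are replaced by [wa'], which is not inner; the repetition allows indexing by all
   faces. *)
- pose k' k := if `[< inner k >] then wa' else k.
  have /choice[H HH] : forall q : 'I_m * (bool * bool), exists g, forall x,
      hs_set g x <-> hs_set (h (k' q.1)) (kk q.2.1 q.2.2 x).
    move=> [k [i j]] /=.
    have step l c f (d : bool) : l != 0 -> exists g, forall x,
        hs_set g x <-> hs_set f ((if d then Defs.vrefl l c else id) x).
      by move=> l0; case: d; [exact: halfspace_vrefl|exists f].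
    have [g1 H1] := step na ca (h (k' k)) i na0.
    have [g2 H2] := step nb cb g1 j nb0.
    by exists g2 => x; rewrite H2 H1 /kk /sa /sb sE sbE.
  exists #|{: 'I_m * (bool * bool)}|, (fun q => H (enum_val q)).
  apply/seteqP; split=> x.
    move=> /(domainP x) Px q; apply/HH/hs_setE/Px.
    by rewrite /k'; case: asboolP => // _; exact: a'_not_inner.
  move=> Hx; apply/(domainP x) => i j k nk.
  have := Hx (enum_rank (k, (i, j))); rewrite enum_rankK => /HH/hs_setE /=.
  by rewrite /k'; case: asboolP.
- exists o; apply/hinteriorP; have [d d1 Hd] := interior_ball QE ho.
  by exists d => // y /Hd Qy; exists false, false.
- pose Xa := [set x | Q (Defs.vrefl na ca x)].
  pose Xb := [set x | Q (Defs.vrefl nb cb x)].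
  pose Xab := [set x | Xa (Defs.vrefl nb cb x)].
  have mQ := polyhedron_measurable QE.
  have [mXa vXa] := hvolume_vrefl ca na0 mQ.
  have [mXb vXb] := hvolume_vrefl cb nb0 mQ.
  have [mXab vXab] := hvolume_vrefl cb nb0 mXa.
  have -> : P = (Q `|` Xa) `|` (Xb `|` Xab).
    apply/seteqP; split=> [x [[] [[] Qx]]|x].
    + by right; right; rewrite /Xab /Xa /= -sE -sbE.
    + by left; right; rewrite /Xa /= -sE.
    + by right; left; rewrite /Xb /= -sbE.
    + by left; left.
    + move=> [[Qx|Qx]|[Qx|Qx]]; [by exists false, false| | |].
      * by exists true, false; rewrite /kk /= /sa sE.
      * by exists false, true; rewrite /kk /= /sb sbE.
      * by exists true, true; rewrite /kk /= /sa /sb sE sbE.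
  have m1 : measurable (@coord R @` (Q `|` Xa)) by rewrite image_setU; exact: measurableU.
  have m2 : measurable (@coord R @` (Xb `|` Xab)) by rewrite image_setU; exact: measurableU.
  by apply: hvolume_setU_lt => //; apply: hvolume_setU_lt => //; rewrite ?vXa ?vXb ?vXab ?vXa.
Qed.

Lemma domain_fundamental : fundamental_domain G P.
Proof.
by split; [exact: domain_polyhedron|exact: domain_cover|exact: domain_disjoint].
Qed.

(** * The Dirichlet domain centred above the corner *)

Let w0 : h3 R := H3 ((a1 * B - b1 * C) +i* (a1 * C + b1 * B))%C (addr_gt0 T0 ltr01).

Let xi_w0 : xi (zc w0) = a1.
Proof. by rewrite /xi /= -[RHS]mulr1 -BC; ring. Qed.

Let eta_w0 : eta (zc w0) = b1.
Proof. by rewrite /eta /= -[RHS]mulr1 -BC; ring. Qed.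

Let kk_w0 i j : kk i j w0 = w0.
Proof.
have [e1 e2 e3] := kk_coord i j w0; apply: h3_eq => //.
by apply: xi_eta_inj; rewrite ?e2 ?e3 ?xi_w0 ?eta_w0; case: ifP => // _; ring.
Qed.

(** The height T + 1 puts [w0] above all hemispheres, and the corner lies strictly inside the two
    opposite sides. *)
Let w0_neg k : ~ inner k -> side (h k) w0 < 0.
Proof.
move=> nk; have [D0|D0] := eqVneq (cD (enorm (h k))) 0; last first.
  by apply: high => //=; rewrite ltrDl.
have [wa0 wb0] := widths.
have [e|e] := not_inner_vertical nk D0; rewrite /side e.
  by rewrite -/(side (h wa') w0) side_lt0 side_wa' xi_w0; lra.
by rewrite -/(side (h wb') w0) side_lt0 side_wb' eta_w0; lra.
Qed.

Let Q_w0 : Q w0.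
Proof.
apply/QE => k; have [[e|e]|/w0_neg/ltW//] := pselect (inner k); rewrite /side e.
  by rewrite -/(side (h wa) w0) side_le0 side_wa xi_w0 subrr.
by rewrite -/(side (h wb) w0) side_le0 side_wb eta_w0 subrr.
Qed.

(** The reflection in the k-th face of the copy [kk i j] of [Q]; conjugation leaves the parities of
    the letter unchanged. *)
Let conj_refl i j k := kk i j \o reflection (h k) \o kk i j.

Let Wconj i j k : W (conj_refl i j k) (~~ phi (h k)) (phi (h k)).
Proof.
have := Wcomp (Wkk i j) (Wcomp (W1 (hface k)) (Wkk i j)).
by rewrite [_ (+) i]addbC [_ (+) j]addbC !addbA !addbb !addFb.
Qed.

Lemma domain_dirichlet : P = dirichlet_set G w0.
Proof.
apply/seteqP; split=> [x [i [j Qy]] g Gg _|x Dx].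
  rewrite hdist_le; have Wg := Wcomp (Wkk i j) Gg.
  (* Seen from a point of [Q], each reflection in a folded word takes the image of [w0] farther
     away. *)
  have := Wfold (F := fun v => - chd (kk i j x) v) (x := w0) _ Wg Q_w0.
  rewrite -(Wchd x w0 (Wkk i j)) -(Wchd x (g w0) (Wkk i j)) kk_w0 lerN2; apply.
  move=> f y Ff fy; rewrite lerN2 chd_reflection_r lerDl.
  have [Qf _] := (faceP Q f).1 Ff; have := Qf _ Qy.
  by move=> fx; rewrite -mulrA mulr_ge0 // mulr_le0.
apply/(domainP x) => i j k nk.
(* The [kk] factor cancels the parities and fixes [w0], so [g w0] is the mirror image of [w0] in the
   violated face. *)
pose g := conj_refl i j k \o kk (~~ phi (h k)) (phi (h k)).
have Gg : G g by have := Wcomp (Wconj i j k) (Wkk (~~ phi (h k)) (phi (h k))); rewrite !addbb.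
have gw : g w0 = kk i j (reflection (h k) w0) by rewrite /g /conj_refl /= !kk_w0.
have k0 := w0_neg nk.
have g1 : g <> id.
  move=> e; have : reflection (h k) w0 = w0.
    by rewrite -(kkK i j (reflection _ _)) -gw e kk_w0.
  move=> /(congr1 (side (h k))); rewrite side_reflection_self; lra.
have := Dx g Gg g1; rewrite hdist_le gw -(Wchd x (kk i j _) (Wkk i j)) kkK chd_reflection_r.
rewrite -{2}(kk_w0 i j) (Wchd _ _ (Wkk i j)); nra.
Qed.

(** * The cusp subgroup, its polygon and the Ford domain *)

Let ht_fold f y : face Q f -> side f y <= 0 -> ht (reflection f y) <= ht y.
Proof.
move=> /shape[[n [c [n0 ->]]]|[p [r [r0 ->]]]]; first by move=> _; exact: lexx.
move=> /hs_setE ry; have S0 := sqdist_gt0 p y.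
suff : r ^+ 2 / sqdist p y <= 1 by have := ht_gt0 y; move=> y0 le; rewrite [ht _]/=; exact: ler_piMl (ltW y0) le.
by rewrite ler_pdivrMr // mul1r.
Qed.

(** The reflections in two opposite sides have the same parities, so their product, a translation by
    twice the width, is in the kernel. *)
Let G_translation (i j : int) : exists u : R[i],
  [/\ G (translation u), xi u = i%:~R * (2 * (a1 + a2)) & eta u = j%:~R * (2 * (b1 + b2))].
Proof.
have [Gid GM GV] := kernel_is_group.
have trD u v : translation u \o translation v = translation (u + v) :> (h3 R -> h3 R).
  by apply/funext => x; apply: h3_eq => //=; rewrite addrAC addrA.
have trN u : G (translation u) -> G (translation (- u)).
  move=> /GV[v [Gv e1 e2]]; suff -> : translation (- u) = v by [].
  apply/funext => x.
  have -> : translation (- u) x = v (translation u (translation (- u) x)).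
    by have := congr1 (fun t => t (translation (- u) x)) e2.
  by congr v; apply: h3_eq => //=; rewrite addrNK.
have mul u (k : int) : G (translation u) -> exists v,
    [/\ G (translation v), xi v = k%:~R * xi u & eta v = k%:~R * eta u].
  move=> Gu; have nat_mul (l : nat) : exists v,
    [/\ G (translation v), xi v = l%:R * xi u & eta v = l%:R * eta u].
    elim: l => [|l [v [Gv e1 e2]]].
      exists 0; split; rewrite ?mul0r; [|by rewrite /xi /=; ring|by rewrite /eta /=; ring].
      suff -> : translation 0 = id :> (h3 R -> h3 R) by [].
      by apply/funext => x; apply: h3_eq => //=; rewrite addr0.
    exists (u + v); split; first by rewrite -trD; exact: GM.
      by rewrite -natr1 mulrDl mul1r -e1 /xi; case: (u) (v) => ? ? [? ?] /=; ring.
    by rewrite -natr1 mulrDl mul1r -e2 /eta; case: (u) (v) => ? ? [? ?] /=; ring.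
  case: (intP k) => [|l|l]; first by exact: (nat_mul 0%N).
    exact: (nat_mul l.+1).
  have [v [Gv e1 e2]] := nat_mul l.+1; exists (- v); split; first exact: trN.
    by rewrite mulrNz mulNr -e1 /xi; case: (v) => ? ? /=; ring.
  by rewrite mulrNz mulNr -e2 /eta; case: (v) => ? ? /=; ring.
have base (c c' : R) : exists u : R[i], xi u = c /\ eta u = c'.
  exists ((c * B - c' * C) +i* (c * C + c' * B))%C.
  by rewrite /xi /eta /=; split; rewrite -[RHS]mulr1 -BC; ring.
have [u1 [x1 e1]] := base (2 * (a1 + a2)) 0.
have [u2 [x2 e2]] := base 0 (2 * (b1 + b2)).
have xiD u v : xi (u + v) = xi u + xi v by rewrite /xi; case: u v => ? ? [? ?] /=; ring.
have etaD u v : eta (u + v) = eta u + eta v by rewrite /eta; case: u v => ? ? [? ?] /=; ring.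
have G1 : G (translation u1).
  have Wab : G (sa \o reflection (h wa')).
    by have := Wcomp (W1 (hface wa)) (W1 (hface wa')); rewrite phi_a phi_a'.
  suff -> : translation u1 = sa \o reflection (h wa') by [].
  apply/funext => x; have [|t1 t2 t3] := @vertical_reflection wa' x; first by rewrite ea'.
  rewrite side_wa' ea' /= in t2 t3.
  have xa : xi (zc (reflection (h wa') x)) = - 2 * a2 - xi (zc x).
    rewrite {1}/xi t2 t3.
    transitivity (xi (zc x) + 2 * (- xi (zc x) - a2) * (B ^+ 2 + C ^+ 2)); first by rewrite /xi; ring.
    by rewrite BC; ring.
  have xe : eta (zc (reflection (h wa') x)) = eta (zc x) by rewrite /eta t2 t3; ring.
  have [s1 s2 s3] := kk_coord true false (reflection (h wa') x).
  apply: h3_eq => /=; last by rewrite -t1 -s1.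
  apply: xi_eta_inj; first by rewrite xiD x1 [RHS]s2 xa; ring.
  by rewrite etaD e1 [RHS]s3 xe; ring.
have G2 : G (translation u2).
  have Wab : G (sb \o reflection (h wb')).
    by have := Wcomp (W1 (hface wb)) (W1 (hface wb')); rewrite phi_b phi_b'.
  suff -> : translation u2 = sb \o reflection (h wb') by [].
  apply/funext => x; have [|t1 t2 t3] := @vertical_reflection wb' x; first by rewrite eb'.
  rewrite side_wb' eb' /= in t2 t3.
  have xa : eta (zc (reflection (h wb') x)) = - 2 * b2 - eta (zc x).
    rewrite {1}/eta t2 t3.
    transitivity (eta (zc x) + 2 * (- eta (zc x) - b2) * (B ^+ 2 + C ^+ 2)); first by rewrite /eta; ring.
    by rewrite BC; ring.
  have xe : xi (zc (reflection (h wb') x)) = xi (zc x) by rewrite /xi t2 t3; ring.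
  have [s1 s2 s3] := kk_coord false true (reflection (h wb') x).
  apply: h3_eq => /=; last by rewrite -t1 -s1.
  apply: xi_eta_inj; first by rewrite xiD x2 [RHS]s2 xe; ring.
  by rewrite etaD e2 [RHS]s3 xa; ring.
have [v1 [H1 p1 q1]] := mul _ i G1; have [v2 [H2 p2 q2]] := mul _ j G2.
exists (v1 + v2); split; first by rewrite -trD; exact: GM.
  by rewrite xiD p1 p2 x1 x2; ring.
by rewrite etaD q1 q2 e1 e2; ring.
Qed.

Lemma kernel_Z2 : contains_Z2 (stab_infinity G).
Proof.
have [wa0 wb0] := widths.
have /choice[u Hu] : forall ij : int * int, exists u : R[i],
  [/\ G (translation u), xi u = ij.1%:~R * (2 * (a1 + a2)) & eta u = ij.2%:~R * (2 * (b1 + b2))].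
  by move=> [i j]; exact: G_translation.
exists (fun ij => translation (u ij)); split.
- move=> ij; have [M [e c0 _]] := translation_act (u ij).
  by exists M => //; split=> //; rewrite e; have [] := Hu ij.
- move=> p q; apply/funext => x; apply: h3_eq => //=.
  have [_ e1 e2] := Hu p; have [_ e3 e4] := Hu q; have [_ e5 e6] := Hu (p + q).
  rewrite -addrA [_ + u p]addrC; congr (_ + _); apply: xi_eta_inj.
    rewrite e5 /= mulrzDr mulrDl -e1 -e3 /xi; case: (u p) (u q) => ? ? [? ?] /=; ring.
  rewrite e6 /= mulrzDr mulrDl -e2 -e4 /eta; case: (u p) (u q) => ? ? [? ?] /=; ring.
- move=> p q e.
  have uu : u p = u q.
    by have := congr1 (fun t => zc (t w0)) e => /= /addrI.
  have [_ e1 e2] := Hu p; have [_ e3 e4] := Hu q; rewrite uu in e1 e2.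
  have [la lb] : 2 * (a1 + a2) != 0 /\ 2 * (b1 + b2) != 0 by split; apply: lt0r_neq0; lra.
  case: p q {e uu} e1 e2 e3 e4 => p1 p2 [q1 q2] /= -> -> /(mulIf la)/eqP + /(mulIf lb)/eqP.
  by rewrite !eqr_int => /eqP-> /eqP->.
Qed.

(** The rectangle of [Q] together with its mirror images in the sides xi = a1 and eta = b1. *)
Let rect : set R[i] := [set z | [/\ - a2 <= xi z, xi z <= 2 * a1 + a2,
                                    - b2 <= eta z & eta z <= 2 * b1 + b2]].

Let normc_xi_eta z : normc z ^+ 2 = xi z ^+ 2 + eta z ^+ 2.
Proof.
rewrite normc_sqr -[LHS]mulr1 -BC /xi /eta; ring.
Qed.

Lemma rect_polygon : polygon rect.
Proof.
have [wa0 wb0] := widths.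
split.
- pose n (i : 'I_4) := [:: (- B +i* - C)%C; (B +i* C)%C; (C +i* - B)%C; (- C +i* B)%C]`_i.
  pose c (i : 'I_4) := [:: a2; 2 * a1 + a2; b2; 2 * b1 + b2]`_i.
  exists 4%N, n, c; split.
    have nz (s t : R) : s ^+ 2 + t ^+ 2 = 1 -> (s +i* t)%C != 0 :> R[i].
      by move=> e; apply/eqP => -[s0 t0]; move: e; rewrite s0 t0 expr0n addr0 => /eqP; rewrite eq_sym oner_eq0.
    by case=> -[|[|[|[|//]]]] i4; rewrite /n /=; apply: nz; rewrite ?sqrrN // addrC.
  apply/seteqP; split=> z.
    move=> [h1 h2 h3' h4] [[|[|[|[|//]]]] i4]; rewrite /n /c /= cdotE /=; move: h1 h2 h3' h4; rewrite /xi /eta; lra.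
  move=> H; have := H (Ordinal (isT : (0 < 4)%N)); have := H (Ordinal (isT : (1 < 4)%N)).
  have := H (Ordinal (isT : (2 < 4)%N)); have := H (Ordinal (isT : (3 < 4)%N)).
  by rewrite /n /c /= !cdotE /= /rect /= /xi /eta; split; lra.
- pose S := `|a1| + `|a1| + `|a2| + (`|b1| + `|b1| + `|b2|).
  exists S => z [h1 h2 h3' h4].
  have n1 := ler_norm a1; have n2 := ler_norm a2; have n3 := ler_norm b1; have n4 := ler_norm b2.
  have m1 := normr_ge0 a1; have m2 := normr_ge0 a2; have m3 := normr_ge0 b1; have m4 := normr_ge0 b2.
  have x1 : `|xi z| <= `|a1| + `|a1| + `|a2| by rewrite ler_norml; lra.
  have x2 : `|eta z| <= `|b1| + `|b1| + `|b2| by rewrite ler_norml; lra.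
  rewrite -ler_sqr ?nnegrE ?normc_ge0 //; last by rewrite /S; lra.
  rewrite normc_xi_eta -(real_normK (num_real (xi z))) -(real_normK (num_real (eta z))) /S.
  have := normr_ge0 (xi z); have := normr_ge0 (eta z).
  by move: `|xi z| `|eta z| x1 x2 => ? ? *; nra.
- pose e := Num.min (a1 + a2) (b1 + b2); have e0 : 0 < e by rewrite lt_min; apply/andP; split; lra.
  have [e1 e2] : e <= a1 + a2 /\ e <= b1 + b2 by rewrite /e !ge_min !lexx orbT.
  exists (zc w0); exists e => // w.
  set v := w - zc w0 => ve.
  have v2 : normc v ^+ 2 < e ^+ 2 by rewrite ltr_sqr ?nnegrE ?normc_ge0 // ltW.
  rewrite normc_xi_eta in v2.
  have x1 : `|xi v| <= e.
    by rewrite -ler_sqr ?nnegrE ?(ltW e0) // real_normK ?num_real //; have := sqr_ge0 (eta v); lra.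
  have x2 : `|eta v| <= e.
    by rewrite -ler_sqr ?nnegrE ?(ltW e0) // real_normK ?num_real //; have := sqr_ge0 (xi v); lra.
  have vx : xi v = xi w - a1 by rewrite -xi_w0 /v /xi; case: (w) (zc w0) => ? ? [? ?] /=; ring.
  have vy : eta v = eta w - b1 by rewrite -eta_w0 /v /eta; case: (w) (zc w0) => ? ? [? ?] /=; ring.
  move: x1 x2; rewrite vx vy !ler_norml /rect /= => /andP[? ?] /andP[? ?]; split; lra.
Qed.

Let translation_stab i j : exists (M : sl2 R) (u : R[i]), [/\ in_stab_infinity G M,
  forall z, act_plane M z = z + u, xi u = i%:~R * (2 * (a1 + a2)) & eta u = j%:~R * (2 * (b1 + b2))].
Proof.
have [u [Gu e1 e2]] := G_translation i j; have [M [e c0 ap]] := translation_act u.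
by exists M, u; split=> //; split=> //; rewrite e.
Qed.

Let floor_exists (s l t : R) : 0 < l -> exists k : int, s <= t - k%:~R * l <= s + l.
Proof.
move=> l0; exists (Num.floor ((t - s) / l)); set k := Num.floor _.
have k1 : k%:~R <= (t - s) / l by exact: floor_le.
have k2 : (t - s) / l < k%:~R + 1 by have := floorD1_gt ((t - s) / l); rewrite -/k intrD.
move: k1 k2; rewrite ler_pdivlMr // ltr_pdivrMr // => k1 k2; apply/andP; split; lra.
Qed.

Lemma rect_cover z : exists2 M, in_stab_infinity G M & (act_plane M @` rect) z.
Proof.
have [wa0 wb0] := widths.
have [|i /andP[i1 i2]] := @floor_exists (- a2) (2 * (a1 + a2)) (xi z); first by lra.
have [|j /andP[j1 j2]] := @floor_exists (- b2) (2 * (b1 + b2)) (eta z); first by lra.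
have [M [u [GM ap e1 e2]]] := translation_stab i j; exists M => //.
exists (z - u); last by rewrite ap subrK.
have x1 : xi (z - u) = xi z - i%:~R * (2 * (a1 + a2)).
  by rewrite -e1 /xi; case: (z) (u) => ? ? [? ?] /=; ring.
have x2 : eta (z - u) = eta z - j%:~R * (2 * (b1 + b2)).
  by rewrite -e2 /eta; case: (z) (u) => ? ? [? ?] /=; ring.
by rewrite /rect /= x1 x2; split; lra.
Qed.

Let rect_interior z : cinterior rect z ->
  [/\ - a2 < xi z, xi z < 2 * a1 + a2, - b2 < eta z & eta z < 2 * b1 + b2].
Proof.
move=> [e e0 He].
have near (s t : R) : s ^+ 2 + t ^+ 2 = 1 -> exists w : R[i], [/\ rect w,
    xi w = xi z + e / 2 * s & eta w = eta z + e / 2 * t].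
  move=> st; pose v := (e / 2 * (s * B - t * C) +i* (e / 2 * (s * C + t * B)))%C.
  have xv : xi v = e / 2 * s by rewrite /xi /= -[RHS]mulr1 -BC; ring.
  have yv : eta v = e / 2 * t by rewrite /eta /= -[RHS]mulr1 -BC; ring.
  exists (z + v); split.
  - apply: He; rewrite -ltr_sqr ?nnegrE ?normc_ge0 ?(ltW e0) //.
    rewrite (_ : z + v - z = v); last by rewrite addrAC subrr add0r.
    rewrite normc_xi_eta xv yv.
    rewrite (_ : _ + _ = e ^+ 2 / 4 * (s ^+ 2 + t ^+ 2)); last by field.
    by rewrite st; have := exprn_gt0 2 e0; lra.
  - by rewrite -xv /xi; case: (z) (v) => ? ? [? ?] /=; ring.
  - by rewrite -yv /eta; case: (z) (v) => ? ? [? ?] /=; ring.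
have [|w1 [[A1 A2 A3 A4] A5 A6]] := near 1 0; first by ring.
have [|w2 [[B1 B2 B3 B4] B5 B6]] := near (-1) 0; first by ring.
have [|w3 [[C1 C2 C3 C4] C5 C6]] := near 0 1; first by ring.
have [|w4 [[D1 D2 D3 D4] D5 D6]] := near 0 (-1); first by ring.
by split; lra.
Qed.

Let high_interior x : cinterior rect (zc x) -> T < ht x -> hinterior P x.
Proof.
move=> /rect_interior[x1 x2 y1 y2] hx.
have neg i j k : ~ inner k -> side (h k) (kk i j x) < 0.
  move=> nk; have [e1 e2 e3] := kk_coord i j x.
  have [D0|D0] := eqVneq (cD (enorm (h k))) 0; last by apply: high; rewrite ?e1.
  have [e|e] := not_inner_vertical nk D0; rewrite /side e.
    by rewrite -/(side (h wa') _) side_lt0 side_wa' e2; case: ifP => _; lra.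
  by rewrite -/(side (h wb') _) side_lt0 side_wb' e3; case: ifP => _; lra.
have /choice[d Hd] : forall q : 'I_m * (bool * bool), exists d, 1 < d /\
    (~ inner q.1 -> forall y, chd x y < d -> side (h q.1) (kk q.2.1 q.2.2 y) <= 0).
  move=> [k [i j]] /=; have [kn|kn] := pselect (inner k); first by exists 2; split=> //; lra.
  have [d d1 Hd] := hs_nbhd (ltr0_neq0 (neg i j k kn)); exists d; split=> // _ y xy.
  have := Hd (kk i j y); rewrite (Wchd _ _ (Wkk i j)) nmulr_rgt0; last exact: neg.
  by move=> /(_ xy)/ltW.
have [d' d'1 Hd'] := finite_lower_bound (fun q => (Hd q).1).
apply/hinteriorP; exists d' => // y xy; apply/(domainP y) => i j k nk.
by apply: (Hd (k, (i, j))).2 => //; exact: lt_le_trans (Hd' _).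
Qed.

(** The stabilizer of infinity need not be classified: overlapping polygons would make the images of
    [P] overlap at great height. *)
Lemma rect_fundamental : fundamental_polygon G rect.
Proof.
split; [exact: rect_polygon|exact: rect_cover|].
move=> M [GM c0] M1; rewrite -subset0 => z [zi [z' z'i zE]].
have [_ _ nd] := act_infinity w0 c0; set q := normc (md M) in nd.
(* Chosen so that both [t] and the height t / q^2 of the image exceed [T]. *)
pose t := (T + 1) * (1 + q ^+ 2); have q2 : 0 < q ^+ 2 by rewrite exprn_gt0.
have tT : T < t.
  rewrite /t mulrDr mulr1 -addrA ltrDl addr_gt0 // mulr_gt0 //; have := T0; lra.
have tq : T * q ^+ 2 < t.
  by rewrite /t mulrDl mul1r mulrDr mulr1; have := mulr_ge0 (ltW T0) (ltW q2); have := T0; lra.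
have t0 : 0 < t := lt_trans T0 tT.
pose x := H3 z' t0; have [e1 e2 _] := act_infinity x c0.
suff : (hinterior P `&` act M @` hinterior P) (act M x) by rewrite (domain_disjoint GM M1).
split; last by exists x => //; apply: high_interior.
apply: high_interior; first by rewrite e1 /= zE.
by rewrite e2 -/q /= ltr_pdivlMr.
Qed.

Lemma domain_Ford : is_Ford_domain G P.
Proof.
split; first exact: kernel_Z2.
exists rect; first exact: rect_fundamental.
apply/seteqP; split=> [x Px|x [Ox Cx]].
  split; last first.
    rewrite /chimney /rect /=; split.
    - have := (domainP x).1 Px false false wa' a'_not_inner; rewrite side_le0 side_wa'.
      by have [_ -> _] := kk_coord false false x; lra.
    - have := (domainP x).1 Px true false wa' a'_not_inner; rewrite side_le0 side_wa'.
      by have [_ -> _] := kk_coord true false x; lra.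
    - have := (domainP x).1 Px false false wb' b'_not_inner; rewrite side_le0 side_wb'.
      by have [_ _ ->] := kk_coord false false x; lra.
    - have := (domainP x).1 Px false true wb' b'_not_inner; rewrite side_le0 side_wb'.
      by have [_ _ ->] := kk_coord false true x; lra.
  move=> M GM c0; rewrite act_outside_isometric //.
  (* [x] is the image under [kk i j] of a point of [Q] at the same height, from which a word leading
     to [act M x] can only descend. *)
  have [i [j Qy]] := Px; have [<- _ _] := kk_coord i j x.
  rewrite -{1}(kkK i j x).
  exact: (Wfold ht_fold (Wcomp GM (Wkk i j)) Qy).
apply/(domainP x) => i j k nk; have [e1 e2 e3] := kk_coord i j x.
have [D0|D0] := eqVneq (cD (enorm (h k))) 0.
  case: Cx => x1 x2 y1 y2.
  have [e|e] := not_inner_vertical nk D0; rewrite /side e.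
    by rewrite -/(side (h wa') _) side_le0 side_wa' e2; case: ifP => _; lra.
  by rewrite -/(side (h wb') _) side_le0 side_wb' e3; case: ifP => _; lra.
have [[n [c [n0 hk]]]|[p [r [r0 hk]]]] := shape (hface k); first by rewrite hk eqxx in D0.
(* Here the factor correcting the parities acts last: it preserves heights, so [g] changes the
   height as the reflection does. *)
pose g := kk (~~ phi (h k)) (phi (h k)) \o conj_refl i j k.
have Gg : G g by have := Wcomp (Wkk (~~ phi (h k)) (phi (h k))) (Wconj i j k); rewrite !addbb.
have hg y : ht (g y) = ht (reflection (h k) (kk i j y)).
  rewrite /g /conj_refl /=.
  by have [-> _ _] := kk_coord (~~ phi (h k)) (phi (h k)) (kk i j (reflection (h k) (kk i j y)));
     have [-> _ _] := kk_coord i j (reflection (h k) (kk i j y)).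
have [M gM] := G_act Gg.
have hr y : ht (reflection (h k) y) = r ^+ 2 / sqdist p y * ht y by rewrite hk.
have c0 : mc M != 0.
  (* An element fixing infinity scales all heights by one constant, whereas the inversion scales
     them by 1 at height [r] above its centre and by 1/4 at height [2 * r]. *)
  apply/eqP => c0; set D := normc (md M) ^+ 2.
  have key y : ht y / D = r ^+ 2 / sqdist p y * ht y.
    have [_ e _] := act_infinity (kk i j y) c0; have [e4 _ _] := kk_coord i j y.
    by rewrite -hr -{2}(kkK i j y) -hg gM e -/D e4.
  have r1 : r != 0 := lt0r_neq0 r0.
  have r20 : 0 < 2 * r by rewrite mulr_gt0.
  have S t (t0 : 0 < t) : sqdist p (H3 p t0) = t ^+ 2.
    by rewrite /sqdist /= subrr ComplexField.Normc.normc0 expr0n add0r.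
  have := key (H3 p r0); have := key (H3 p r20); rewrite !S /= -!/(_ / _).
  rewrite (_ : r ^+ 2 / r ^+ 2 * r = r); last by field.
  rewrite (_ : r ^+ 2 / (2 * r) ^+ 2 * (2 * r) = r / 2); last by field.
  by rewrite -mulrA => k2 k1; have r_gt0 := r0; move: k2; rewrite k1; lra.
have := Ox M; rewrite -gM => /(_ Gg c0); rewrite act_outside_isometric // -gM hg hr -e1 => le.
rewrite hk; apply/hs_setE; have S0 := sqdist_gt0 p (kk i j x).
suff : r ^+ 2 / sqdist p (kk i j x) <= 1 by rewrite ler_pdivrMr // mul1r.
by rewrite -(ler_pM2r (ht_gt0 (kk i j x))) mul1r.
Qed.

End Kernel.

Theorem proposition7p2 (R : realType) (Q : set (h3 R)) :
  polyhedron Q ->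
  all_right Q ->
  ideal_vertex_at_infinity Q ->
  all_vertices_ideal Q ->
  exists Gamma : set (h3 R -> h3 R),
    subgroup_of_index 4 Gamma (reflection_group Q) /\ admits_DF_domain Gamma.
Proof.
move=> Qpoly Qright Qinf Qideal; have [_ _ Qvol] := Qpoly.
have [m [h [ o [QE hface ho]]]] := polyhedron_faces Qpoly.
have tri := @face_trichotomy _ _ _ _ QE hface Qright Qideal.
have shape := @face_shape _ _ Qinf.
have [T T0 high] := high_points hface Qinf.
have [wa [wa' [wb [wb' [B [C [a1 [a2 [b1 [b2 [BC [ea ea' eb eb'] vert]]]]]]]]]]] :=
  rectangle QE hface ho tri Qinf Qvol.
exists (kernel_group Q h wb wb'); split; first exact: (kernel_index QE hface ho tri BC ea eb eb').
split; first exact: kernel_kleinian QE ho tri wb wb'.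
exists (domain Q h wa wb); split.
- exact: (domain_fundamental QE hface ho tri Qvol shape BC ea ea' eb eb').
- exact: (domain_Ford QE hface ho tri shape BC ea ea' eb eb' vert T0 high).
- by eexists; exact: (domain_dirichlet QE hface ho tri BC ea ea' eb eb' vert T0 high).
Qed.
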